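(* Let $P=P_m+\cdots+P_0\in\mathbb C[x_1,\dots,x_d]$, $m\ge3$, $P_k$ homogeneous of degree $k$, be such that $\partial_1P_m(x)=\cdots=\partial_dP_m(x)=0$ implies $x=0$, and put $\mu=(m-1)^d$. Let $R=\{1,\dots,r\}$ and let $\Sigma$ be a real symmetric positive-definite $r\times r$ matrix. (i) For every $S\subset K\subset R$, $H^q(\mathcal C_{K\mid S})=0$ for $q\ne|K|d$, and $\dim_{\mathbf k_S}H^{|K|d}(\mathcal C_{K\mid S})=\mu^{|S|}$. (ii) Let $S\subset I\subset K\subset R$, $J=K\setminus I$, $L_{J\mid I}=\Sigma_{JI}\Sigma_{II}^{-1}$, $C_{J\mid I}=\Sigma_{JJ}-\Sigma_{JI}\Sigma_{II}^{-1}\Sigma_{IJ}$, and for $f\in\mathbf k_S[\boldsymbol x_K]$ set $$\mathsf W^\Sigma_{K\to I}f(\boldsymbol x_I)=\left.\exp\!\left(\tfrac12\Delta^{(\boldsymbol y)}_{C_{J\mid I}}\right)f(\boldsymbol x_I,L_{J\mid I}\boldsymbol x_I+\boldsymbol y_J)\right|_{\boldsymbol y_J=0},\qquad\Delta^{(\boldsymbol y)}_{C_{J\mid I}}=\sum_{a,b\in J}(C_{J\mid I})_{ab}\sum_{\nu=1}^d\partial_{y_{a,\nu}}\partial_{y_{b,\nu}}.$$ The exponential is finite on every polynomial. Under the canonical identifications of determinant orientation lines, normalised Gaussian contraction on the quotient orientation line induces an isomorphism $$\mathbf W^{\Sigma,S}_{K\to I}:H^{|K|d}(\mathcal C_{K\mid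 S})\to H^{|I|d}(\mathcal C_{I\mid S}),\qquad[f\,\mathrm{vol}_K]\mapsto[\mathsf W^\Sigma_{K\to I}f\,\mathrm{vol}_I].$$ (If the quotient orientation is replaced by independently ordered coordinate forms, the corresponding shuffle sign must be inserted.) (iii) For every $S\subset I\subset K\subset L\subset R$ the polynomial conditional Wick operators satisfy strictly $$\mathsf W^{\Sigma_K}_{K\to I}\circ\mathsf W^{\Sigma_L}_{L\to K}=\mathsf W^{\Sigma_L}_{L\to I},$$ and the induced cohomology maps $\mathbf W^{\Sigma,S}$ satisfy the same identity under the canonical associative identifications of determinant orientation lines. Thus every face diagram with common active support $S$ commutes. (iv) If the universal complex is first formed over $\mathbb C[t_a:a\in K]$ and only then specialised to $t_a\ne0$ ($a\in S$), $t_b=0$ ($b\in K\setminus S$), the cohomology of the specialised complex is exactly $H^{|K|d}(\mathcal C_{K\mid S})$. (This is not asserted to be the specialisation of the generic cohomology; hence the maps in (ii) give the canonical face restrictions.) When the retained set $I$ is empty, the conventions are $L_{K\mid\varnothing}=0$, $C_{K\mid\varnothing}=\Sigma_K$, $\mathrm{vol}_\varnothing=1$.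
   Context: For $K\subset R$, $\Sigma_K$ is the principal submatrix of $\Sigma$ indexed by $K$, and $\Sigma_{JI}$ the block with rows $J$, columns $I$. $\boldsymbol x_K=(x_a)_{a\in K}$, $x_a\in$ $d$-dimensional space; $\mathrm{vol}_K$ is the standard volume form in these $|K|d$ variables. For $I\subset K$, $\mathbf k_I=\mathbb C(t_a:a\in I)$, $\mathbf k_\varnothing=\mathbb C$, $$F_{K\mid I}(\boldsymbol x_K)=-\frac12\sum_{a,b\in K}(\Sigma_K^{-1})_{ab}\langle x_a,x_b\rangle+i\sum_{a\in I}t_aP(x_a),$$ $$\mathcal C_{K\mid I}=\bigl(\Omega^\bullet_{\mathbf k_I[\boldsymbol x_K]},\ \mathrm d+\mathrm dF_{K\mid I}\wedge\bigr).$$ The universal complex over $\mathbb C[t_a:a\in K]$ is polynomial forms in $\boldsymbol x_K$ over that ring with the phase in which all $t_a$, $a\in K$, appear. Determinant orientation lines: $\mathfrak o_A=\det((\mathbb R^d)^A)$ with the canonical associative identifications $\mathfrak o_K\simeq\mathfrak o_I\otimes\mathfrak o_{K/I}$. The critical-point condition on $P_m$ is over $x\in\mathbb C^d$. *)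

(* Defs.v *)
From HB Require Import structures.
From mathcomp Require Import all_boot all_order all_algebra.
From mathcomp Require Import fraction ring_quotient generic_quotient.
From mathcomp Require Import boolp reals complex mpoly.

Set Implicit Arguments.
Unset Strict Implicit.
Unset Printing Implicit Defensive.

Import Order.TTheory GRing.Theory Num.Theory.
Local Open Scope ring_scope.

Section Exterior.
Variables (M : comNzRingType) (n : nat).

(* w B is the coefficient of dx_B = dx_{b1} /\ ... /\ dx_{bq}, where
   B = {b1 < ... < bq}. *)
Definition ext := {ffun {set 'I_n} -> M}.

Definition ext_sign (B B' : {set 'I_n}) : M :=
  (-1) ^+ #|[set p : 'I_n * 'I_n | [&& p.1 \in B, p.2 \in B' & (p.2 < p.1)%N]]|.

Definition wedge (w w' : ext) : ext :=
  [ffun D : {set 'I_n} => \sum_(B : {set 'I_n} | B \subset D)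
               ext_sign B (D :\: B) * (w B * w' (D :\: B))].

Definition ext_mono (f : M) (B : {set 'I_n}) : ext :=
  [ffun B' : {set 'I_n} => if B' == B then f else 0].

(* f vol, with vol the wedge of all generators in increasing order *)
Definition vform (f : M) : ext := ext_mono f setT.

Definition of_degree (q : nat) (w : ext) : bool :=
  [forall B : {set 'I_n}, (#|B| != q) ==> (w B == 0)].

End Exterior.

Arguments vform {M n} f.

Notation forms A n := {ffun {set 'I_n} -> {mpoly A[n]}}.

Section DeRham.
Variables (A : comNzRingType) (n : nat).
Implicit Types (w : forms A n) (F : {mpoly A[n]}).

Definition dform w : forms A n :=
  \sum_(v < n) wedge (ext_mono 1 [set v]) [ffun B : {set 'I_n} => (w B)^`M(v)].

Definition nabla F w : forms A n :=
  dform w + wedge (dform (ext_mono F set0)) w.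

Lemma nablaE F w D :
  nabla F w D = \sum_(v in D)
    ext_sign _ [set v] (D :\ v) * ((w (D :\ v))^`M(v) + F^`M(v) * w (D :\ v)).
Proof.
have E1 (u : forms A n) (v : 'I_n) (f : {mpoly A[n]}) :
    wedge (ext_mono f [set v]) u D =
    if v \in D then ext_sign _ [set v] (D :\ v) * (f * u (D :\ v)) else 0.
  rewrite ffunE; case: ifPn => vD.
    rewrite (bigD1 [set v]) ?sub1set //= ffunE eqxx big1 ?addr0 // => B.
    by case/andP=> _ /negPf nB; rewrite ffunE nB mul0r mulr0.
  rewrite big1 // => B BD; rewrite ffunE; case: eqP => [E|_].
    by move: vD; rewrite -sub1set -E BD.
  by rewrite mul0r mulr0.
have dF : dform (ext_mono F set0) = \sum_(v < n) ext_mono (F^`M(v)) [set v].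
  rewrite /dform; apply: eq_bigr => v _; apply/ffunP=> B.
  rewrite !ffunE; case: (eqVneq B [set v]) => [->|nB].
    rewrite (bigD1 [set v]) //= !ffunE eqxx setDv eqxx mul1r.
    rewrite big1 ?addr0.
      rewrite /ext_sign (_ : [set p | _] = set0) ?cards0 ?expr0 ?mul1r //.
      by apply/setP=> p; rewrite !inE andbF.
    move=> B' /andP[_ /negPf nB']; by rewrite ffunE nB' mul0r mulr0.
  rewrite big1 // => B' sB'; rewrite !ffunE; case: eqP => [E|]; last first.
    by rewrite mul0r mulr0.
  case: eqP => [|_]; last by rewrite mderiv0 mulr0 mulr0.
  move/eqP; rewrite setD_eq0 E => sB; rewrite E in sB'.
  by case/eqP: nB; apply/eqP; rewrite eqEsubset sB.
have wedge_suml (f : 'I_n -> forms A n) (u : forms A n) :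
    wedge (\sum_v f v) u D = \sum_v wedge (f v) u D.
  rewrite /wedge ffunE.
  under [RHS]eq_bigr => v _ do rewrite ffunE.
  rewrite exchange_big /=; apply: eq_bigr => B _.
  by rewrite sum_ffunE mulr_suml mulr_sumr.
rewrite /nabla dF ffunE wedge_suml /dform sum_ffunE -big_split /=.
rewrite [RHS]big_mkcond; apply: eq_bigr => v _.
rewrite !E1; case: ifP => _; last by rewrite addr0.
by rewrite ffunE mul1r mulrDr.
Qed.

Lemma nabla_is_linear F : linear (nabla F).
Proof.
move=> c u w; apply/ffunP=> D.
have -> : (c *: nabla F u + nabla F w) D = c *: nabla F u D + nabla F w D.
  by rewrite [LHS]ffunE; congr (_ + _); rewrite [LHS]ffunE.
rewrite !nablaE scaler_sumr -big_split /=; apply: eq_bigr => v _.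
rewrite !ffunE mderivD mderivZ [in RHS]scalerAr -mulrDr; congr (_ * _).
by rewrite mulrDr -scalerAr scalerDr addrACA.
Qed.

HB.instance Definition _ F :=
  GRing.isLinear.Build A (forms A n) (forms A n) *:%R (nabla F) (nabla_is_linear F).

Lemma ext_sign1 (M : comNzRingType) (v : 'I_n) (D : {set 'I_n}) :
  ext_sign M [set v] D = (-1) ^+ #|[set u in D | (u < v)%N]|.
Proof.
have pair_inj : injective (fun u : 'I_n => (v, u)) by move=> a b [].
rewrite /ext_sign -(card_imset _ pair_inj); congr (_ ^+ _); apply: eq_card => -[a b].
rewrite !inE /=; apply/idP/imsetP => [/and3P[/eqP-> bD bv]|[x]].
  by exists b; rewrite ?inE ?bD.
by rewrite !inE => /andP[xD xv] [-> ->]; rewrite eqxx xD.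
Qed.

Lemma nabla_nabla F w : nabla F (nabla F w) = 0.
Proof.
pose T v (f : {mpoly A[n]}) := f^`M(v) + F^`M(v) * f.
have Tsum v (I : finType) (Q : pred I) f k :
    T v (\sum_(u | Q u) (-1) ^+ k u * f u) = \sum_(u | Q u) (-1) ^+ k u * T v (f u).
  rewrite /T mulr_sumr raddf_sum -big_split /=; apply: eq_bigr => u _.
  rewrite -signr_odd; case: odd; rewrite ?expr0 ?expr1 ?mul1r ?mulN1r //.
  by rewrite raddfN mulrN -opprD.
have TC u v f : T u (T v f) = T v (T u f).
  rewrite /T !mderivD !mderivM (mderiv_comm u v f) (mderiv_comm u v F).
  rewrite !mulrDr -!addrA; do 2!congr (_ + _).
  by rewrite addrCA mulrCA.
apply/ffunP=> D; rewrite nablaE [RHS]ffunE.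
pose K E (v : 'I_n) := #|[set u in E :\ v | (u < v)%N]|.
pose G v u := (-1) ^+ (K D v + K (D :\ v) u) * T v (T u (w (D :\ v :\ u))).
have E : \sum_(v in D) ext_sign _ [set v] (D :\ v) *
    ((nabla F w (D :\ v))^`M(v) + F^`M(v) * nabla F w (D :\ v)) =
    \sum_(v in D) \sum_(u in D) (if u == v then 0 else G v u).
  apply: eq_bigr => v vD; rewrite nablaE -/(T v _).
  under eq_bigr => u _ do rewrite ext_sign1 -/(T u _).
  rewrite Tsum ext_sign1 mulr_sumr [RHS]big_mkcond [LHS]big_mkcond /=.
  apply: eq_bigr => u _; rewrite !inE; case: eqP => [_|_]; first by case: ifP.
  by case: ifP => //= uD; rewrite ?uD // mulrA -exprD.
have GC (v u : 'I_n) : v \in D -> u \in D -> (u < v)%N -> G v u + G u v = 0.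
  move=> vD uD uv; rewrite /G TC [D :\ v :\ u]setDDl setUC -setDDl -mulrDl.
  have -> : K (D :\ v) u = K D u.
    apply: eq_card => x; rewrite !inE; case: (ltnP x u) => xu; rewrite ?andbF //.
    by rewrite (_ : x != v) //; apply: contraTneq xu => ->; rewrite -leqNgt ltnW.
  have -> : K D v = (K (D :\ u) v).+1.
    rewrite {1}/K (cardsD1 u) !inE uD uv andbT (_ : u != v) ?add1n; last first.
      by apply: contraTneq uv => ->; rewrite ltnn.
    congr _.+1; apply: eq_card => x; rewrite !inE -!andbA.
    by case: (x == u); case: (x == v); rewrite ?andbF.
  by rewrite addSn exprS mulN1r addnC addNr mul0r.
pose H (v u : 'I_n) := if (u < v)%N then G v u else 0.
pose H' (v u : 'I_n) := if (v < u)%N then G v u else 0.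
rewrite E (_ : \sum_(v in D) _ = \sum_(v in D) \sum_(u in D) (H v u + H' v u)); last first.
  apply: eq_bigr => v _; apply: eq_bigr => u _; rewrite /H /H' -(inj_eq val_inj) /=.
  by case: ltngtP; rewrite ?addr0 ?add0r.
under eq_bigr => v _ do rewrite big_split.
rewrite big_split /= [X in _ + X]exchange_big -big_split /=.
apply: big1 => v vD; rewrite -big_split /=; apply: big1 => u uD.
by rewrite /H /H'; case: ifP => [/GC->|]; rewrite ?addr0.
Qed.

End DeRham.

Section Cohomology.
Variables (A : comNzRingType) (n : nat) (D : {linear forms A n -> forms A n}) (q : nat).

Definition cocycle (w : forms A n) : bool := of_degree q w && (D w == 0).

Lemma cocycle_closed : subsemimod_closed cocycle.
Proof.
have deg0 : of_degree q (0 : forms A n).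
  by apply/forallP=> B; rewrite ffunE eqxx implybT.
split=> [|c u]; first split=> [|u v].
- by rewrite unfold_in /cocycle deg0 raddf0 eqxx.
- rewrite !unfold_in => /andP[du /eqP Du] /andP[dv /eqP Dv].
  rewrite /cocycle raddfD /= Du Dv addr0 eqxx andbT.
  apply/forallP=> B; apply/implyP=> qB; rewrite ffunE.
  by rewrite (eqP (implyP (forallP du B) qB)) (eqP (implyP (forallP dv B) qB)) addr0.
- rewrite !unfold_in => /andP[du /eqP Du]; rewrite /cocycle linearZ /= Du scaler0.
  rewrite eqxx andbT; apply/forallP=> B; apply/implyP=> qB; rewrite ffunE.
  by rewrite (eqP (implyP (forallP du B) qB)) scaler0.
Qed.

HB.instance Definition _ :=
  GRing.isSubmodClosed.Build A (forms A n) cocycle cocycle_closed.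

Record cocycles := Cocycle { cocycle_form : forms A n; _ : cocycle cocycle_form }.

HB.instance Definition _ := [isSub for cocycle_form].
HB.instance Definition _ := [Choice of cocycles by <:].
HB.instance Definition _ := [SubChoice_isSubLmodule of cocycles by <:].

(* The primitive eta has degree q - 1; for q = 0 this forces eta = 0. *)
Definition coboundary (z : cocycles) : bool :=
  `[< exists2 eta : forms A n,
        forall B : {set 'I_n}, #|B|.+1 != q -> eta B = 0 &
        cocycle_form z = D eta >].

Lemma coboundary_closed : subsemimod_closed coboundary.
Proof.
split=> [|c z]; first split=> [|u v].
- by apply/asboolP; exists 0 => [B _|]; rewrite ?ffunE // [RHS]raddf0.
- move=> /asboolP[e1 d1 E1] /asboolP[e2 d2 E2]; apply/asboolP; exists (e1 + e2).
    by move=> B qB; rewrite ffunE d1 // d2 // addr0.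
  by rewrite [RHS]raddfD /= -E1 -E2.
- move=> /asboolP[e d E]; apply/asboolP; exists (c *: e).
    by move=> B qB; rewrite ffunE d // scaler0.
  by rewrite [RHS]linearZ /= -E.
Qed.

HB.instance Definition _ :=
  GRing.isSubmodClosed.Build A cocycles coboundary coboundary_closed.

Definition coh := Quotient.quot (GRing.ZmodClosed.clone cocycles coboundary _).

HB.instance Definition _ := Quotient.on coh.
HB.instance Definition _ := GRing.Zmodule.on coh.

Lemma coh_pi_eq (z z' : cocycles) :
  (\pi_coh z == \pi_coh z')%qT = coboundary (z - z').
Proof. by rewrite -Quotient.idealrBE. Qed.

Lemma coh_piD (z z' : cocycles) :
  (\pi_coh (z + z') = \pi_coh z + \pi_coh z' :> coh)%qT.
Proof. exact: (@Quotient.pi_add _ (GRing.ZmodClosed.clone cocycles coboundary _) z z'). Qed.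

Definition coh_scale (c : A) (h : coh) : coh := (\pi_coh (c *: repr h))%qT.

Lemma coh_scale_pi c z : coh_scale c (\pi_coh z)%qT = (\pi_coh (c *: z))%qT.
Proof.
apply/eqP; rewrite /coh_scale coh_pi_eq -scalerBr [coboundary _]rpredZ //.
by rewrite -[_ \in _]coh_pi_eq reprK.
Qed.

Lemma coh_scaleA a b h : coh_scale a (coh_scale b h) = coh_scale (a * b) h.
Proof. by elim/quotW: h => z; rewrite (coh_scale_pi b) !coh_scale_pi scalerA. Qed.

Lemma coh_scale1 : left_id 1 coh_scale.
Proof. by elim/quotW=> z; rewrite coh_scale_pi scale1r. Qed.

Lemma coh_scaleDr : right_distributive coh_scale +%R.
Proof.
move=> c; elim/quotW=> z; elim/quotW=> z'.
by rewrite -coh_piD !coh_scale_pi -coh_piD scalerDr.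
Qed.

Lemma coh_scaleDl h : {morph coh_scale^~ h : a b / a + b}.
Proof.
by move=> a b; elim/quotW: h => z; rewrite !coh_scale_pi -coh_piD scalerDl.
Qed.

HB.instance Definition _ := GRing.Zmodule_isLmodule.Build A coh
  coh_scaleA coh_scale1 coh_scaleDr coh_scaleDl.

(* The class of a cocycle of degree q; any other form is sent to 0. *)
Definition coh_class (w : forms A n) : coh := (\pi_coh (insubd 0 w))%qT.

(* The representative selected by the quotient type. *)
Definition coh_repr (h : coh) : forms A n := cocycle_form (repr h).

End Cohomology.

Section TopForms.
Variables (A : comNzRingType) (n : nat) (F : {mpoly A[n]}).

Lemma vform_cocycle f : cocycle (nabla F) n (vform f).
Proof.
apply/andP; split.
  apply/forallP=> B; apply/implyP=> nB; rewrite ffunE; case: (B =P setT) => // EB.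
  by move: nB; rewrite EB cardsT card_ord eqxx.
apply/eqP/ffunP=> D; rewrite [RHS]ffunE nablaE big1 // => v _.
rewrite ffunE; case: eqP => [/setP/(_ v)|_]; last by rewrite mderiv0 mulr0 addr0 mulr0.
by rewrite !inE eqxx.
Qed.

Lemma vformE (w : forms A n) : of_degree n w -> w = vform (w setT).
Proof.
move=> dw; apply/ffunP=> B; rewrite ffunE; case: eqP => [->//|/eqP nB].
apply/eqP; apply: (implyP (forallP dw B)); apply: contraNneq nB => cB.
by rewrite eqEcard subsetT cardsT card_ord cB leqnn.
Qed.

End TopForms.

Definition posdef (R : realType) (r : nat) (Sigma : 'M[R]_r) : Prop :=
  forall v : 'rV[R]_r, v != 0 -> 0 < (v *m Sigma *m v^T) 0 0.

Section Model.
Variables (R : realType) (r d : nat).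
Implicit Types (Sigma : 'M[R]_r) (P : {mpoly R[i][d]}).
Implicit Types (S I J K L : {set 'I_r}) (a : 'I_r).

(* A subset K is indexed by 'I_#|K| through enum_val, in increasing order. *)
Definition pos K a : option 'I_#|K| := [pick i : 'I_#|K| | enum_val i == a].

Definition blk J I Sigma : 'M[R]_(#|J|, #|I|) := mxsub enum_val enum_val Sigma.

(* The variables x_{a,nu} of x_K are listed in row-major order; this is also the
   order of the factors of vol_K. *)
Definition npt K := (#|K| * d)%N.

Section Scalars.
Variables (A : comNzRingType) (iota : {rmorphism R[i] -> A}).

Definition rsc (c : R) : A := iota (c%:C)%C.

Definition xmat K : 'M[{mpoly A[npt K]}]_(#|K|, d) :=
  \matrix_(i, nu) 'X_(mxvec_index i nu).

Definition xdot K (i j : 'I_#|K|) : {mpoly A[npt K]} :=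
  \sum_(nu < d) xmat K i nu * xmat K j nu.

Definition Pat P K (i : 'I_#|K|) : {mpoly A[npt K]} :=
  mmap (@mpolyC _ A \o iota) (fun nu => xmat K i nu) P.

(* t a is the coupling at the point a *)
Definition phase Sigma P K I (t : 'I_r -> A) : {mpoly A[npt K]} :=
  - (rsc 2^-1 *: \sum_(i < #|K|) \sum_(j < #|K|)
       rsc (invmx (blk K K Sigma) i j) *: xdot i j)
  + iota 'i%C *: \sum_(i < #|K| | enum_val i \in I) t (enum_val i) *: Pat P i.

(* Wick contraction; here J = K :\: I, and k[x_I, y_J] is the polynomial ring in
   npt I + npt J variables, first x_I and then y_J. *)
Definition Lmat Sigma K I : 'M[R]_(#|K :\: I|, #|I|) :=
  blk (K :\: I) I Sigma *m invmx (blk I I Sigma).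

Definition Cmat Sigma K I : 'M[R]_(#|K :\: I|) :=
  blk (K :\: I) (K :\: I) Sigma
  - blk (K :\: I) I Sigma *m invmx (blk I I Sigma) *m blk I (K :\: I) Sigma.

(* For I empty, L has no columns. *)
Lemma Cmat_set0 Sigma K : Cmat Sigma K set0 = blk (K :\: set0) (K :\: set0) Sigma.
Proof.
apply/matrixP=> i j; rewrite !mxE big1 ?subr0 // => k _.
by have := ltn_ord k; rewrite [X in (_ < X)%N]cards0.
Qed.

Notation xyring K I := {mpoly A[npt I + npt (K :\: I)]}.

Definition wxmat K I : 'M[xyring K I]_(#|I|, d) :=
  \matrix_(i, nu) 'X_(lshift _ (mxvec_index i nu)).

Definition yidx K I (j : 'I_#|K :\: I|) (nu : 'I_d) : 'I_(npt I + npt (K :\: I)) :=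
  rshift _ (mxvec_index j nu).

Definition wymat K I : 'M[xyring K I]_(#|K :\: I|, d) :=
  \matrix_(j, nu) 'X_(yidx j nu).

(* f(x_I, L x_I + y_J) *)
Definition wshift_pt Sigma K I : 'M[xyring K I]_(#|K|, d) :=
  \matrix_(i, nu)
    if pos I (enum_val i) is Some b then wxmat K I b nu
    else if pos (K :\: I) (enum_val i) is Some j then
      (map_mx (fun c => (rsc c)%:MP) (Lmat Sigma K I) *m wxmat K I + wymat K I) j nu
    else 0.

Definition wshift Sigma K I (f : {mpoly A[npt K]}) : xyring K I :=
  f \mPo [tuple mxvec (wshift_pt Sigma K I) ord0 v | v < npt K].

Definition glap Sigma K I (g : xyring K I) : xyring K I :=
  \sum_(i < #|K :\: I|) \sum_(j < #|K :\: I|)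
    rsc (Cmat Sigma K I i j) *: \sum_(nu < d) g^`M(yidx i nu)^`M(yidx j nu).

Definition gexp_term Sigma K I (k : nat) (g : xyring K I) : xyring K I :=
  rsc ((2%:R ^+ k * k`!%:R)^-1) *: iter k (glap Sigma (K := K) (I := I)) g.

(* exp(1/2 Delta) g; the terms with k >= msize g vanish since Delta lowers degrees. *)
Definition gexp Sigma K I (g : xyring K I) : xyring K I :=
  \sum_(k < msize g) gexp_term Sigma k g.

Definition set_y0 K I (g : xyring K I) : {mpoly A[npt I]} :=
  g \mPo [tuple if split v is inl u then 'X_u else 0 | v < npt I + npt (K :\: I)].

Definition wick Sigma K I (f : {mpoly A[npt K]}) : {mpoly A[npt I]} :=
  set_y0 (gexp Sigma (wshift Sigma I f)).

End Scalars.

(* k_S = C(t_a : a in S) *)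
Definition kfield S : fieldType := {fraction {mpoly R[i][#|S|]}}.

Definition kcst S : {rmorphism R[i] -> kfield S} :=
  @tofrac {mpoly R[i][#|S|]} \o @mpolyC _ R[i].

Definition tpoly S a : {mpoly R[i][#|S|]} := if pos S a is Some i then 'X_i else 0.

Definition kvar S a : kfield S := tofrac (tpoly S a).

(* F_{K|I} *)
Definition Fphase Sigma P K I : {mpoly (kfield I)[npt K]} :=
  phase (kcst I) Sigma P K I (kvar I).

(* H^{|K|d}(C_{K|S}) *)
Definition Htop Sigma P K S : lmodType (kfield S) :=
  coh (nabla (Fphase Sigma P K S)) (npt K).

Definition vclass Sigma P K S (f : {mpoly (kfield S)[npt K]}) : Htop Sigma P K S :=
  coh_class (nabla (Fphase Sigma P K S)) (npt K) (vform f).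

(* Orientation lines: o_A is the top degree part of the exterior algebra on the
   generators (a, nu), a in A, and the quotient of (R^d)^K by (R^d)^I is identified
   with (R^d)^(K :\: I), so that o_{K/I} is the top degree part of the exterior
   algebra on the generators (a, nu), a in K :\: I. *)
Definition label K (v : 'I_(npt K)) : 'I_r * 'I_d :=
  mxvec (\matrix_(i < #|K|, nu < d) (enum_val i, nu)) ord0 v.

(* The map of exterior algebras induced by the inclusion of generators; the
   inclusion is increasing, hence no sign. *)
Definition ext_incl I K (w : ext R (npt I)) : ext R (npt K) :=
  [ffun D : {set 'I_(npt K)} =>
     \sum_(B : {set 'I_(npt I)} | @label I @: B == @label K @: D) w B].

(* o_I (x) o_J -> o_K, for K the disjoint union of I and J *)
Definition ormul I J K (al : ext R (npt I)) (be : ext R (npt J)) : ext R (npt K) :=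
  wedge (ext_incl K al) (ext_incl K be).

Definition orvol K : ext R (npt K) := vform 1.

(* The coordinate of be in o_{K/I} for the identification o_K = o_I (x) o_{K/I}:
   vol_I (x) be = orcoef be * vol_K. *)
Definition orcoef K I (be : ext R (npt (K :\: I))) : R :=
  ormul K (orvol I) be setT.

(* The generator of o_{K/I} with vol_I (x) qvol = vol_K *)
Definition qvol K I : ext R (npt (K :\: I)) :=
  vform (orcoef (orvol (K :\: I)))^-1.

(* Gaussian contraction normalised by a generator be of o_{K/I}: it sends
   f vol_I (x) be to (wick f) vol_I. *)
Definition gauss_contr Sigma K I S (be : ext R (npt (K :\: I)))
    (w : forms (kfield S) (npt K)) : forms (kfield S) (npt I) :=
  vform (rsc (kcst S) (orcoef be)^-1 *: wick (kcst S) Sigma I (w setT)).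

(* The map induced on classes, computed on a chosen representative; it is the induced
   map as soon as its value on [f vol_K] does not depend on that choice. *)
Definition Wcoh Sigma P K I S (be : ext R (npt (K :\: I)))
    (h : Htop Sigma P K S) : Htop Sigma P I S :=
  coh_class (nabla (Fphase Sigma P I S)) (npt I)
    (gauss_contr Sigma be (coh_repr h)).

(* Sign of the shuffle from the concatenated order of I x d, J x d to the
   row-major order; I and J are disjoint, so first components decide. *)
Definition shuffle_sign (M : comNzRingType) I J : M :=
  (-1) ^+ #|[set p : ('I_r * 'I_d) * ('I_r * 'I_d) |
             [&& p.1.1 \in I, p.2.1 \in J & (p.2.1 < p.1.1)%N]]|.

(* The universal complex over C[t_a : a in K] and its specialisation *)
Definition Funiv Sigma P K : {mpoly {mpoly R[i][#|K|]}[npt K]} :=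
  phase (@mpolyC #|K| R[i]) Sigma P K K (tpoly K).

Definition tspec K S (c : {mpoly R[i][#|K|]}) : kfield S :=
  mmap (kcst S) (fun i => if enum_val i \in S then kvar S (enum_val i) else 0) c.

Definition form_spec K S (w : forms {mpoly R[i][#|K|]} (npt K)) :
    forms (kfield S) (npt K) :=
  [ffun B : {set 'I_(npt K)} => map_mpoly (@tspec K S) (w B)].

(* The base change of the free module of universal forms along tspec is the module
   of forms over k_S; D is the base change of the universal differential. *)
Definition specialised_diff Sigma P K S
    (D : {linear forms (kfield S) (npt K) -> forms (kfield S) (npt K)}) : Prop :=
  forall w, D (form_spec S w) = form_spec S (nabla (Funiv Sigma P K) w).

End Model.

Definition has_dim (k : fieldType) (V : lmodType k) (n : nat) : Prop :=
  inhabited (Vector.axiom n V).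

(* Main.v *)
Require Import Defs.
From HB Require Import structures.
From mathcomp Require Import all_boot all_order all_algebra.
From mathcomp Require Import fraction ring_quotient generic_quotient.
From mathcomp Require Import boolp reals complex mpoly.
From mathcomp Require Import ring.

Set Implicit Arguments.
Unset Strict Implicit.
Unset Printing Implicit Defensive.

Import Order.TTheory GRing.Theory Num.Theory.
Local Open Scope ring_scope.


(** The complex C_{K|S} is a deformation of a Koszul complex.  The derivative of the phase
    along x_{a,nu} has the leading part i t_a (d_nu P_m)(x_a), of degree m - 1 >= 2, when a is
    in S, and the linear form - (Sigma_K^-1 x)_{a,nu} otherwise ([symbol], [Fphase_symbol]).
    The only common zero of these leading parts is the origin, so that some power of each
    variable lies in the ideal they generate.  For the derivatives of P_m this is a homogeneous
    Nullstellensatz ([homog_nullstellensatz]), over the complex numbers; scalars are extended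
    to C(t_a) only afterwards, on the explicit coefficients.  At the other points the linear
    forms express x_a through the active variables ([symbol_ideal_inactive]).

    Powers of the variables in the ideal of the symbols make their Koszul complex exact below
    the top degree ([koszul_acyclic]).  The twisted differential differs from the Koszul
    differential by terms of lower weight, and strictness of the weight filtration
    ([kos_strict]) carries exactness over.  In each bounded weight the complex is finite
    dimensional, its terms depend only on the degrees of the symbols, and exactness below the
    top determines all ranks; so the top cohomology has the dimension found for the symbols
    'X_v ^+ e v, namely the product of the degrees ([koszul_top_dim]).  This gives the
    dimension ((m - 1) ^ d) ^ |S| and the vanishing of the other groups
    ([Fphase_cohomology]).

    The Wick operator is conditional expectation of polynomials of a Gaussian vector: x_a is
    its mean given x_I plus a centred part, and Gaussian integration by parts turns the
    centred part into derivatives ([gexp_yvar], [wick_xvar]).  The resulting recursion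
    determines the operator and is stable under composition, by the laws of total expectation
    and total covariance; hence the tower identity ([wick_comp]).  The same recursion shows
    that contraction intertwines the twisted derivatives in the retained directions and kills
    them in the contracted ones ([wick_twisted]), because interactions sit at retained points
    only.  So it descends to cohomology ([wick_top_class]).  The descended map is onto, as
    contraction undoes the inclusion of polynomials in x_I, and both sides have the dimension
    ((m - 1) ^ d) ^ |S|; hence it is bijective ([Wcoh_bijective]).

    The product of orientation lines of disjoint sets is governed by the sign of the shuffle
    ([ormul_vform]), and inversion counts are additive; this gives the compatibility of the
    normalised generators ([ormul_qvol_tower]).  Finally the universal phase specialises to the
    phase with couplings in S, and monomial forms, which are specialisations, span all forms:
    the specialised differential exists and is unique ([specialised_diff_uniq]). *)

(** * Homogeneous Nullstellensatz *)

Section Elimination.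

(** The shape of the Sylvester matrix depends on the degrees, which are kept when the
    leading coefficients survive; the matrices then correspond entry by entry. *)
Lemma map_resultant_lead (aR rR : nzRingType) (f : {rmorphism aR -> rR})
    (p q : {poly aR}) :
  f (lead_coef p) != 0 -> f (lead_coef q) != 0 ->
  f (resultant p q) = resultant (map_poly f p) (map_poly f q).
Proof.
move=> nz_fp nz_fq; rewrite /resultant /Sylvester_mx !size_map_poly_id0 //.
rewrite -det_map_mx /= map_col_mx; congr (\det (col_mx _ _));
  by apply: map_lin1_mx => v; rewrite map_poly_rV rmorphM /= map_rVpoly.
Qed.

Section Univariate.
Variables (k : closedFieldType) (n : nat).
Local Notation A := {mpoly k[n]}.
Local Notation B := {mpoly k[n.+1]}.

Definition of_uni (p : {poly A}) : B := (map_poly (@mwiden n k) p).['X_ord_max].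

Lemma meval_resultant (a : 'I_n -> k) (p q : {poly A}) c :
  c != 0 -> lead_coef p = c%:MP -> lead_coef q = c%:MP ->
  (resultant p q).@[a] = resultant (map_poly (meval a) p) (map_poly (meval a) q).
Proof. by move=> nz_c lp lq; apply: map_resultant_lead; rewrite /= ?lp ?lq mevalC. Qed.

Definition extend_pt (a : 'I_n -> k) (b : k) (i : 'I_n.+1) : k :=
  if unlift ord_max i is Some j then a j else b.

(** The restriction of f to the line above a, as a polynomial in the last coordinate. *)
Definition spec_pt (a : 'I_n -> k) (f : B) : {poly k} := map_poly (meval a) (muni f).

Lemma widen_lift (i : 'I_n) : widen_ord (leqnSn n) i = lift ord_max i.
Proof. by apply: val_inj; rewrite /= /bump leqNgt ltn_ord. Qed.

Lemma extend_pt_widen a b i : extend_pt a b (widen_ord (leqnSn n) i) = a i.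
Proof. by rewrite /extend_pt widen_lift liftK. Qed.

Lemma extend_pt_max a b : extend_pt a b ord_max = b.
Proof. by rewrite /extend_pt unlift_none. Qed.

Definition lowm (m : 'X_{1..n.+1}) : 'X_{1..n} :=
  [multinom m (widen_ord (leqnSn n) i) | i < n].

Lemma mnmwiden_low m : (mnmwiden (lowm m) + U_(ord_max) *+ m ord_max)%MM = m.
Proof.
apply/mnmP=> i; rewrite mnmDE mulmnE mnm1E; case: (unliftP ord_max i) => [j|] ->.
  rewrite -widen_lift mnmwiden_widen mnmE -(inj_eq val_inj) /=.
  by rewrite gtn_eqF ?ltn_ord // mul0n addn0.
by rewrite mnmwiden_ordmax eqxx mul1n.
Qed.

Lemma muniX (m : 'X_{1..n.+1}) :
  muni 'X_[m] = 'X_[lowm m] *: 'X^(m ord_max) :> {poly A}.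
Proof. by rewrite muniE msuppX big_seq1 mcoeffX eqxx scale1r. Qed.

Lemma of_uniC p : of_uni p%:P = mwiden p.
Proof. by rewrite /of_uni map_polyC hornerC. Qed.

Lemma of_uniM p q : of_uni (p * q) = of_uni p * of_uni q.
Proof. by rewrite /of_uni rmorphM hornerM. Qed.

Lemma of_uniD p q : of_uni (p + q) = of_uni p + of_uni q.
Proof. by rewrite /of_uni rmorphD hornerD. Qed.

Lemma muniK : cancel (@muni n k) of_uni.
Proof.
apply: mpolyind => [|c m p _ _ IH]; first by rewrite muni0 /of_uni map_poly0 horner0.
rewrite muniD muniZ muniX of_uniD IH -mul_polyC of_uniM of_uniC mwidenC mul_mpolyC.
congr (_ *: _ + _); rewrite -mul_polyC of_uniM of_uniC mwidenX /of_uni map_polyXn.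
by rewrite hornerXn mpolyXn -mpolyXD mnmwiden_low.
Qed.

Lemma of_uni_comb p q f g :
  of_uni (p * muni f + q * muni g) = of_uni p * f + of_uni q * g.
Proof.
apply: etrans (of_uniD _ _) _; congr (_ + _).
  by apply: etrans (of_uniM _ _) _; congr (_ * _); apply: muniK.
by apply: etrans (of_uniM _ _) _; congr (_ * _); apply: muniK.
Qed.

Lemma spec_ptM a f g : spec_pt a (f * g) = spec_pt a f * spec_pt a g.
Proof. by rewrite /spec_pt muniM rmorphM. Qed.

Lemma spec_ptD a f g : spec_pt a (f + g) = spec_pt a f + spec_pt a g.
Proof. by rewrite /spec_pt muniD rmorphD. Qed.

Lemma spec_ptC a c : spec_pt a c%:MP = c%:P.
Proof. by rewrite /spec_pt muniC map_polyC /= mevalC. Qed.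

Lemma spec_ptXmax a i : spec_pt a ('X_ord_max ^+ i) = 'X^i.
Proof.
rewrite /spec_pt mpolyXn muniX (_ : lowm _ = 0%MM).
  by rewrite mpolyX0 scale1r map_polyXn mulmnE mnm1E eqxx mul1n.
by apply/mnmP=> j; rewrite mnmE mulmnE mnm1E widen_lift (negPf (neq_lift _ _)) mnm0E.
Qed.

Lemma spec_pt_onto a q : exists f, spec_pt a f = q.
Proof.
elim/poly_ind: q => [|q c [f <-]]; first by exists 0; rewrite /spec_pt muni0 map_poly0.
exists (f * 'X_ord_max ^+ 1 + c%:MP).
by rewrite spec_ptD spec_ptM spec_ptXmax spec_ptC expr1.
Qed.

Lemma meval_extend a b f : f.@[extend_pt a b] = (spec_pt a f).[b].
Proof.
elim/mpolyind: f => [|c m p _ _ IH]; first by rewrite meval0 /spec_pt muni0 map_poly0 horner0.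
rewrite mevalD spec_ptD hornerD IH mevalZ -mul_mpolyC spec_ptM spec_ptC hornerCM.
congr (_ * _ + _); rewrite /spec_pt muniX -mul_polyC rmorphM /= map_polyC map_polyXn.
rewrite hornerCM hornerXn mevalX big_ord_recr /= extend_pt_max mevalX; congr (_ * _).
by apply: eq_bigr => i _; rewrite extend_pt_widen mnmE.
Qed.

(** A monomial of degree e other than the power of the last variable involves another
    variable: it has lower degree in the last one and vanishes at the last coordinate point. *)
Lemma muni_homog e (g : B) : g \is e.-homog ->
  exists2 r : {poly A}, (size r <= e)%N &
    muni g = (g.@[extend_pt (fun=> 0) 1])%:MP *: 'X^e + r.
Proof.
move=> /dhomogP hg; rewrite [g]mpolyE big_seq.
apply: (big_ind (fun f : B => exists2 r : {poly A}, (size r <= e)%N &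
  muni f = (f.@[extend_pt (fun=> 0) 1])%:MP *: 'X^e + r)).
- by exists 0; rewrite ?size_poly0 // muni0 meval0 mpolyC0 scale0r addr0.
- move=> f1 f2 [r1 s1 E1] [r2 s2 E2]; exists (r1 + r2).
    by rewrite (leq_trans (size_polyD _ _)) // geq_max s1.
  by rewrite muniD E1 E2 mevalD mpolyCD scalerDl addrACA.
move=> m /hg /= dm; rewrite muniZ mevalZ muniX mevalX big_ord_recr /=.
rewrite extend_pt_max expr1n mulr1.
have [low0|nz] := eqVneq (lowm m) 0%MM; last first.
  have lt_me : (m ord_max < e)%N.
    rewrite -dm -{2}(mnmwiden_low m) mdegD mdegMn mdeg1 mul1n -[X in (X < _)%N]add0n.
    rewrite ltn_add2r lt0n; apply: contra nz; rewrite !mdeg_eq0 => /eqP E.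
    by apply/eqP/mnmP=> i; rewrite -mnmwiden_widen E !mnm0E.
  exists ((g@_m)%:MP *: ('X_[lowm m] *: 'X^(m ord_max))).
    do 2!rewrite (leq_trans (size_scale_leq _ _)) //.
    by rewrite size_polyXn.
  have [i nz_i] : exists i, lowm m i != 0%N.
    apply/existsP; apply: contraR nz => /existsPn all0; apply/eqP/mnmP=> i.
    by rewrite mnm0E; apply/eqP; rewrite -[_ == _]negbK all0.
  rewrite (bigD1 i) //= extend_pt_widen expr0n.
  by move: nz_i; rewrite mnmE => /negPf->; rewrite mul0r mulr0 mpolyC0 scale0r add0r.
exists 0; rewrite ?size_poly0 // addr0.
have m_max : m ord_max = e.
  by rewrite -dm -{2}(mnmwiden_low m) low0 mnmwiden0 add0m mdegMn mdeg1 mul1n.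
rewrite low0 mpolyX0 scale1r m_max big1 ?mulr1 // => i _.
by move/mnmP/(_ i): low0; rewrite mnmE mnm0E => ->; rewrite expr0.
Qed.

End Univariate.

Section Ideals.
Variable k : comNzRingType.

(** Membership in the ideals below means existence of coefficients, hence the value in Prop. *)
Definition is_ideal n (I : {mpoly k[n]} -> Prop) : Prop :=
  [/\ I 0, forall f g, I f -> I g -> I (f + g) & forall f g, I g -> I (f * g)].

(** Every term of the binomial expansion of (f + g) ^+ (M + N) contains f ^+ M or g ^+ N. *)
Lemma radicalD n (I : {mpoly k[n]} -> Prop) f g : is_ideal I ->
  (exists N, I (f ^+ N)) -> (exists N, I (g ^+ N)) -> exists N, I ((f + g) ^+ N).
Proof.
move=> [I0 ID IM] [M IfM] [N IgN]; exists (M + N)%N; rewrite exprDn.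
apply: (big_ind I) => // i _; rewrite -mulr_natl; apply: (IM).
have [le_Ni|lt_iN] := leqP N i.
  by rewrite -(subnK le_Ni) exprD mulrA; apply: IM.
have le_M : (M <= M + N - i)%N by rewrite -addnBA ?leq_addr // ltnW.
by rewrite mulrC -(subnK le_M) exprD mulrA; apply: IM.
Qed.

Lemma radicalM n (I : {mpoly k[n]} -> Prop) f g : is_ideal I ->
  (exists N, I (g ^+ N)) -> exists N, I ((f * g) ^+ N).
Proof. by move=> [I0 ID IM] [N IgN]; exists N; rewrite exprMn; apply: IM. Qed.

End Ideals.

Section Nullstellensatz.
Variable k : closedFieldType.

Definition homog_closed n (I : {mpoly k[n]} -> Prop) : Prop :=
  forall e f, I f -> I (pihomog mdeg e f).

Lemma pihomog_mwiden n e (f : {mpoly k[n]}) :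
  pihomog mdeg e (mwiden f) = mwiden (pihomog mdeg e f).
Proof.
elim/mpolyind: f => [|c m p _ _ IH]; first by rewrite mwiden0 !pihomog0 mwiden0.
rewrite mwidenD !pihomogD mwidenD IH mwidenZ !linearZ /= mwidenZ mwidenX.
rewrite !pihomogX /=.
rewrite (_ : mdeg (mnmwiden m) = mdeg m).
  by case: ifP; rewrite ?mwidenX ?mwiden0.
rewrite !mdegE big_ord_recr /= mnmwiden_ordmax addn0.
by apply: eq_bigr => i _; rewrite mnmwiden_widen.
Qed.

Lemma elim_ideal n (I : {mpoly k[n.+1]} -> Prop) :
  is_ideal I -> is_ideal (fun f : {mpoly k[n]} => I (mwiden f)).
Proof.
move=> [I0 ID IM]; split=> [|f g If Ig|f g Ig].
- by rewrite mwiden0.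
- by rewrite mwidenD; apply: ID.
- by rewrite mwidenM; apply: IM.
Qed.

(** Suppose that f restricts to 1 above a.  Adding to f a multiple of g of higher degree makes
    its leading coefficient a constant and leaves it coprime to g above a.  But the resultant
    of the two lies in the elimination ideal, so it vanishes at a and they have a common
    factor there. *)
Lemma spec_ideal_proper n (I : {mpoly k[n.+1]} -> Prop) e g a :
  is_ideal I -> I g -> g \is e.-homog -> g.@[extend_pt (fun=> 0) 1] != 0 ->
  (forall f, I (mwiden f) -> f.@[a] = 0) ->
  forall f, I f -> spec_pt a f != 1.
Proof.
move=> [I0 ID IM] Ig hg nz_c za f If; apply/eqP => Ef.
have [r sr Eg] := muni_homog hg; set c := _.@[_] in Eg nz_c.
have nz_cP : c%:MP != 0 :> {mpoly k[n]} by rewrite mpolyC_eq0.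
have e_gt0 : (0 < e)%N.
  rewrite lt0n; apply/eqP => e0; move: sr Eg; rewrite e0 leqn0 size_poly_eq0 => /eqP->.
  rewrite expr0 alg_polyC addr0 => /(congr1 (@of_uni k n)); rewrite muniK of_uniC => Eg.
  by move: Ig; rewrite Eg => /za /eqP; rewrite mevalC (negPf nz_c).
have sg : size (muni g) = e.+1.
  by rewrite Eg size_polyDl size_scale ?size_polyXn.
have lg : lead_coef (muni g) = c%:MP.
  rewrite Eg lead_coefDl ?size_scale ?size_polyXn //.
  by rewrite lead_coefZ lead_coefXn mulr1.
(* A multiple of g of larger degree in the last variable dominates f. *)
pose M := size (muni f).
pose f' := f + 'X_ord_max ^+ M * g.
have uX : muni ('X_ord_max ^+ M) = 'X^M :> {poly {mpoly k[n]}}.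
  rewrite mpolyXn muniX (_ : lowm _ = 0%MM).
    by rewrite mpolyX0 scale1r mulmnE mnm1E eqxx mul1n.
  by apply/mnmP=> j; rewrite mnmE mulmnE mnm1E widen_lift (negPf (neq_lift _ _)) mnm0E.
have Ef' : muni f' = 'X^M * muni g + muni f by rewrite /f' muniD muniM uX addrC.
have nz_g : muni g != 0 by rewrite -size_poly_eq0 sg.
have sXg : size ('X^M * muni g) = (M + e.+1)%N.
  by rewrite mulrC size_mulXn // sg.
have ltf : (size (muni f) < size ('X^M * muni g)%R)%N by rewrite sXg addnS ltnS leq_addr.
have sf' : size (muni f') = (M + e.+1)%N by rewrite Ef' size_polyDl.
have lf' : lead_coef (muni f') = c%:MP.
  by rewrite Ef' lead_coefDl // lead_coefM lead_coefXn mul1r.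
have [||[u v] _ /= Er] := @resultant_in_ideal _ (muni f') (muni g).
- by rewrite sf' addnS ltnS addn_gt0 e_gt0 orbT.
- by rewrite sg.
have [res Eres] : exists res, res = resultant (muni f') (muni g) by eexists.
have Er' : mwiden res = of_uni u * f' + of_uni v * g.
  by rewrite -(of_uni_comb u v f' g) -(of_uniC res) Eres Er.
have /za : I (mwiden res).
  by rewrite Er'; apply: (ID); apply: (IM) => //; apply: ID => //; apply: IM.
have Ea : res.@[a] = resultant (spec_pt a f') (spec_pt a g).
  by rewrite Eres; apply: (meval_resultant _ nz_c lf' lg).
rewrite {}Ea {Eres Er Er'} => /eqP.
rewrite resultant_eq0 /f' spec_ptD spec_ptM Ef -[(1 < _)%N]negbK -leqNgt; case/negP.
have : coprimep (1 + spec_pt a ('X_ord_max ^+ M) * spec_pt a g) (spec_pt a g).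
  by rewrite coprimep_sym addrC coprimep_addl_mul coprimep1.
by rewrite /coprimep => /eqP->.
Qed.

(** Above a the ideal restricts to a proper ideal of univariate polynomials.  An element of
    minimal size generates it and is not constant; the new coordinate b is a root of it. *)
Lemma extend_zero n (I : {mpoly k[n.+1]} -> Prop) e g a :
  is_ideal I -> I g -> g \is e.-homog -> g.@[extend_pt (fun=> 0) 1] != 0 ->
  (forall f, I (mwiden f) -> f.@[a] = 0) ->
  exists b, forall f, I f -> f.@[extend_pt a b] = 0.
Proof.
move=> idI Ig hg nz_c za; have not1 := spec_ideal_proper idI Ig hg nz_c za.
have [I0 ID IM] := idI.
have [r sr Eg] := muni_homog hg; set c := _.@[_] in Eg nz_c.
have nz_g : spec_pt a g != 0.
  rewrite /spec_pt Eg raddfD /= map_polyZ /= map_polyXn mevalC -size_poly_eq0.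
  by rewrite size_polyDl size_scale ?size_polyXn // ltnS (leq_trans (size_poly _ _)).
have ex_s : exists s, `[< exists2 f, I f & spec_pt a f != 0 /\ size (spec_pt a f) = s >].
  by exists (size (spec_pt a g)); apply/asboolP; exists g.
have [s /asboolP[f0 If0 [nz_f0 sf0]] min_s] := ex_minnP ex_s.
set h := spec_pt a f0 in nz_f0 sf0.
have [b /rootP hb] : exists b, root h b.
  apply/closed_rootP; apply/negP => /size_poly1P [x nz_x Eh].
  have /eqP[] := not1 _ (IM x^-1%:MP _ If0).
  by rewrite spec_ptM spec_ptC -/h Eh -polyCM mulVf.
exists b => f If; rewrite meval_extend.
suff -> : spec_pt a f = spec_pt a f %/ h * h by rewrite hornerM hb mulr0.
rewrite {1}(divp_eq (spec_pt a f) h).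
have [q Eq] := spec_pt_onto a (- (spec_pt a f %/ h)).
have Er : spec_pt a (f + q * f0) = spec_pt a f %% h.
  by rewrite spec_ptD spec_ptM Eq mulNr {1}(divp_eq (spec_pt a f) h) addrAC addrN add0r.
have [->|nz] := eqVneq (spec_pt a f %% h) 0; first by rewrite addr0.
have := ltn_modp (spec_pt a f) h; rewrite nz_f0 ltnNge sf0 => /negP[].
apply: min_s; apply/asboolP; exists (f + q * f0); last by rewrite Er.
by apply: ID => //; apply: IM.
Qed.

(** Induction on the number of variables.  Since the last coordinate point is not a common zero,
    some form g of I has a nonzero multiple of a power of the last variable among its terms.
    Zeros of the elimination ideal then extend to zeros of I, so the induction hypothesis
    applies to it and the other variables lie in the radical of I; modulo these, g is a
    multiple of a power of the last variable. *)
Theorem homog_nullstellensatz n (I : {mpoly k[n]} -> Prop) :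
  is_ideal I -> homog_closed I ->
  (forall a, (forall f, I f -> f.@[a] = 0) -> forall i, a i = 0) ->
  forall i : 'I_n, exists N, I ('X_i ^+ N).
Proof.
elim: n I => [|n IHn] I idI hI nz; first by case.
have [I0 ID IM] := idI.
have [e [g [Ig hg nz_g]]] : exists e, exists g,
    [/\ I g, g \is e.-homog & g.@[extend_pt (fun=> 0) 1] != 0].
  apply: contrapT => no; have := nz (extend_pt (fun=> 0) 1) _ ord_max.
  rewrite extend_pt_max => /(_ _)/eqP; rewrite oner_eq0 => H; apply/notF/H => f If.
  rewrite (@pihomog_partitionE _ _ mdeg _ f (leqnn (msize f))) raddf_sum big1 //= => e _.
  apply/eqP; apply: contrapT => /negP nz_e; apply: no; exists e, (pihomog mdeg e f).
  by split=> //; [apply: hI|apply: pihomogP].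
(* The induction hypothesis for the elimination ideal. *)
have low (i : 'I_n) : exists N, I ('X_(widen_ord (leqnSn n) i) ^+ N).
  have [|||N] := IHn (fun f => I (mwiden f)) _ _ _ i.
  - exact: elim_ideal.
  - by move=> d f If; rewrite -pihomog_mwiden; apply: hI.
  - move=> a za j; have [b zb] := extend_zero idI Ig hg nz_g za.
    by rewrite -(extend_pt_widen a b) nz.
  by exists N; rewrite -mnmwiden1 -mwidenX -rmorphXn.
move=> i; have [j ->|->] := unliftP ord_max i; first by rewrite -widen_lift.
set c := _.@[_] in nz_g.
(* Up to g, a nonzero multiple of this power is a sum of monomials that involve other variables. *)
suff [N IN] : exists N, I (('X_ord_max ^+ e) ^+ N) by exists (e * N)%N; rewrite exprM.
have -> : 'X_ord_max ^+ e = c^-1%:MP * (c *: 'X_ord_max ^+ e - g) + c^-1%:MP * g.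
  by rewrite -mulrDr subrK mul_mpolyC scalerA mulVf ?scale1r.
apply: radicalD => //; last by exists 1%N; rewrite expr1; apply: IM.
apply: radicalM => //; rewrite /c; move/dhomogP: hg => hg; pose Q (f : {mpoly k[n.+1]}) := exists N,
  I ((f.@[extend_pt (fun=> 0) 1] *: 'X_ord_max ^+ e - f) ^+ N).
suff : Q g by []; rewrite [g]mpolyE big_seq; apply: (big_ind Q); rewrite /Q.
- by exists 1%N; rewrite expr1 meval0 scale0r subr0.
- by move=> f1 f2 H1 H2; rewrite mevalD scalerDl opprD addrACA; apply: radicalD.
move=> m /hg /= dm; rewrite mevalZ -scalerA -scalerBr -(mul_mpolyC (g@_m)).
apply: radicalM => //.
rewrite mevalX big_ord_recr /= extend_pt_max expr1n mulr1 -[in 'X_[m]](mnmwiden_low m).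
have [low0|/eqP nz_low] := eqVneq (lowm m) 0%MM.
  have m_max : m ord_max = e.
    by rewrite -dm -{2}(mnmwiden_low m) low0 mnmwiden0 add0m mdegMn mdeg1 mul1n.
  exists 1%N; rewrite low0 mnmwiden0 add0m m_max mpolyXn big1 => [|j _].
    by rewrite scale1r subrr expr1.
  by move/mnmP/(_ j): low0; rewrite mnmE mnm0E => ->; rewrite expr0.
have [j nz_j] : exists j, lowm m j != 0%N.
  apply: contrapT => no; apply: nz_low; apply/mnmP=> j; rewrite mnm0E.
  by apply: contrapT => nz_j; apply: no; exists j; apply/eqP.
rewrite (bigD1 j) //= extend_pt_widen expr0n; move: (nz_j); rewrite mnmE => /negPf->.
rewrite mul0r scale0r sub0r -mulN1r mpolyXD mulrA -(@submK _ U_(j) (lowm m)).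
  by rewrite mnmwidenD mpolyXD mulrA mnmwiden1 mulrAC; apply: radicalM.
by rewrite lep1mP.
Qed.

End Nullstellensatz.
End Elimination.

(** * Complexes of forms built from commuting operators *)

Section Koszul.
Variables (k : comNzRingType) (n : nat).
Local Notation A := {mpoly k[n]}.
Local Notation form := (forms k n).
Implicit Types (B D : {set 'I_n}) (u v : 'I_n) (w z : form).

Local Notation sg v D := (ext_sign {mpoly k[n]} [set v] D).

(** Inserting u and v in the two possible orders differs by one transposition. *)
Lemma ext_sign_swap u v D : u != v -> u \notin D -> v \notin D ->
  sg u (v |: D) * sg v D = - (sg v (u |: D) * sg u D).
Proof.
have E (x y : 'I_n) : y \notin D -> sg x (y |: D) = (-1) ^+ (y < x)%N * sg x D.
  move=> yD; rewrite !ext_sign1 -exprD; congr (_ ^+ _).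
  have [yx|xy] := boolP (y < x)%N; last first.
    rewrite add0n; apply: eq_card => t; rewrite !inE; have [->|//] := eqVneq t y.
    by rewrite (negPf xy) !andbF.
  rewrite (cardsD1 y) !inE eqxx yx; congr (_ + _)%N; apply: eq_card => t.
  rewrite !inE; have [->|//] := eqVneq t y.
  by rewrite (negPf yD).
move=> nuv uD vD; rewrite !E // -(inj_eq val_inj) in nuv *.
by case: ltngtP nuv => // _ _;
  rewrite ?expr0 ?expr1 ?mul1r ?mulN1r ?mulNr ?opprK mulrC.
Qed.

Lemma sqr_ext_sign v D : sg v D * sg v D = 1.
Proof. by rewrite ext_sign1 -expr2 sqrr_sign. Qed.

Lemma ext_sign_swapU u v D : u != v -> u \notin D -> v \notin D ->
  sg u (v |: D) * sg v (u |: D) = - (sg v D * sg u D).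
Proof.
move=> nuv uD vD; rewrite -[LHS]mulr1 -(sqr_ext_sign v D).
have -> : sg u (v |: D) * sg v (u |: D) * (sg v D * sg v D) =
    sg u (v |: D) * sg v D * (sg v (u |: D) * sg v D) by ring.
rewrite ext_sign_swap // mulNr; congr (- _).
have -> : sg v (u |: D) * sg u D * (sg v (u |: D) * sg v D) =
    sg v (u |: D) * sg v (u |: D) * (sg v D * sg u D) by ring.
by rewrite sqr_ext_sign mul1r.
Qed.

(** For multiplication by f v this is the Koszul differential, for the twisted derivatives the
    twisted de Rham differential; the two are compared below. *)
Definition kos (T : 'I_n -> {linear A -> A}) w : form :=
  [ffun D : {set 'I_n} => \sum_(v in D) sg v (D :\ v) * T v (w (D :\ v))].

(** Interior product with the vector field of components a. *)
Definition contraction (a : 'I_n -> A) w : form :=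
  [ffun D : {set 'I_n} => \sum_(v | v \notin D) sg v D * (a v * w (v |: D))].

Definition scale_form (x : A) w : form := [ffun D : {set 'I_n} => x * w D].

Definition mulop (f g : A) : A := f * g.

Fact mulop_linear f : linear (mulop f).
Proof. by move=> c g h; rewrite /mulop mulrDr scalerAr. Qed.

HB.instance Definition _ f := GRing.isLinear.Build k A A *:%R (mulop f) (mulop_linear f).

Definition mults (f : 'I_n -> A) v : {linear A -> A} := mulop (f v).

Lemma multsE f v g : mults f v g = f v * g. Proof. by []. Qed.

Fact kos_linear T : linear (kos T).
Proof.
move=> c w z; apply/ffunP=> D.
have -> : (c *: kos T w + kos T z) D = c *: kos T w D + kos T z D.
  by rewrite [LHS]ffunE; congr (_ + _); rewrite [LHS]ffunE.
rewrite !ffunE scaler_sumr -big_split /=; apply: eq_bigr => v _.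
by rewrite !ffunE linearP mulrDr scalerAr.
Qed.

HB.instance Definition _ T := GRing.isLinear.Build k form form *:%R (kos T) (kos_linear T).

(** The terms for (u, v) and (v, u) cancel: the operators commute and the signs are opposite. *)
Lemma kos_kos (T : 'I_n -> {linear A -> A}) w :
  (forall u v g, T u (T v g) = T v (T u g)) ->
  kos T (kos T w) = 0.
Proof.
move=> TC; apply/ffunP=> D; rewrite !ffunE.
pose G v u := sg v (D :\ v) * sg u (D :\ v :\ u) * T v (T u (w (D :\ v :\ u))).
have -> : \sum_(v in D) sg v (D :\ v) * T v (kos T w (D :\ v)) =
    \sum_(v in D) \sum_(u in D | u != v) G v u.
  apply: eq_bigr => v vD; rewrite ffunE raddf_sum mulr_sumr.
  apply: eq_big => [u|u _]; first by rewrite !inE andbC.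
  by rewrite /G !ext_sign1 raddfMsign mulrA.
have GC v u : v \in D -> u \in D -> u != v -> G v u = - G u v.
  move=> vD uD nuv; rewrite /G TC [D :\ v :\ u]setDDl setUC -setDDl -mulNr.
  congr (_ * _); set D' := D :\ u :\ v.
  have Ev : D :\ v = u |: D'.
    by apply/setP=> t; rewrite !inE; have [->|_] := eqVneq t u; rewrite ?nuv ?uD.
  have Eu : D :\ u = v |: D'.
    by rewrite setD1K // !inE eq_sym nuv.
  by rewrite Ev Eu; apply: ext_sign_swap; rewrite ?inE ?eqxx ?andbF // eq_sym.
pose lt (u v : 'I_n) := (u < v)%N.
have split_lt v : \sum_(u in D | u != v) G v u =
    \sum_(u in D | lt u v) G v u + \sum_(u in D | lt v u) G v u.
  rewrite (bigID (lt^~ v)) /=; congr (_ + _); apply: eq_bigl => u;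
  by rewrite /lt -(inj_eq val_inj) -andbA; case: ltngtP; rewrite ?andbF.
rewrite (eq_bigr _ (fun v _ => split_lt v)) big_split /=.
rewrite [X in _ + X](exchange_big_dep (mem D)) //=; last by move=> ? ? _ /andP[].
rewrite -big_split big1 //= => v vD.
rewrite -[X in _ + X]opprK -sumrN; apply/eqP; rewrite subr_eq0; apply/eqP.
apply: eq_big => [u|u]; first by rewrite vD.
by case/andP=> uD uv; apply: GC => //; apply: contraTneq uv => ->; rewrite /lt ltnn.
Qed.

(** Cartan homotopy formula: an element of the ideal of f acts on the Koszul complex by a map
    homotopic to zero. *)
Lemma kos_contraction (f a : 'I_n -> A) w :
  kos (mults f) (contraction a w) +
    contraction a (kos (mults f) w) =
  scale_form (\sum_v a v * f v) w.
Proof.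
apply/ffunP=> D; rewrite !ffunE.
pose G v u := sg v (D :\ v) * sg u (D :\ v) * (f v * a u * w (u |: (D :\ v))).
have -> : \sum_(v in D) sg v (D :\ v) * mults f v (contraction a w (D :\ v)) =
    \sum_(v in D) (a v * f v * w D + \sum_(u | u \notin D) G v u).
  apply: eq_bigr => v vD; rewrite ffunE (bigD1 v) ?inE ?eqxx //= multsE !mulrDr.
  congr (_ + _).
    rewrite setD1K // (mulrCA (f v)) (mulrA (sg v _)) sqr_ext_sign mul1r.
    by rewrite mulrA (mulrC (f v)).
  rewrite !mulr_sumr; apply: eq_big => [u|u _]; last first.
    by rewrite /G; ring.
  by rewrite !inE; have [->|_] := eqVneq u v; rewrite ?vD ?andbF // andbT.
have -> : \sum_(u | u \notin D) sg u D * (a u * kos (mults f) w (u |: D)) =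
    \sum_(u | u \notin D) (a u * f u * w D - \sum_(v in D) G v u).
  apply: eq_bigr => u uD; rewrite ffunE (bigD1 u) ?inE ?eqxx //= !mulrDr.
  congr (_ + _); rewrite ?multsE.
    by rewrite setU1K // (mulrCA (a u)) (mulrA (sg u _)) sqr_ext_sign mul1r mulrA.
  rewrite !mulr_sumr -sumrN; apply: eq_big => [v|v].
    by rewrite !inE; have [->|_] := eqVneq v u; rewrite ?(negPf uD) ?andbF ?andbT.
  rewrite !inE => /andP[/orP[/eqP->|vD] nvu]; first by rewrite eqxx in nvu.
  have -> : (u |: D) :\ v = u |: (D :\ v).
    by apply/setP=> t; rewrite !inE; have [->|//] := eqVneq t v; rewrite (negPf nvu).
  transitivity (sg u D * sg v (u |: (D :\ v)) * (f v * a u * w (u |: D :\ v))).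
    by rewrite multsE; ring.
  rewrite /G -mulNr; congr (_ * _); rewrite -[in sg u D](setD1K vD).
  have [uDv vDv] : u \notin D :\ v /\ v \notin D :\ v.
    by rewrite !inE eqxx (negPf uD) andbF.
  by apply: ext_sign_swapU; rewrite // eq_sym.
rewrite !big_split /= sumrN exchange_big /= addrACA subrr addr0.
by rewrite mulr_suml [RHS](bigID (mem D)).
Qed.

End Koszul.

(** * Acyclicity of the Koszul complex *)

Section Acyclicity.
Variables (k : comNzRingType) (n : nat).
Local Notation A := {mpoly k[n]}.
Local Notation form := (forms k n).
Implicit Types (B D : {set 'I_n}) (u v : 'I_n) (w z : form) (g h : A).

Definition isform (q : nat) w := forall B, #|B| != q -> w B = 0.

(** The possible primitives of forms of degree q; for q = 0 only the zero form. *)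
Definition isprim (q : nat) w := forall B, #|B|.+1 != q -> w B = 0.

Lemma isprimS q w : isprim q.+1 w <-> isform q w.
Proof. by split=> H B qB; apply: H; rewrite ?eqSS // -eqSS. Qed.

Lemma isprim_pred q w : (0 < q)%N -> isprim q w <-> isform q.-1 w.
Proof. by case: q => // q _; apply: isprimS. Qed.

Lemma isprim0 w : isprim 0 w -> w = 0.
Proof. by move=> H; apply/ffunP=> B; rewrite H // ffunE. Qed.

Lemma isprimD q w z : isprim q w -> isprim q z -> isprim q (w + z).
Proof. by move=> Hw Hz B qB; rewrite ffunE Hw // Hz // addr0. Qed.

Lemma isformB q w z : isform q w -> isform q z -> isform q (w - z).
Proof. by move=> Hw Hz B qB; rewrite !ffunE Hw // Hz // subr0. Qed.

Lemma isform_kos q (T : 'I_n -> {linear A -> A}) w : isprim q w -> isform q (kos T w).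
Proof.
move=> Hw B qB; rewrite ffunE big1 // => v vB; rewrite Hw ?raddf0 ?mulr0 //.
by move: qB; rewrite (cardsD1 v) vB.
Qed.

Lemma isprim_contraction q a w : isform q w -> isprim q (contraction a w).
Proof.
move=> Hw B qB; rewrite ffunE big1 // => v vB.
by rewrite Hw ?mulr0 // cardsU1 vB.
Qed.

Lemma card_full B : (#|B| == n) = (B == setT).
Proof.
rewrite eqEcard subsetT cardsT card_ord eqn_leq.
by have := max_card (mem B); rewrite card_ord => ->.
Qed.

Lemma isform_vform g : isform n (vform g).
Proof. by move=> B; rewrite card_full ffunE => /negPf->. Qed.

Lemma isform_full w : isform n w -> w = vform (w setT).
Proof.
by move=> Hw; apply: vformE; apply/forallP=> B; apply/implyP=> /Hw/eqP.
Qed.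

Lemma kos_vform (T : 'I_n -> {linear A -> A}) g : kos T (vform g) = 0.
Proof.
apply/ffunP=> D; rewrite !ffunE big1 // => v vD; rewrite ffunE.
have [/setP/(_ v)|_] := eqVneq (D :\ v) setT; last by rewrite raddf0 mulr0.
by rewrite !inE eqxx.
Qed.

Lemma kos_contraction_vform (f a : 'I_n -> A) g :
  kos (mults f) (contraction a (vform g)) = vform ((\sum_v a v * f v) * g).
Proof.
have Ec : contraction a (kos (mults f) (vform g)) = 0.
  by rewrite kos_vform; apply/ffunP=> D; rewrite !ffunE big1 // => i _; rewrite ffunE !mulr0.
have := kos_contraction f a (vform g); rewrite Ec addr0 => ->.
by apply/ffunP=> B; rewrite !ffunE; case: ifP; rewrite ?mulr0.
Qed.

(** The ideal generated by the N-th powers of the first p variables.  It is spanned by monomials,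
    so membership can be read off the coefficients. *)
Definition pow_ideal (N p : nat) g :=
  forall m : 'X_{1..n}, (forall v, (v < p)%N -> (m v < N)%N) -> g@_m = 0.

Section PowIdeal.
Variable N : nat.
Local Notation J := (pow_ideal N).

Lemma pow_ideal0 p : J p 0.
Proof. by move=> m _; rewrite mcoeff0. Qed.

Lemma pow_idealD p g h : J p g -> J p h -> J p (g + h).
Proof. by move=> Jg Jh m Hm; rewrite mcoeffD Jg // Jh // addr0. Qed.

Lemma pow_idealN p g : J p g -> J p (- g).
Proof. by move=> Jg m Hm; rewrite mcoeffN Jg // oppr0. Qed.

Lemma mcoeff_XM (m l : 'X_{1..n}) g :
  ('X_[m] * g)@_l = if (m <= l)%MM then g@_(l - m) else 0.
Proof.
case: ifP => [le_ml|nle]; first by rewrite -{1}(submK le_ml) (addmC _ m) mulrC mcoeffMX.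
rewrite (mulrC 'X_[m]); apply: memN_msupp_eq0; rewrite (perm_mem (msuppMX _ _)).
apply/negP=> /mapP[l' _ El]; move: nle; rewrite El lem_addr //.
Qed.

Lemma pow_idealM p g h : J p h -> J p (g * h).
Proof.
move=> Jh; rewrite [g]mpolyE mulr_suml; elim/big_ind: _ => [|x y|m _].
- exact: pow_ideal0.
- exact: pow_idealD.
rewrite -scalerAl => l Hl; rewrite mcoeffZ mcoeff_XM; case: ifP => _; last by rewrite mulr0.
rewrite Jh ?mulr0 // => v /Hl; apply: leq_ltn_trans.
by rewrite mnmBE leq_subr.
Qed.

Lemma pow_ideal_full g : J 0 g -> g = 0.
Proof. by move=> Jg; apply/mpolyP=> m; rewrite mcoeff0 Jg. Qed.

Lemma pow_idealW p g : J p g -> J p.+1 g.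
Proof. by move=> Jg m Hm; apply: Jg => v vp; apply: Hm; apply: ltnW. Qed.

(** Multiplication by a power of the variable v changes the exponent of v only, which is not
    among those that decide membership: this power is a nonzerodivisor modulo the ideal. *)
Lemma pow_ideal_reg v g : J v ('X_v ^+ N * g) -> J v g.
Proof.
move=> Jg m Hm; have := Jg (m + U_(v) *+ N)%MM.
rewrite mpolyXn mulrC addmC mcoeffMX; apply=> u uv.
by rewrite mnmDE mulmnE mnm1E -(inj_eq val_inj) /= gtn_eqF // mul0n Hm.
Qed.

(** Division by the N-th power of the variable v, monomial by monomial. *)
Lemma pow_ideal_split v g : J v.+1 g -> exists h, J v (g - 'X_v ^+ N * h).
Proof.
move=> Jg; pose h := \sum_(m <- msupp g | (N <= m v)%N) g@_m *: 'X_[m - U_(v) *+ N].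
have Eh : 'X_v ^+ N * h = \sum_(m <- msupp g | (N <= m v)%N) g@_m *: 'X_[m].
  rewrite mulr_sumr; apply: eq_bigr => m Hm; rewrite -scalerAr mpolyXn mulrC -mpolyXD.
  rewrite submK //; apply/mnm_lepP=> u; rewrite mulmnE mnm1E.
  by have [<-|_] := eqVneq v u; rewrite ?mul1n ?mul0n.
exists h; rewrite Eh [X in X - _]mpolyE (bigID (fun m : 'X_{1..n} => (N <= m v)%N)) /=.
rewrite addrAC subrr add0r => l Hl; rewrite raddf_sum /= big1_seq // => m /andP[Hm m_g].
rewrite mcoeffZ mcoeffX; have [Eml|] := eqVneq m l; last by rewrite mulr0.
rewrite Jg ?mul0r // => u; rewrite ltnS leq_eqVlt => /predU1P[/val_inj->|/Hl].
  by rewrite ltnNge.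
by rewrite Eml.
Qed.

End PowIdeal.

(** Exactness modulo the ideal generated by the N-th powers of the first p variables, in the
    degrees q with q + p < n, is proved by descending induction on p; the statement is the
    case p = 0.  The N-th power x of the next variable lies in the ideal of [f], hence is
    homotopic to zero: a cocycle z satisfies x z = kos f w for a contraction w of z, which is
    itself a cocycle modulo x.  By induction w is a coboundary modulo x, so that kos f w is x
    times a coboundary, and x can be cancelled because it is a nonzerodivisor. *)
Lemma koszul_acyclic (f : 'I_n -> A) N :
  (forall v, exists a : 'I_n -> A, 'X_v ^+ N = \sum_u a u * f u) ->
  forall q z, (q < n)%N -> isform q z -> kos (mults f) z = 0 ->
  exists2 u, isprim q u & z = kos (mults f) u.
Proof.
move=> fX; set d := kos (mults f).
have d0 : d 0 = 0 by rewrite /d raddf0.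
have dB w w' : d (w - w') = d w - d w' by rewrite /d raddfB.
have ddK w : d (d w) = 0.
  by apply: kos_kos => u v g; rewrite !multsE mulrCA.
suff gen j : (j <= n)%N -> forall q z, (q + (n - j) < n)%N -> isform q z ->
    (forall D, pow_ideal N (n - j) (d z D)) ->
    exists2 u, isprim q u & forall D, pow_ideal N (n - j) ((z - d u) D).
  move=> q z ltqn Hz dz0; have [|||u Hu Eu] := gen n (leqnn n) q z; rewrite ?subnn ?addn0 //.
    by move=> D; rewrite dz0 ffunE; apply: pow_ideal0.
  exists u => //; apply/eqP; rewrite -subr_eq0; apply/eqP/ffunP=> D.
  by rewrite [RHS]ffunE; apply: (@pow_ideal_full N); move: (Eu D); rewrite subnn.
elim: j => [|j IHj] ltjn q z.
  by rewrite subn0 ltnNge leq_addl.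
have ltp : (n - j.+1 < n)%N by rewrite -subn_gt0 subKn.
pose v := Ordinal ltp; have Ep : (n - j)%N = v.+1 by rewrite /= subnSK.
rewrite -[(n - j.+1)%N]/(nat_of_ord v) => ltq Hz Jz.
have [a Ea] := fX v; pose w := contraction a z.
have Edw : d w = scale_form ('X_v ^+ N) z - contraction a (d z).
  by rewrite Ea -kos_contraction addrK.
have Jc D : pow_ideal N v (contraction a (d z) D).
  rewrite ffunE; elim/big_ind: _ => [||u _]; [exact: pow_ideal0|exact: pow_idealD|].
  by do 2!apply: pow_idealM; apply: Jz.
have Jdw D : pow_ideal N v.+1 (d w D).
  rewrite Edw !ffunE; apply: pow_idealD; last first.
    by apply/pow_idealN/pow_idealW; move: (Jc D); rewrite ffunE.
  move=> m /(_ v (ltnSn _)) ltm; rewrite mpolyXn mcoeff_XM; case: ifP => // /mnm_lepP/(_ v).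
  by rewrite mulmnE mnm1E eqxx mul1n leqNgt ltm.
have Hw : isprim q w by apply: isprim_contraction.
suff [w' Hw' Jw'] : exists2 w', isprim q w' &
    forall D, pow_ideal N v (d w D - 'X_v ^+ N * d w' D).
  exists w' => // D; apply: pow_ideal_reg.
  move: (Jw' D); rewrite Edw !ffunE => Jw''.
  rewrite mulrDr mulrN; move: (pow_idealD Jw'' (Jc D)); rewrite ffunE.
  by rewrite addrAC subrK.
case: q ltq Hz Hw => [|q] ltq Hz Hw.
  exists 0 => [B _|D]; first by rewrite ffunE.
  by rewrite (isprim0 Hw) d0 !ffunE mulr0 subr0; apply: pow_ideal0.
have [|||u1 Hu1 Ju1] := IHj (ltnW ltjn) q w.
- by rewrite Ep addnS -addSn.
- exact/isprimS.
- by rewrite Ep.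
pose y := w - d u1.
have Hy : isform q y by apply: isformB; [apply/isprimS|apply: isform_kos].
have /choice[w' Hw'] : forall D, exists h,
    (#|D| != q -> h = 0) /\ pow_ideal N v (y D - 'X_v ^+ N * h).
  move=> D; have [qD|nqD] := eqVneq #|D| q.
    by have [|h Jh] := @pow_ideal_split N v (y D); [rewrite -Ep; apply: Ju1|exists h; split].
  by exists 0; split=> //; rewrite Hy // mulr0 subr0; apply: pow_ideal0.
have Ew' D : finfun w' D = w' D by rewrite ffunE.
exists (finfun w').
  by apply/isprimS => B qB; rewrite Ew'; case: (Hw' B) => ->.
move=> D.
have -> : d w D = d y D by rewrite /y dB ddK subr0.
rewrite !ffunE mulr_sumr -sumrB; elim/big_ind: _ => [||u uD]; [exact: pow_ideal0|exact: pow_idealD|].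
have E (a1 a2 a3 x h : A) : a1 * (a2 * a3) - x * (a1 * (a2 * h)) = a1 * (a2 * (a3 - x * h)).
  by ring.
rewrite !multsE E Ew'; do 2!apply: pow_idealM.
by case: (Hw' (D :\ u)).
Qed.

End Acyclicity.

(** * Deformed Koszul complexes and the weight filtration *)

Section Deformation.
Variables (k : comNzRingType) (n : nat).
Local Notation A := {mpoly k[n]}.
Local Notation form := (forms k n).
Implicit Types (B D : {set 'I_n}) (v : 'I_n) (w z : form) (g h : A).

Lemma msize_homog_le d g : g \is d.-homog -> (msize g <= d.+1)%N.
Proof.
by move=> /dhomogP hg; rewrite msizeE; apply/bigmax_leqP_seq => m /hg /= ->.
Qed.

Lemma msizeD_bound N g h : (msize g <= N)%N -> (msize h <= N)%N -> (msize (g + h) <= N)%N.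
Proof. by move=> Hg Hh; rewrite (leq_trans (msizeD_le _ _)) // geq_max Hg. Qed.

Lemma msizeB_bound N g h : (msize g <= N)%N -> (msize h <= N)%N -> (msize (g - h) <= N)%N.
Proof. by move=> Hg Hh; apply: msizeD_bound; rewrite ?msizeN. Qed.

Lemma msize_bound0 N : (msize (0 : A) <= N)%N. Proof. by rewrite mmeasure0. Qed.

Lemma msize_sum_bound N (I : Type) (r : seq I) (Q : pred I) (F : I -> A) :
  (forall i, Q i -> (msize (F i) <= N)%N) -> (msize (\sum_(i <- r | Q i) F i) <= N)%N.
Proof.
by move=> HF; elim/big_ind: _ => // [|x y]; [apply: msize_bound0|apply: msizeD_bound].
Qed.

Lemma msize_sign N (i : nat) g : (msize g <= N)%N -> (msize ((-1) ^+ i * g) <= N)%N.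
Proof.
by move=> Hg; rewrite -signr_odd; case: odd; rewrite ?mul1r // expr1 mulN1r msizeN.
Qed.

Lemma msize_boundP N g :
  (forall m : 'X_{1..n}, (N <= mdeg m)%N -> g@_m = 0) -> (msize g <= N)%N.
Proof.
move=> Hg; rewrite msizeE; apply/bigmax_leqP_seq => m /= m_g _.
by rewrite ltnNge; apply: contraL m_g => /Hg; rewrite mcoeff_msupp => ->; rewrite eqxx.
Qed.

Lemma msize_coef0 N g (m : 'X_{1..n}) : (msize g <= N)%N -> (N <= mdeg m)%N -> g@_m = 0.
Proof.
by move=> Hg Hm; apply: memN_msupp_eq0; apply: msize_mdeg_ge; apply: leq_trans Hm.
Qed.

Lemma msizeM_bound N N' g h :
  (msize g <= N.+1)%N -> (msize h <= N')%N -> (msize (g * h) <= N + N')%N.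
Proof.
move=> Hg Hh; apply: msize_boundP => m Hm; rewrite [g]mpolyE mulr_suml raddf_sum /= big1_seq //.
move=> m' /andP[_ m'_g]; rewrite -scalerAl mcoeffZ mcoeff_XM; case: ifP => [le|]; last by rewrite mulr0.
rewrite (msize_coef0 Hh) ?mulr0 // -(leq_add2l (mdeg m')) -mdegD addmC submK //.
apply: leq_trans Hm; rewrite leq_add2r -ltnS; apply: leq_trans Hg; exact: msize_mdeg_lt.
Qed.

Lemma msize_deriv_bound N v g : (msize g <= N.+1)%N -> (msize g^`M(v) <= N)%N.
Proof.
move=> Hg; apply: msize_boundP => m Hm; rewrite mcoeff_deriv (msize_coef0 Hg) ?mul0rn //.
by rewrite mdegD mdeg1 addn1.
Qed.

Lemma mcoeff_pihomog d g (m : 'X_{1..n}) :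
  (pihomog mdeg d g)@_m = if mdeg m == d then g@_m else 0.
Proof.
rewrite pihomogE raddf_sum /=; case: ifP => Hm.
  rewrite [in RHS](mpolyE g) raddf_sum /= [RHS](bigID (fun m' : 'X_{1..n} => mdeg m' == d)) /=.
  rewrite [X in _ + X]big1 ?addr0 // => m' Hm'; rewrite mcoeffZ mcoeffX.
  by case: eqVneq => [E|_]; rewrite ?mulr0 //; rewrite E Hm in Hm'.
rewrite big1 // => m' Hm'; rewrite mcoeffZ mcoeffX.
by case: eqVneq => [E|_]; rewrite ?mulr0 //; rewrite E Hm in Hm'.
Qed.

Lemma msize_sub_pihomog d g : (msize g <= d.+1)%N -> (msize (g - pihomog mdeg d g) <= d)%N.
Proof.
move=> Hg; apply: msize_boundP => m; rewrite mcoeffB mcoeff_pihomog leq_eqVlt eq_sym.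
case: eqP => [_ _|_ /= Hm]; first by rewrite subrr.
by rewrite subr0 (msize_coef0 Hg).
Qed.

Lemma pihomog_small d g : (msize g <= d)%N -> pihomog mdeg d g = 0.
Proof.
move=> Hg; apply/mpolyP=> m; rewrite mcoeff_pihomog mcoeff0; case: eqP => // Em.
by rewrite (msize_coef0 Hg) ?Em.
Qed.

Lemma pihomogM d e f g : f \is e.-homog ->
  pihomog mdeg d (f * g) = if (e <= d)%N then f * pihomog mdeg (d - e) g else 0.
Proof.
move=> hf; elim/mpolyind: g => [|c m p _ _ IH].
  by rewrite mulr0 !pihomog0 mulr0; case: ifP.
rewrite mulrDr !pihomogD IH -scalerAr !linearZ /= pihomogX.
have hfm : f * 'X_[m] \is (e + mdeg m)%N.-homog by apply: dhomogM => //; rewrite dhomogX.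
have [Ed|nEd] := eqVneq (e + mdeg m)%N d.
  by rewrite -Ed leq_addr addKn eqxx pihomog_dE // mulrDr scalerAr.
rewrite (pihomog_ne0 nEd hfm) scaler0 add0r; case: ifP => // le_ed.
by rewrite -(eqn_add2l e) subnKC // (negPf nEd) scaler0 add0r.
Qed.

Variables (e : 'I_n -> nat).

(** The total weight of the missing directions: adding the direction v while multiplying by a
    form of degree e v keeps degree plus codegree. *)
Definition codeg B := (\sum_(v | v \notin B) e v)%N.

Lemma codegD1 D v : v \in D -> codeg (D :\ v) = (codeg D + e v)%N.
Proof.
move=> vD; rewrite /codeg (bigD1 v) ?inE ?eqxx //= addnC; congr (_ + _)%N.
by apply: eq_bigl => u; rewrite !inE; have [->|_] := eqVneq u v; rewrite ?vD ?andbF ?andbT.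
Qed.

Lemma codegT : codeg setT = 0%N.
Proof. by rewrite /codeg big1 // => v; rewrite inE. Qed.

(** Degree plus codegree less than N, the filtration for which multiplication by the symbols is
    homogeneous; by truncated subtraction the components of codegree at least N vanish. *)
Definition inW (N : nat) w := forall B, (msize (w B) <= N - codeg B)%N.

Lemma inWW N M w : (N <= M)%N -> inW N w -> inW M w.
Proof. by move=> NM Hw B; apply: leq_trans (Hw B) _; apply: leq_sub2r. Qed.

Lemma inWD N w z : inW N w -> inW N z -> inW N (w + z).
Proof. by move=> Hw Hz B; rewrite ffunE; apply: msizeD_bound. Qed.

Lemma inWB N w z : inW N w -> inW N z -> inW N (w - z).
Proof. by move=> Hw Hz B; rewrite !ffunE; apply: msizeB_bound. Qed.

Lemma inW0 w : inW 0 w -> w = 0.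
Proof.
by move=> Hw; apply/ffunP=> B; apply/eqP; rewrite ffunE -msize_poly_eq0 -leqn0; apply: Hw.
Qed.

(** The filtration is exhaustive. *)
Lemma inW_ex w : exists N, inW N w.
Proof.
exists (\max_B (msize (w B) + codeg B))%N => B.
by rewrite leq_subRL ?(leq_trans (leq_addl _ _) (leq_bigmax B)) // addnC leq_bigmax.
Qed.

Definition top_part (N : nat) w : form :=
  [ffun B : {set 'I_n} =>
     if (codeg B <= N)%N then pihomog mdeg (N - codeg B) (w B) else 0].

Lemma inW_top N w : inW N.+1 (top_part N w).
Proof.
move=> B; rewrite ffunE; case: ifP => [le|_]; last exact: msize_bound0.
by rewrite subSn //; apply: msize_homog_le; apply: pihomogP.
Qed.

Lemma sub_top_part N w : inW N.+1 w -> inW N (w - top_part N w).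
Proof.
move=> Hw B; have := Hw B; rewrite !ffunE; have [le|lt] := leqP (codeg B) N.
  by rewrite subSn // => /msize_sub_pihomog.
by rewrite subr0; move: (lt); rewrite -subn_eq0 => /eqP ->; rewrite leqn0 => /eqP->.
Qed.

Lemma top_part_small N w : inW N w -> top_part N w = 0.
Proof.
move=> Hw; apply/ffunP=> B; rewrite !ffunE; case: ifP => // _.
exact: pihomog_small.
Qed.

Lemma top_part_id N w : top_part N (top_part N w) = top_part N w.
Proof. by apply/ffunP=> B; rewrite !ffunE; case: (codeg B <= N)%N; rewrite ?pihomog_id. Qed.

Lemma isprim_top q N w : isprim q w -> isprim q (top_part N w).
Proof. by move=> Hw B /Hw E; rewrite ffunE E pihomog0; case: ifP. Qed.

Section Symbol.
Variable f : 'I_n -> A.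
Hypothesis f_homog : forall v, f v \is (e v).-homog.

Lemma kos_top_part N w : kos (mults f) (top_part N w) = top_part N (kos (mults f) w).
Proof.
apply/ffunP=> D; rewrite [RHS]ffunE [LHS]ffunE.
have E v : v \in D -> f v * top_part N w (D :\ v) =
    if (codeg D <= N)%N then pihomog mdeg (N - codeg D) (f v * w (D :\ v)) else 0.
  move=> vD; rewrite ffunE (pihomogM _ _ (f_homog v)) codegD1 //.
  have [le|lt] := leqP (codeg D) N; last by rewrite leqNgt ltn_addr // mulr0.
  by rewrite leq_subRL // subnDA; case: ifP; rewrite ?mulr0.
under eq_bigr => v vD do rewrite multsE E //.
case: ifP => _; last by rewrite big1 // => v _; rewrite mulr0.
rewrite ffunE raddf_sum; apply: eq_bigr => v _.
by rewrite !ext_sign1 raddfMsign.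
Qed.

(** Multiplication by the symbols is the leading part of T for the weight filtration. *)
Definition deforms (T : 'I_n -> {linear A -> A}) :=
  forall v N g, (msize g <= N.+1)%N -> (msize (T v g - f v * g) <= N + e v)%N.

Section Deformed.
Variable T : 'I_n -> {linear A -> A}.
Hypothesis T_def : deforms T.
Hypothesis TC : forall u v g, T u (T v g) = T v (T u g).

Lemma kos_sub_symbol N w : inW N.+1 w -> inW N (kos T w - kos (mults f) w).
Proof.
move=> Hw D; rewrite !ffunE -sumrB; apply: msize_sum_bound => v vD.
rewrite -mulrBr ext_sign1; apply: msize_sign; rewrite multsE.
have := Hw (D :\ v); rewrite codegD1 // => Hwv.
have [lt|le] := ltnP N (codeg D + e v).
  move: Hwv; have -> : (N.+1 - (codeg D + e v) = 0)%N by apply/eqP; rewrite subn_eq0.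
  by rewrite leqn0 msize_poly_eq0 => /eqP->; rewrite raddf0 mulr0 subrr msize_bound0.
move: Hwv; rewrite subSn // => /T_def/leq_trans; apply.
by rewrite subnDA subnK // leq_subRL // (leq_trans (leq_addr _ _) le).
Qed.

Lemma inW_kos_symbol N w : inW N w -> inW N (kos (mults f) w).
Proof.
move=> Hw D; rewrite ffunE; apply: msize_sum_bound => v vD.
rewrite ext_sign1; apply: msize_sign; rewrite multsE.
have := Hw (D :\ v); rewrite codegD1 // subnDA => Hwv.
have [lt|le] := leqP (e v) (N - codeg D).
  by rewrite -(subnKC lt); apply: msizeM_bound => //; apply: msize_homog_le.
move: Hwv; have -> : (N - codeg D - e v = 0)%N by apply/eqP; rewrite subn_eq0 ltnW.
by rewrite leqn0 msize_poly_eq0 => /eqP->; rewrite mulr0 msize_bound0.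
Qed.

Lemma inW_kos N w : inW N w -> inW N (kos T w).
Proof.
move=> Hw; rewrite -(subrK (kos (mults f) w) (kos T w)); apply: inWD.
  by apply: kos_sub_symbol; apply: inWW Hw.
exact: inW_kos_symbol.
Qed.

Variable Nx : nat.
Hypothesis f_pow : forall v, exists a : 'I_n -> A, 'X_v ^+ Nx = \sum_u a u * f u.

(** Strictness.  The leading part of a cochain whose differential has lower weight is a symbol
    cocycle, hence a symbol coboundary; subtracting the corresponding coboundary of T lowers
    the weight, until it is that of the differential. *)
Lemma kos_strict q N j z : (q < n)%N -> isform q z -> inW (N + j) z -> inW N (kos T z) ->
  exists u, [/\ isprim q u, inW (N + j) u & inW N (z - kos T u)].
Proof.
move=> ltqn; elim: j z => [|j IHj] z Hz Wz Wdz.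
  rewrite addn0 in Wz *; exists 0; rewrite raddf0 subr0.
  by split=> // B; rewrite ffunE // msize_bound0.
rewrite addnS in Wz; set K := (N + j)%N in Wz IHj.
have Wfz : inW K (kos (mults f) z).
  rewrite -(subrK (kos T z) (kos (mults f) z)); apply: inWD; last exact: inWW (leq_addr _ _) Wdz.
  by move=> B; have := kos_sub_symbol Wz B; rewrite !ffunE -opprB msizeN.
have [||u' Hu' Eu'] := @koszul_acyclic _ _ f Nx f_pow q (top_part K z) ltqn.
- by move=> B /Hz E; rewrite ffunE E pihomog0; case: ifP.
- by rewrite kos_top_part; apply: top_part_small.
pose u := top_part K u'.
have Eu : kos (mults f) u = top_part K z by rewrite kos_top_part -Eu' top_part_id.
have Hu : isprim q u by apply: isprim_top.
have Wu : inW K.+1 u by apply: inW_top.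
pose z1 := z - kos T u.
have Wz1 : inW K z1.
  have -> : z1 = (z - top_part K z) - (kos T u - kos (mults f) u).
    by rewrite Eu opprB addrA subrK.
  by apply: inWB; [apply: sub_top_part|apply: kos_sub_symbol].
have Edz1 : kos T z1 = kos T z by rewrite raddfB /= (kos_kos _ TC) subr0.
have [||u2 [Hu2 Wu2 Wz2]] := IHj z1 _ Wz1; rewrite ?Edz1 //.
  by apply: isformB => //; apply: isform_kos.
exists (u + u2); split; first exact: isprimD.
  by rewrite addnS; apply: inWD => //; apply: inWW Wu2.
by rewrite raddfD /= opprD addrA.
Qed.

(** Strictness down to weight zero, where only the zero form is left. *)
Lemma kos_exact q z : (q < n)%N -> isform q z -> kos T z = 0 ->
  exists2 u, isprim q u & z = kos T u.
Proof.
move=> ltqn Hz dz0; have [N Wz] := inW_ex z.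
have [|||u [Hu _ Wu]] := @kos_strict q 0 N z ltqn => //.
  by rewrite dz0 => B; rewrite ffunE msize_bound0.
by exists u => //; apply/eqP; rewrite -subr_eq0; apply/eqP/inW0.
Qed.

(** Without this control on the weight of the primitive, exactness would not restrict to the
    finite-dimensional pieces of the filtration. *)
Lemma kos_exact_weight q N z : (q < n)%N -> isform q z -> inW N z -> kos T z = 0 ->
  exists u, [/\ isprim q u, inW N u & z = kos T u].
Proof.
move=> ltqn Hz Wz dz0; have [|||u [Hu Wu Ez]] := @kos_strict q 0 N z ltqn => //.
  by rewrite dz0 => B; rewrite ffunE msize_bound0.
by exists u; split=> //; apply/eqP; rewrite -subr_eq0; apply/eqP/inW0.
Qed.

(** Strictness applied to the primitive itself, one degree below the top. *)
Lemma kos_top_strict N u : isprim n u -> inW N (kos T u) ->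
  exists u', [/\ isprim n u', inW N u' & kos T u' = kos T u].
Proof.
move=> Hu Wdu; have [n0|n_gt0] := posnP n.
  have -> : u = 0 by apply: isprim0 => B _; apply: Hu; rewrite eq_sym {1}n0.
  by exists 0; split=> // B; rewrite ffunE // msize_bound0.
have [M Wu] := inW_ex u.
have [||||u1 [Hu1 _ Wu1]] := @kos_strict n.-1 N M u.
- by rewrite ltn_predL.
- exact/isprim_pred.
- by apply: inWW Wu; apply: leq_addl.
- by [].
exists (u - kos T u1); split=> //; last by rewrite raddfB /= (kos_kos _ TC) subr0.
by apply/isprim_pred => //; apply: isformB; [apply/isprim_pred|apply: isform_kos].
Qed.

(** A monomial of degree above n * Nx is divisible by the Nx-th power of some variable, which
    lies in the ideal of the symbols. *)
Lemma kos_onto_symbol K g : (n * Nx < K)%N -> g \is K.-homog ->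
  exists2 u, isprim n u & kos (mults f) u = vform g.
Proof.
move=> ltK /dhomogP hg; rewrite [g]mpolyE big_seq.
pose Q g := exists2 u, isprim n u & kos (mults f) u = vform g.
suff : Q (\sum_(m <- msupp g | m \in msupp g) g@_m *: 'X_[m]) by [].
elim/big_ind: _ => [|x y [u1 H1 E1] [u2 H2 E2]|m m_g]; rewrite /Q.
- exists 0 => [B|]; first by rewrite ffunE.
  by rewrite raddf0; apply/ffunP=> B; rewrite !ffunE; case: ifP.
- exists (u1 + u2); first exact: isprimD.
  by rewrite raddfD /= E1 E2; apply/ffunP=> B; rewrite !ffunE; case: ifP; rewrite ?addr0.
have [v lev] : exists v, (Nx <= m v)%N.
  apply: contrapT => no; move: ltK; rewrite -(hg _ m_g) /= ltnNge mdegE => /negP; apply.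
  rewrite -[X in (_ <= X * _)%N](card_ord n) -sum_nat_const; apply: leq_sum => v _.
  by rewrite leqNgt; apply/negP=> lt; apply: no; exists v; apply: ltnW.
have [a Ea] := f_pow v.
pose g' := g@_m *: 'X_[m - U_(v) *+ Nx] : A.
exists (contraction a (vform g')); first by apply/isprim_contraction/isform_vform.
rewrite kos_contraction_vform -Ea; congr vform.
rewrite /g' -scalerAr mpolyXn mulrC -mpolyXD submK //; apply/mnm_lepP=> u.
by rewrite mulmnE mnm1E; have [<-|_] := eqVneq v u; rewrite ?mul1n ?mul0n.
Qed.

(** Top forms of large weight are coboundaries up to lower weight, since they are so for the
    symbols; every class thus has a representative of bounded weight. *)
Lemma kos_top_reduce j z : isform n z -> inW ((n * Nx).+1 + j) z ->
  exists2 u, isprim n u & inW (n * Nx).+1 (z - kos T u).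
Proof.
elim: j z => [|j IHj] z Hz Wz.
  exists 0 => [B|]; first by rewrite ffunE.
  by move: Wz; rewrite raddf0 subr0 addn0.
rewrite addnS in Wz; set K := (_ + j)%N in Wz IHj.
have Htop : isform n (top_part K z) by move=> B /Hz E; rewrite ffunE E pihomog0; case: ifP.
have Etop := isform_full Htop.
have [u' Hu' Eu'] : exists2 u, isprim n u & kos (mults f) u = top_part K z.
  rewrite Etop; apply: (@kos_onto_symbol K); first exact: leq_addr.
  by rewrite ffunE codegT subn0 pihomogP.
pose u := top_part K u'.
have Eu : kos (mults f) u = top_part K z by rewrite kos_top_part Eu' top_part_id.
have Hu : isprim n u by apply: isprim_top.
have Wu : inW K.+1 u by apply: inW_top.
have [||u2 Hu2 Wu2] := IHj (z - kos T u).
- by apply: isformB => //; apply: isform_kos.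
- have -> : z - kos T u = (z - top_part K z) - (kos T u - kos (mults f) u).
    by rewrite Eu opprB addrA subrK.
  by apply: inWB; [apply: sub_top_part|apply: kos_sub_symbol].
by exists (u + u2); [apply: isprimD|rewrite raddfD /= opprD addrA].
Qed.

End Deformed.
End Symbol.
End Deformation.

(** * Dimensions of quotients *)

Section LinearAlgebra.
Variable k : fieldType.

Section CoordinateSubspace.
Variable I : finType.
Local Notation E := {ffun I -> k^o}.
Implicit Types (P Q : pred I) (x : E).

Definition mask P x : E := [ffun i => if P i then 0 else x i].

Fact mask_linear P : linear (mask P).
Proof.
by move=> c x y; apply/ffunP=> i; rewrite !ffunE; case: ifP; rewrite ?scaler0 ?addr0.
Qed.

HB.instance Definition _ P := GRing.isLinear.Build k E E *:%R (mask P) (mask_linear P).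

Definition coordv P : {vspace E} := lker (linfun (mask P)).

Lemma coordvP P x : reflect (forall i, ~~ P i -> x i = 0) (x \in coordv P).
Proof.
rewrite memv_ker lfunE /=; apply: (iffP eqP) => [/ffunP Hx i /negPf Pi|Hx].
  by have := Hx i; rewrite !ffunE Pi.
by apply/ffunP=> i; rewrite !ffunE; case: ifP => // /negbT/Hx.
Qed.

Lemma dim_coordv_le P : (\dim (coordv P) <= #|P|)%N.
Proof.
pose delta i : E := [ffun j => (i == j)%:R].
pose s := [seq delta i | i <- enum P].
have -> : #|P| = size s by rewrite size_map cardE.
apply: leq_trans (dim_span s); apply: dimvS; apply/subvP=> x /coordvP Hx.
have -> : x = \sum_(i <- enum P) x i *: delta i.
  apply/ffunP=> j; rewrite sum_ffunE.
  have E0 i : i != j -> (x i *: delta i) j = 0.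
    by move=> /negPf nij; rewrite !ffunE nij scaler0.
  rewrite big_enum /=; case Pj: (P j); last first.
    rewrite Hx ?Pj // big1 // => i Pi; apply: E0.
    by apply: contraFneq Pj => <-.
  rewrite (bigD1 j) //= big1 ?addr0 => [|i /andP[_]]; last exact: E0.
  by rewrite !ffunE eqxx [_ *: _]mulr1.
rewrite big_seq; apply: memv_suml => i Pi; apply/memvZ/memv_span.
by apply: map_f.
Qed.

(** The unit vectors bound the dimension from above, for P as for its complement; the two
    dimensions add up to that of the whole space, so both bounds are attained. *)
Lemma dim_coordv P : \dim (coordv P) = #|P|.
Proof.
have limg_mask : (linfun (mask P) @: fullv = coordv (predC P))%VS.
  apply/vspaceP=> x; apply/memv_imgP/coordvP => [[y _ ->] i|Hx].
    by rewrite lfunE /= ffunE negbK => ->.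
  exists x; first exact: memvf.
  rewrite lfunE; apply/ffunP=> i; rewrite ffunE; case: ifP => // Pi.
  by rewrite Hx //= Pi.
apply/eqP; rewrite eqn_leq dim_coordv_le /=.
rewrite -(leq_add2r #|predC P|) cardC -[X in (X <= _)%N]muln1 -[(_ * 1)%N]/(#|I| * dim k^o)%N.
rewrite -[X in (X <= _)%N](dimvf {ffun I -> k^o}) -(limg_ker_dim (linfun (mask P)) fullv).
by rewrite capfv leq_add2l limg_mask dim_coordv_le.
Qed.

End CoordinateSubspace.

(** A complement of U in V is mapped isomorphically onto H, and its basis gives coordinates. *)
Lemma has_dim_quot (E : vectType k) (H : lmodType k) (phi : {linear E -> H})
    (U V : {vspace E}) :
  (U <= V)%VS -> (forall x, x \in V -> (phi x == 0) = (x \in U)) ->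
  (forall h, exists2 x, x \in V & phi x = h) ->
  has_dim H (\dim V - \dim U)%N.
Proof.
move=> sUV kerE onto; pose W := (V :\: U)%VS.
have dW : \dim W = (\dim V - \dim U)%N.
  by rewrite -(dimv_cap_compl V U) (capv_idPr sUV) addKn.
have sWV : (W <= V)%VS by apply: diffvSl.
have WU0 x : x \in W -> x \in U -> x = 0.
  by move=> xW xU; apply/eqP; rewrite -memv0 -(capv_diff V U) memv_cap xU andbT.
rewrite -dW; pose b := vbasis W.
pose psi (r : 'rV[k]_(\dim W)) := phi (\sum_i r 0 i *: b`_i).
have psi_lin : linear psi.
  move=> c r s; apply: etrans (linearP phi c _ _); congr (phi _).
  rewrite scaler_sumr -big_split /=.
  by apply: eq_bigr => i _; rewrite !mxE scalerDl scalerA.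
have inW (r : 'rV[k]_(\dim W)) : \sum_i r 0 i *: b`_i \in W.
  by apply: memv_suml => i _; apply/memvZ/vbasis_mem/mem_nth; rewrite size_tuple.
have psi_inj r : psi r = 0 -> r = 0.
  move/eqP; rewrite kerE ?(subvP sWV) // => /(WU0 _ (inW r)) r0.
  apply/rowP=> i; rewrite mxE; move/freeP: (basis_free (vbasisP W)) => /(_ (r 0) r0).
  exact.
have psi_onto h : exists r, psi r = h.
  have [x xV <-] := onto h.
  have : x \in (W + U)%VS.
    by rewrite addv_diff; apply: subvP xV; apply: addvSl.
  case/memv_addP=> w wW [u uU Ex]; exists (\row_i coord b i w).
  have Eu : phi u = 0 by apply/eqP; rewrite kerE // (subvP sUV).
  rewrite Ex linearD Eu addr0 {2}(coord_vbasis wW) /psi; congr (phi _).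
  by apply: eq_bigr => i _; rewrite mxE.
have [g gK] := choice psi_onto.
have Kg r : g (psi r) = r.
  apply/eqP; rewrite -subr_eq0; apply/eqP/psi_inj.
  by rewrite -[_ - _]addrC -scaleN1r psi_lin gK scaleN1r addNr.
constructor; exists g; last by exists psi.
by move=> c x y; rewrite -{1}(gK x) -{1}(gK y) -psi_lin Kg.
Qed.

End LinearAlgebra.

(** * Dimension of the top cohomology *)

Section KoszulDimension.
Variables (k : fieldType) (n : nat) (e : 'I_n -> nat).
Local Notation A := {mpoly k[n]}.
Local Notation form := (forms k n).
Local Notation codeg := (codeg e).
Local Notation inW := (inW e).
Implicit Types (B : {set 'I_n}) (w : form) (g h : A).

Section Truncation.
Variable N : nat.
Local Notation I := ({set 'I_n} * 'X_{1..n < N})%type.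
Local Notation E := {ffun I -> k^o}.

Definition poly_form (x : E) : form :=
  [ffun B : {set 'I_n} => \sum_(m : 'X_{1..n < N}) x (B, m) *: 'X_[m]].

Definition coef_form (w : form) : E := [ffun i : I => (w i.1)@_(i.2)].

Lemma mcoeff_poly_form x B (m : 'X_{1..n < N}) : (poly_form x B)@_m = x (B, m).
Proof.
rewrite ffunE raddf_sum (bigD1 m) //= mcoeffZ mcoeffX eqxx mulr1.
rewrite big1 ?addr0 // => m' nm; rewrite mcoeffZ mcoeffX.
by rewrite (inj_eq val_inj) (negPf nm) mulr0.
Qed.

Lemma poly_formK : cancel poly_form coef_form.
Proof. by move=> x; apply/ffunP=> -[B m]; rewrite ffunE mcoeff_poly_form. Qed.

Lemma coef_formK w : (forall B, (msize (w B) <= N)%N) -> poly_form (coef_form w) = w.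
Proof.
move=> Hw; apply/ffunP=> B; rewrite ffunE [RHS](mpolywE (Hw B)).
by apply: eq_bigr => m _; rewrite ffunE.
Qed.

Definition trunc_kos (T : 'I_n -> {linear A -> A}) (x : E) : E :=
  coef_form (kos T (poly_form x)).

Fact poly_form_linear : linear poly_form.
Proof.
move=> c x y; apply/ffunP=> B; rewrite !ffunE scaler_sumr -big_split /=.
by apply: eq_bigr => m _; rewrite !ffunE scalerDl scalerA.
Qed.

HB.instance Definition _ := GRing.isLinear.Build k E form *:%R poly_form poly_form_linear.

Fact trunc_kos_linear T : linear (trunc_kos T).
Proof.
move=> c x y; rewrite /trunc_kos linearP linearP; apply/ffunP=> i.
by rewrite !ffunE mcoeffD mcoeffZ.
Qed.

HB.instance Definition _ T :=
  GRing.isLinear.Build k E E *:%R (trunc_kos T) (trunc_kos_linear T).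

(** The coefficients that may be nonzero in a primitive of degree q - 1 and weight below N. *)
Definition cells (q : nat) : pred I :=
  fun i => (#|i.1|.+1 == q) && (mdeg i.2 < N - codeg i.1)%N.

Definition prim_space q : {vspace E} := coordv k (cells q).

Lemma prim_spaceP q x :
  reflect (isprim q (poly_form x) /\ inW N (poly_form x)) (x \in prim_space q).
Proof.
apply: (iffP (coordvP _ _)) => [Hx|[Hp Hw] [B m]].
  split=> B.
    move=> qB; rewrite ffunE big1 // => m _.
    by rewrite Hx ?scale0r // /cells /= (negPf qB).
  apply: msize_boundP => m Hm; have [lt|le] := ltnP (mdeg m) N; last first.
    rewrite ffunE; apply: msize_coef0 le; apply: msize_sum_bound => m' _.
    by apply: leq_trans (msizeZ_le _ _) _; rewrite msizeX bmdeg.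
  rewrite -[m]/(val (BMultinom lt)) mcoeff_poly_form Hx //.
  by rewrite /cells /= [(mdeg m < _)%N]ltnNge Hm andbF.
rewrite /cells /= negb_and -leqNgt -mcoeff_poly_form => /orP[/Hp->|Hm].
  by rewrite mcoeff0.
by apply: msize_coef0 Hm; apply: Hw.
Qed.

Lemma inW_poly_form w : inW N w -> poly_form (coef_form w) = w.
Proof. by move=> Hw; apply: coef_formK => B; apply: leq_trans (Hw B) (leq_subr _ _). Qed.

Lemma coef_prim_space q w : isprim q w -> inW N w -> coef_form w \in prim_space q.
Proof. by move=> Hp Hw; apply/prim_spaceP; rewrite inW_poly_form. Qed.

(** Rank-nullity: by exactness the kernel in one degree is the image from the degree below. *)
Lemma dim_trunc_image (T : 'I_n -> {linear A -> A}) q :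
  (forall u v g, T u (T v g) = T v (T u g)) ->
  (forall w, inW N w -> inW N (kos T w)) ->
  (forall w, isform q w -> inW N w -> kos T w = 0 ->
     exists u, [/\ isprim q u, inW N u & w = kos T u]) ->
  (\dim (linfun (trunc_kos T) @: prim_space q) +
     \dim (linfun (trunc_kos T) @: prim_space q.+1) = \dim (prim_space q.+1))%N.
Proof.
move=> TC TW Texact; rewrite -(limg_ker_dim (linfun (trunc_kos T)) (prim_space q.+1)).
congr (\dim _ + _)%N; apply/vspaceP=> x; apply/memv_imgP/memv_capP.
  case=> y /prim_spaceP[Hy Wy] ->; rewrite lfunE /= -[trunc_kos T y]/(coef_form (kos T (poly_form y))).
  have Wdy := TW _ Wy; split.
    by apply: coef_prim_space => //; apply/isprimS/isform_kos.
  rewrite memv_ker lfunE /= /trunc_kos inW_poly_form // (kos_kos _ TC); apply/eqP/ffunP=> i.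
  by rewrite !ffunE mcoeff0.
case=> /prim_spaceP[/isprimS Hx Wx] Kx; have dx0 : trunc_kos T x = 0.
  by move: Kx; rewrite memv_ker lfunE => /eqP.
have [|u [Hu Wu Eu]] := Texact _ Hx Wx.
  by rewrite -(inW_poly_form (TW _ Wx)) -/(trunc_kos T x) dx0 raddf0.
exists (coef_form u); first by apply: coef_prim_space.
by rewrite lfunE /= /trunc_kos inW_poly_form // -Eu poly_formK.
Qed.

End Truncation.

Section Main.
Variables (f : 'I_n -> A) (T : 'I_n -> {linear A -> A}) (Nx : nat).
Hypothesis f_homog : forall v, f v \is (e v).-homog.
Hypothesis T_def : deforms e f T.
Hypothesis TC : forall u v g, T u (T v g) = T v (T u g).
Hypothesis f_pow : forall v, exists a : 'I_n -> A, 'X_v ^+ Nx = \sum_u a u * f u.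

(** The system with symbols of the same degrees whose top cohomology is computed by counting
    monomials. *)
Definition pure_power v : A := 'X_v ^+ e v.

Lemma pure_power_homog v : pure_power v \is (e v).-homog.
Proof. by rewrite /pure_power mpolyXn dhomogX /= mdegMn mdeg1 mul1n. Qed.

Lemma pure_power_deforms : deforms e pure_power (mults pure_power).
Proof. by move=> v N g _; rewrite multsE subrr msize_bound0. Qed.

Lemma multsC (h : 'I_n -> A) u v g : mults h u (mults h v g) = mults h v (mults h u g).
Proof. by rewrite !multsE mulrCA. Qed.

Lemma pure_power_pow v :
  exists a : 'I_n -> A, 'X_v ^+ (\max_u e u) = \sum_u a u * pure_power u.
Proof.
set M := (\max_u e u)%N; have leM : (e v <= M)%N by apply: leq_bigmax.
exists (fun u => if u == v then 'X_v ^+ (M - e v) else 0).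
rewrite (bigD1 v) //= eqxx /pure_power -exprD subnK //.
by rewrite big1 ?addr0 // => u /negPf ->; rewrite mul0r.
Qed.

(** Exactness determines the rank in each degree from the rank one degree below and the
    dimension of the term, which is the same for both systems. *)
Lemma dim_trunc_image_pure N q : (q <= n)%N ->
  \dim (linfun (trunc_kos (N:=N) T) @: prim_space N q) =
  \dim (linfun (trunc_kos (N:=N) (mults pure_power)) @: prim_space N q).
Proof.
elim: q => [|q IHq] ltqn.
  have -> : prim_space N 0 = 0%VS.
    apply/eqP; rewrite -subv0; apply/subvP=> x /prim_spaceP[/isprim0 x0 _].
    by rewrite memv0 -(poly_formK x) x0; apply/eqP/ffunP=> i; rewrite !ffunE mcoeff0.
  by rewrite !limg0 !dimv0.
have ET : (\dim (linfun (trunc_kos (N:=N) T) @: prim_space N q) +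
     \dim (linfun (trunc_kos (N:=N) T) @: prim_space N q.+1) = \dim (prim_space N q.+1))%N.
  apply: dim_trunc_image => //; first exact: (inW_kos f_homog T_def).
  by move=> w Hw Ww; apply: (kos_exact_weight f_homog T_def TC f_pow).
have EP : (\dim (linfun (trunc_kos (N:=N) (mults pure_power)) @: prim_space N q) +
     \dim (linfun (trunc_kos (N:=N) (mults pure_power)) @: prim_space N q.+1)
     = \dim (prim_space N q.+1))%N.
  apply: dim_trunc_image; first exact: multsC.
    exact: (inW_kos pure_power_homog pure_power_deforms).
  move=> w Hw Ww.
  by apply: (kos_exact_weight pure_power_homog pure_power_deforms (multsC _) pure_power_pow).
by apply/eqP; rewrite -(eqn_add2l (\dim (linfun (trunc_kos (N:=N) T) @: prim_space N q))) ET IHq ?EP // ltnW.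
Qed.

Definition std_cells N : pred ({set 'I_n} * 'X_{1..n < N}) :=
  fun i => (i.1 == setT) && [forall v, (i.2 v < e v)%N].

Lemma cells_top N i : cells (N:=N) n.+1 i = (i.1 == setT).
Proof.
rewrite /cells eqSS card_full; case: (i.1 =P setT) => [->|//].
by rewrite codegT subn0 bmdeg.
Qed.

(** For pure powers the top coboundaries are spanned by the monomials divisible by some
    power 'X_v ^+ e v. *)
Lemma trunc_image_pure N : (linfun (trunc_kos (N:=N) (mults pure_power)) @: prim_space N n =
  coordv k (predI (cells (N:=N) n.+1) (predC (std_cells (N:=N)))))%VS.
Proof.
apply/vspaceP=> x; apply/memv_imgP/coordvP.
  case=> y /prim_spaceP[Hy Wy] -> [B m]; rewrite lfunE /= ffunE /= cells_top /=.
  rewrite /std_cells /=; have [->|nB] := eqVneq B setT; last first.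
    have -> : kos (mults pure_power) (poly_form y) B = 0.
      apply: (@isform_kos _ _ n _ _ Hy); by rewrite card_full.
    by rewrite mcoeff0.
  rewrite /= negbK => /forallP lt; rewrite ffunE raddf_sum big1 //= => v _.
  rewrite ext_sign1 -signr_odd; case: odd; rewrite ?mul1r // ?expr1 ?mulN1r ?mcoeffN;
  rewrite multsE /pure_power mpolyXn mcoeff_XM; case: ifP; rewrite ?oppr0 // => /mnm_lepP/(_ v);
  by rewrite mulmnE mnm1E eqxx mul1n leqNgt lt.
move=> Hx; have Hform : isform n (poly_form x).
  move=> B nB; rewrite ffunE big1 // => m _; rewrite Hx ?scale0r //=.
  by rewrite cells_top /= -card_full negb_and nB.
have Wx : inW N (poly_form x).
  move=> B; have [->|nB] := eqVneq B setT.
    rewrite codegT subn0 ffunE; apply: msize_sum_bound => m _.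
    by apply: leq_trans (msizeZ_le _ _) _; rewrite msizeX bmdeg.
  by rewrite Hform ?msize_bound0 // card_full.
pose Q g := exists2 u, isprim n u & kos (mults pure_power) u = vform g.
have [u Hu Eu] : Q (poly_form x setT).
  rewrite ffunE; elim/big_ind: _ => [|g h [u1 H1 E1] [u2 H2 E2]|m _].
  - exists 0 => [B|]; first by rewrite ffunE.
    by rewrite raddf0; apply/ffunP=> B; rewrite !ffunE; case: ifP.
  - exists (u1 + u2); first exact: isprimD.
    by rewrite raddfD /= E1 E2; apply/ffunP=> B; rewrite !ffunE; case: ifP; rewrite ?addr0.
  have [x0|nz] := eqVneq (x (setT, m)) 0.
    exists 0 => [B|]; first by rewrite ffunE.
    by rewrite raddf0 x0 scale0r; apply/ffunP=> B; rewrite !ffunE; case: ifP.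
  have [v lev] : exists v, (e v <= m v)%N.
    apply: contrapT => no; case/eqP: nz; apply: Hx; rewrite /= negb_and negbK.
    apply/orP; right; rewrite /std_cells /= eqxx /=; apply/forallP=> v.
    by rewrite ltnNge; apply/negP=> le; apply: no; exists v.
  pose g' := x (setT, m) *: 'X_[m - U_(v) *+ e v] : A.
  exists (contraction (fun u => (u == v)%:R) (vform g')).
    by apply/isprim_contraction/isform_vform.
  rewrite kos_contraction_vform (bigD1 v) //= eqxx mul1r big1 ?addr0; last first.
    by move=> u /negPf->; rewrite mul0r.
  congr vform; rewrite /g' /pure_power -scalerAr mpolyXn mulrC -mpolyXD submK //.
  apply/mnm_lepP=> u; rewrite mulmnE mnm1E.
  by have [<-|_] := eqVneq v u; rewrite ?mul1n ?mul0n.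
rewrite -(isform_full Hform) in Eu.
have [|u' [Hu' Wu' Eu']] := @kos_top_strict _ _ e _ pure_power_homog _ pure_power_deforms
  (multsC _) _ pure_power_pow N u Hu; rewrite ?Eu //.
exists (coef_form N u'); first by apply: coef_prim_space.
by rewrite lfunE /= /trunc_kos inW_poly_form // Eu' Eu poly_formK.
Qed.

Lemma card_std_cells N : (\sum_v e v < N)%N -> #|std_cells (N:=N)| = (\prod_v e v)%N.
Proof.
move=> ltN; pose F v := [pred i : 'I_N | (i < e v)%N].
have mdeg_lt (h : {ffun 'I_n -> 'I_N}) : h \in family F ->
    (mdeg [multinom val (h v) | v < n] < N)%N.
  move=> /familyP Hh; apply: leq_ltn_trans ltN; rewrite mdegE; apply: leq_sum => v _.
  by rewrite mnmE ltnW //; apply: Hh.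
have lt_mN (m : 'X_{1..n < N}) v : (m v < N)%N.
  by apply: leq_ltn_trans (bmdeg m); rewrite mdegE (bigD1 v) //= leq_addr.
pose expo (i : {set 'I_n} * 'X_{1..n < N}) := [ffun v => Ordinal (lt_mN i.2 v)].
transitivity #|[set expo i | i in std_cells (N:=N)]|.
  rewrite card_in_imset // => -[B m] [B' m'] /andP[/= /eqP-> _] /andP[/= /eqP-> _] E.
  congr pair; apply/val_inj/mnmP=> v.
  by have /(congr1 val) := congr1 (fun h : {ffun 'I_n -> 'I_N} => h v) E; rewrite !ffunE.
transitivity #|family F|.
  apply: eq_card => h; apply/imsetP/idP => [[[B m] /andP[_ /forallP lt] ->]|Hh].
    by apply/familyP => v; rewrite ffunE inE /=; apply: lt.
  exists (setT, BMultinom (mdeg_lt h Hh)).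
    by rewrite unfold_in /std_cells eqxx; apply/forallP => v /=; rewrite mnmE; apply: (familyP Hh).
  by apply/ffunP=> v; apply: val_inj; rewrite ffunE /= mnmE.
rewrite card_family foldrE big_map big_enum; apply: eq_bigr => v _.
have le_eN : (e v <= N)%N by rewrite ltnW // (leq_ltn_trans _ ltN) // (bigD1 v) //= leq_addr.
have widen_inj : injective (widen_ord le_eN).
  by move=> x y /(congr1 val) /= E; apply: val_inj.
rewrite -[RHS]card_ord -(card_imset _ widen_inj).
apply: eq_card => i; rewrite inE; apply/idP/imsetP => [lt|[j _ ->]]; last exact: (ltn_ord j).
by exists (Ordinal lt) => //; apply: val_inj.
Qed.

(** Two systems with symbols of the same degrees have truncated complexes with the same terms,
    both exact below the top, so their top cohomologies have the same dimension.  For the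
    powers 'X_v ^+ e v the monomials with all exponents below e v form a basis. *)
Theorem koszul_top_dim (H : lmodType k) (phi : {linear A -> H}) :
  (forall g, phi g = 0 <-> exists2 u, isprim n u & vform g = kos T u) ->
  (forall y : H, exists g, phi g = y) ->
  has_dim H (\prod_v e v)%N.
Proof.
(* N bounds the weight of some representative of each class, and the truncation contains all
   monomials with exponents below the e v. *)
move=> kerP onto; pose N := maxn (n * Nx).+1 (\sum_v e v).+1.
pose psi (x : {ffun ({set 'I_n} * 'X_{1..n < N})%type -> k^o}) := phi (poly_form x setT).
have psi_lin : linear psi.
  move=> c x y; apply: etrans (linearP phi c _ _).
  have E : poly_form (c *: x + y) = c *: poly_form x + poly_form y by apply: poly_form_linear.
  rewrite /psi E; congr (phi _).
  by rewrite [LHS]ffunE; congr (_ + _); rewrite [LHS]ffunE.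
pose psiL : {linear _ -> H} := HB.pack psi (GRing.isLinear.Build _ _ _ _ psi psi_lin).
have psiLE x : psiL x = phi (poly_form x setT) by [].
have leN : ((n * Nx).+1 <= N)%N by apply: leq_maxl.
pose U := (linfun (trunc_kos (N:=N) T) @: prim_space N n)%VS.
pose V := prim_space N n.+1.
have -> : (\prod_v e v = \dim V - \dim U)%N.
  rewrite /U dim_trunc_image_pure // trunc_image_pure !dim_coordv -(@card_std_cells N); last exact: leq_maxr.
  rewrite -[X in (X - _)%N](cardID (std_cells (N:=N))).
  rewrite [X in (X + _ - _)%N](_ : _ = #|std_cells (N:=N)|); last first.
    apply: eq_card => i; rewrite !inE -!topredE /= cells_top /std_cells.
    by rewrite andbA andbb.
  rewrite [X in (_ + X - _)%N](_ : _ = #|predI (cells (N:=N) n.+1) (predC (std_cells (N:=N)))|).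
    by rewrite addnK.
  by apply: eq_card => i; rewrite !inE -!topredE /= andbC.
have VP x : x \in V -> isform n (poly_form x) /\ inW N (poly_form x).
  by case/prim_spaceP => /isprimS.
have dE y : y \in prim_space N n -> poly_form (trunc_kos T y) = kos T (poly_form y).
  case/prim_spaceP => Hy Wy; apply: (@inW_poly_form N).
  exact: (inW_kos f_homog T_def Wy).
apply: (@has_dim_quot k _ H psiL U V).
- apply/subvP=> x /memv_imgP[y Hy ->]; rewrite lfunE /=; apply/prim_spaceP.
  rewrite dE //; case/prim_spaceP: Hy => Hy Wy; split.
    by apply/isprimS/isform_kos.
  exact: (inW_kos f_homog T_def Wy).
- move=> x /VP[Hx Wx]; rewrite psiLE; apply/eqP/memv_imgP => [/kerP[u Hu]|[y Hy ->]].
    rewrite -isform_full // => Eu; rewrite Eu in Wx.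
    have [u' [Hu' Wu' Eu']] := kos_top_strict f_homog T_def TC f_pow Hu Wx.
    exists (coef_form N u'); first by apply: coef_prim_space.
    by rewrite lfunE /= /trunc_kos inW_poly_form // Eu' -Eu poly_formK.
  rewrite lfunE /= dE //; apply/kerP; case/prim_spaceP: Hy => Hy Wy.
  by exists (poly_form y) => //; rewrite -isform_full //; apply: isform_kos.
move=> y; have [g <-] := onto y.
have [M WM] := inW_ex e (vform g).
have [||u Hu Wu] := @kos_top_reduce _ _ e f f_homog T T_def Nx f_pow M (vform g).
- exact: isform_vform.
- by apply: inWW WM; apply: leq_addl.
have WuN := inWW leN Wu; set z := vform g - kos T u in Wu WuN.
have Hz : isform n z by apply: isformB; [apply: isform_vform|apply: isform_kos].
exists (coef_form N z).
  by apply/prim_spaceP; rewrite inW_poly_form //; split=> //; apply/isprimS.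
rewrite psiLE inW_poly_form // /z.
have -> : (vform g - kos T u) setT = g - kos T u setT by rewrite !ffunE eqxx.
rewrite raddfB /= -[RHS]subr0; congr (_ - _); apply/kerP.
by exists u => //; rewrite -isform_full //; apply: isform_kos.
Qed.

End Main.
End KoszulDimension.

(** * Twisted de Rham cohomology *)

Section CohomologyClasses.
Variables (A : comNzRingType) (n : nat) (D : {linear forms A n -> forms A n}) (q : nat).
Implicit Types (w u : forms A n).

Lemma cocycleP w : reflect (isform q w /\ D w = 0) (cocycle D q w).
Proof.
apply: (iffP andP) => [[/forallP Hw /eqP ->]|[Hw ->]].
  by split=> // B /(implyP (Hw B))/eqP.
by split=> //; apply/forallP=> B; apply/implyP=> /Hw/eqP.
Qed.

Local Notation toc w := (insubd (0 : cocycles D q) w).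

Lemma tocK w : cocycle D q w -> cocycle_form (toc w) = w.
Proof. exact: insubdK. Qed.

Lemma cocycle_formB (z z' : cocycles D q) :
  cocycle_form (z - z') = cocycle_form z - cocycle_form z'.
Proof. exact: (raddfB (val : cocycles D q -> _)). Qed.

Lemma cocycle_formP c (z z' : cocycles D q) :
  cocycle_form (c *: z + z') = c *: cocycle_form z + cocycle_form z'.
Proof. exact: (linearP (val : cocycles D q -> _)). Qed.

Lemma coh_classB w w' : cocycle D q w -> cocycle D q w' ->
  coh_class D q w = coh_class D q w' <-> exists2 u, isprim q u & w - w' = D u.
Proof.
move=> Zw Zw'; rewrite /coh_class; split=> [/eqP|[u Hu Eu]].
  rewrite coh_pi_eq => /asboolP[u Hu Eu]; exists u => //.
  by rewrite -Eu cocycle_formB !tocK.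
apply/eqP; rewrite coh_pi_eq; apply/asboolP; exists u => //.
by rewrite cocycle_formB !tocK.
Qed.

Lemma coh_class0 : coh_class D q 0 = 0.
Proof.
have Z0 : cocycle D q 0 by apply/cocycleP; rewrite raddf0; split=> // B _; rewrite ffunE.
rewrite /coh_class -[RHS](subrr (\pi_(coh D q) (insubd 0 0))%qT).
apply: (addIr (\pi_(coh D q) (insubd 0 0))%qT).
rewrite subrK -coh_piD; apply/eqP; rewrite coh_pi_eq addrK.
apply/asboolP; exists 0 => [B _|]; first by rewrite ffunE.
by rewrite raddf0 tocK.
Qed.

Lemma coh_class_linear c w w' : cocycle D q w -> cocycle D q w' ->
  coh_class D q (c *: w + w') = c *: coh_class D q w + coh_class D q w'.
Proof.
move=> Zw Zw'; have -> : c *: coh_class D q w = (\pi_(coh D q) (c *: toc w))%qT by apply: coh_scale_pi.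
rewrite /coh_class -coh_piD.
have Zs : cocycle D q (c *: w + w').
  by apply/cocycleP; case/cocycleP: Zw => Hw dw; case/cocycleP: Zw' => Hw' dw';
     split; [move=> B /[dup]/Hw E1 /Hw' E2; rewrite !ffunE E1 E2 scaler0 addr0
            |rewrite linearP /= dw dw' scaler0 addr0].
apply/eqP; rewrite coh_pi_eq; apply/asboolP; exists 0 => [B _|]; first by rewrite ffunE.
by rewrite raddf0 cocycle_formB cocycle_formP !tocK // subrr.
Qed.

Lemma coh_reprP (h : coh D q) : cocycle D q (coh_repr h).
Proof. by rewrite /coh_repr; case: (repr h). Qed.

Lemma coh_reprK (h : coh D q) : coh_class D q (coh_repr h) = h.
Proof.
rewrite -[RHS]reprK /coh_class; congr (\pi_(coh D q) _)%qT.
by apply: val_inj; rewrite /= tocK //; apply: coh_reprP.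
Qed.

Lemma coh_class_eq0 w : cocycle D q w ->
  coh_class D q w = 0 <-> exists2 u, isprim q u & w = D u.
Proof.
move=> Zw; have Z0 : cocycle D q 0.
  by apply/cocycleP; rewrite raddf0; split=> // B _; rewrite ffunE.
by rewrite -coh_class0; split=> [/(coh_classB Zw Z0)|H]; last apply/(coh_classB Zw Z0);
   rewrite subr0.
Qed.

Lemma coh_exact_eq0 :
  (forall w, isform q w -> D w = 0 -> exists2 u, isprim q u & w = D u) ->
  forall h : coh D q, h = 0.
Proof.
move=> ex h; rewrite -[h]coh_reprK; apply/coh_class_eq0; first exact: coh_reprP.
by case/cocycleP: (coh_reprP h); apply: ex.
Qed.

(** There are no nonzero forms of degree larger than the number of variables. *)
Lemma coh_above (h : coh D q) : (n < q)%N -> h = 0.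
Proof.
move=> ltnq; apply: coh_exact_eq0 => w Hw _; exists 0.
  by move=> B _; rewrite ffunE.
rewrite raddf0; apply/ffunP=> B; rewrite ffunE Hw //.
by apply: contraTneq ltnq => <-; rewrite -leqNgt -[X in (_ <= X)%N]card_ord max_card.
Qed.

End CohomologyClasses.

Section TwistedDeRham.
Variables (A : comNzRingType) (n : nat) (F : {mpoly A[n]}).
Implicit Types (v : 'I_n) (g : {mpoly A[n]}).

Definition twisted_deriv_fun v g := g^`M(v) + F^`M(v) * g.

Fact twisted_deriv_linear v : linear (twisted_deriv_fun v).
Proof.
move=> c g h; rewrite /twisted_deriv_fun mderivD mderivZ mulrDr -scalerAr scalerDr.
by rewrite addrACA.
Qed.

HB.instance Definition _ v := GRing.isLinear.Build A {mpoly A[n]} {mpoly A[n]} *:%R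
  (twisted_deriv_fun v) (twisted_deriv_linear v).

Definition twisted_deriv v : {linear {mpoly A[n]} -> {mpoly A[n]}} := twisted_deriv_fun v.

Lemma twisted_derivE v g : twisted_deriv v g = g^`M(v) + F^`M(v) * g.
Proof. by []. Qed.

Lemma nabla_kos w : nabla F w = kos twisted_deriv w.
Proof. by apply/ffunP=> D; rewrite nablaE ffunE. Qed.

Lemma twisted_derivC u v g :
  twisted_deriv u (twisted_deriv v g) = twisted_deriv v (twisted_deriv u g).
Proof.
rewrite !twisted_derivE !mderivD !mderivM (mderiv_comm u v g) (mderiv_comm u v F).
ring.
Qed.

Lemma twisted_deriv_deforms e (f : 'I_n -> {mpoly A[n]}) :
  (forall v, (msize (F^`M(v) - f v) <= e v)%N) -> deforms e f twisted_deriv.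
Proof.
move=> Hf v N g Hg; rewrite twisted_derivE -addrA -mulrBl.
apply: msizeD_bound.
  by apply: leq_trans (msize_deriv_bound v Hg) _; apply: leq_addr.
have := Hf v; case: (e v) => [|ev] He.
  by move: He; rewrite leqn0 msize_poly_eq0 => /eqP->; rewrite mul0r msize_bound0.
by rewrite addnS -addSn addnC; apply: msizeM_bound.
Qed.

Definition top_class g : coh (nabla F) n := coh_class (nabla F) n (vform g).

Lemma vformP c g h : vform (c *: g + h) = c *: vform g + vform h :> forms A n.
Proof.
apply/ffunP=> B; rewrite [RHS]ffunE !ffunE; case: ifP => //.
by rewrite scaler0 addr0.
Qed.

Fact top_class_linear : linear top_class.
Proof.
by move=> c g h; rewrite /top_class vformP coh_class_linear //; apply: vform_cocycle.
Qed.

HB.instance Definition _ := GRing.isLinear.Build A {mpoly A[n]} (coh (nabla F) n) *:%R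
  top_class top_class_linear.

Lemma top_class_onto (h : coh (nabla F) n) : exists g, top_class g = h.
Proof.
exists (coh_repr h setT); rewrite /top_class -isform_full ?coh_reprK //.
by case/cocycleP: (coh_reprP h).
Qed.

Lemma top_class_eq0 g :
  top_class g = 0 <-> exists2 u, isprim n u & vform g = kos twisted_deriv u.
Proof.
rewrite coh_class_eq0; last exact: vform_cocycle.
by split=> -[u Hu Eu]; exists u; rewrite // Eu /= nabla_kos.
Qed.

(** Up to sign, this is the class of the differential of the form with the factor dx_v left out. *)
Lemma top_class_twisted v g : top_class (twisted_deriv v g) = 0.
Proof.
apply/top_class_eq0.
have cD : (#|[set: 'I_n] :\ v|.+1 = n)%N.
  by have := cardsD1 v [set: 'I_n]; rewrite inE add1n cardsT card_ord.
pose s := (-1) ^+ #|[set u in [set: 'I_n] :\ v | (u < v)%N]| : {mpoly A[n]}.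
pose w : forms A n := ext_mono (s * g) ([set: 'I_n] :\ v).
have Hw : isprim n w.
  by move=> B; rewrite ffunE; have [->|//] := eqVneq B ([set: 'I_n] :\ v); rewrite cD eqxx.
exists w => //; rewrite (isform_full (isform_kos _ Hw)); congr vform.
have Ew B : w B = if B == [set: 'I_n] :\ v then s * g else 0 by rewrite ffunE.
rewrite [kos _ _ _]ffunE (bigD1 v) ?inE //= Ew eqxx ext_sign1 -/s /s raddfMsign mulrA -expr2 sqrr_sign mul1r.
rewrite big1 ?addr0 // => u /andP[_ nuv]; rewrite Ew.
have [/setP/(_ u)|_] := eqVneq ([set: 'I_n] :\ u) ([set: 'I_n] :\ v).
  by rewrite !inE eqxx nuv.
by rewrite raddf0 mulr0.
Qed.

(** The value of a coboundary on the top component is a signed sum of twisted derivatives. *)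
Lemma top_class_descent (H : lmodType A) (phi : {linear {mpoly A[n]} -> H}) :
  (forall v g, phi (twisted_deriv v g) = 0) -> forall f, top_class f = 0 -> phi f = 0.
Proof.
move=> phi0 f /top_class_eq0[u _ Eu].
have -> : f = kos twisted_deriv u setT by rewrite -Eu ffunE eqxx.
rewrite ffunE linear_sum big1 // => v _; rewrite ext_sign1 -signr_odd.
set T := twisted_deriv v _; have T0 : phi T = 0 by apply: phi0.
by case: odd; rewrite ?mul1r // expr1 mulN1r linearN /= T0 oppr0.
Qed.

End TwistedDeRham.

(** The twisted derivatives are lower order deformations of multiplication by the symbols f v,
    whose Koszul complex is exact below the top degree. *)
Theorem twisted_cohomology (k : fieldType) n (F : {mpoly k[n]})
    (e : 'I_n -> nat) (f : 'I_n -> {mpoly k[n]}) N :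
  (forall v, f v \is (e v).-homog) ->
  (forall v, (msize (F^`M(v) - f v) <= e v)%N) ->
  (forall v, exists a : 'I_n -> {mpoly k[n]}, 'X_v ^+ N = \sum_u a u * f u) ->
  (forall q : nat, q != n -> forall h : coh (nabla F) q, h = 0) /\
  has_dim (coh (nabla F) n) (\prod_v e v)%N.
Proof.
move=> f_homog F_symb f_pow; have T_def := twisted_deriv_deforms F_symb.
have TC := twisted_derivC F; split=> [q nqn h|].
  case: (ltngtP q n) nqn => // [ltqn|ltnq] _; last exact: coh_above.
  apply: coh_exact_eq0 => w Hw /= dw; rewrite nabla_kos in dw.
  have [u Hu Eu] := kos_exact f_homog T_def TC f_pow ltqn Hw dw.
  by exists u; rewrite //= nabla_kos.
apply: (koszul_top_dim f_homog T_def TC f_pow (phi := @top_class k n F)).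
  exact: top_class_eq0.
exact: top_class_onto.
Qed.

(** * Conditional means and covariances *)

Section Covariance.
Variables (R : realType) (r : nat) (Sigma : 'M[R]_r).
Hypotheses (Sigma_sym : Sigma^T = Sigma) (Sigma_pd : posdef Sigma).
Implicit Types (I J K : {set 'I_r}) (a b : 'I_r).

Definition sel I : 'M[R]_(#|I|, r) := \matrix_(i, a) (enum_val i == a)%:R.

(** The inverse of the block on I, extended by zero to all points, so that the relations between
    nested sets are identities of matrices of one size. *)
Definition Ginv I : 'M[R]_r := (sel I)^T *m invmx (blk I I Sigma) *m sel I.

(** Conditional expectation given the coordinates in I, for a Gaussian vector of covariance
    Sigma; the points of I are included. *)
Definition Lcond I : 'M[R]_r := Sigma *m Ginv I.

(** Conditional covariance given the coordinates in I. *)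
Definition Ccond I : 'M[R]_r := Sigma - Sigma *m Ginv I *m Sigma.

Lemma mul_selE I n (M : 'M[R]_(r, n)) i j : (sel I *m M) i j = M (enum_val i) j.
Proof.
rewrite mxE (bigD1 (enum_val i)) //= mxE eqxx mul1r big1 ?addr0 // => a na.
by rewrite mxE eq_sym (negPf na) mul0r.
Qed.

Lemma mul_selTE I n (M : 'M[R]_(n, r)) i j : (M *m (sel I)^T) i j = M i (enum_val j).
Proof. by rewrite -[M]trmxK -trmx_mul mxE mul_selE [RHS]mxE. Qed.

Lemma blk_sel J I : blk J I Sigma = sel J *m Sigma *m (sel I)^T.
Proof. by apply/matrixP=> i j; rewrite mul_selTE mul_selE [LHS]mxE. Qed.

Lemma sel_selT I : sel I *m (sel I)^T = 1%:M.
Proof.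
by apply/matrixP=> i j; rewrite mul_selTE !mxE (inj_eq enum_val_inj).
Qed.

Lemma sel_sub I K : I \subset K -> (sel K)^T *m (sel K *m (sel I)^T) = (sel I)^T.
Proof.
move=> /subsetP sIK; apply/matrixP=> a j; rewrite mxE.
under eq_bigr => i _ do rewrite mul_selE !mxE.
have jK := sIK _ (enum_valP j).
rewrite (bigD1 (enum_rank_in jK (enum_val j))) //= enum_rankK_in // eqxx mulr1.
rewrite big1 ?addr0 ?mxE // => i ni.
case: (enum_val j =P enum_val i) => [E|_]; last by rewrite mulr0.
by case/eqP: ni; apply: enum_val_inj; rewrite enum_rankK_in.
Qed.

(** A vector in the kernel of a principal block would be isotropic for Sigma. *)
Lemma blk_unit I : blk I I Sigma \in unitmx.
Proof.
rewrite -row_free_unit -kermx_eq0; apply/rowV0P=> v /sub_kermxP v0.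
pose w := v *m sel I.
have w0 : (w *m Sigma *m w^T) 0 0 = 0.
  have -> : w *m Sigma *m w^T = v *m blk I I Sigma *m v^T.
    by rewrite /w trmx_mul blk_sel !mulmxA.
  by rewrite v0 mul0mx mxE.
have [wz|nz] := eqVneq w 0; last by have := Sigma_pd nz; rewrite w0 ltxx.
by rewrite -[v]mulmx1 -(sel_selT I) mulmxA -/w wz mul0mx.
Qed.

Lemma Ginv_tr I : (Ginv I)^T = Ginv I.
Proof.
rewrite /Ginv !trmx_mul trmxK trmx_inv mulmxA; congr (_ *m invmx _ *m _).
by rewrite blk_sel !trmx_mul trmxK Sigma_sym mulmxA.
Qed.

Lemma Ginv_Sigma_selT I : Ginv I *m Sigma *m (sel I)^T = (sel I)^T.
Proof.
rewrite /Ginv -!mulmxA [sel I *m (Sigma *m _)]mulmxA -blk_sel mulVmx ?blk_unit //.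
by rewrite mulmx1.
Qed.

(** Ginv K inverts Sigma on the vectors supported in K, in particular on those supported in I. *)
Lemma Ginv_Sigma_sel_sub I K : I \subset K ->
  Ginv K *m Sigma *m (sel I)^T = (sel I)^T.
Proof. by move=> sIK; rewrite -{1}(sel_sub sIK) mulmxA Ginv_Sigma_selT sel_sub. Qed.

Lemma Ginv_mul_sub I K : I \subset K -> Ginv K *m Sigma *m Ginv I = Ginv I.
Proof. by move=> sIK; rewrite {2}/Ginv !mulmxA Ginv_Sigma_sel_sub. Qed.

Lemma Ginv_mul_sup I K : I \subset K -> Ginv I *m Sigma *m Ginv K = Ginv I.
Proof.
move=> sIK; apply: trmx_inj.
rewrite (trmx_mul (Ginv I *m Sigma)) (trmx_mul (Ginv I)) Sigma_sym !Ginv_tr mulmxA.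
exact: Ginv_mul_sub.
Qed.

Lemma invmx_blkE K i j : invmx (blk K K Sigma) i j = Ginv K (enum_val i) (enum_val j).
Proof.
rewrite -mul_selTE -mul_selE !mulmxA sel_selT mul1mx -[RHS]/((_ *m _) i j).
by rewrite -mulmxA sel_selT mulmx1.
Qed.

Lemma Lmat_cond K I i j : Lmat Sigma K I i j = Lcond I (enum_val i) (enum_val j).
Proof.
rewrite -mul_selTE -mul_selE /Lcond /Ginv !mulmxA; congr (fun_of_matrix _ i j).
by rewrite /Lmat blk_sel -[RHS]mulmxA sel_selT mulmx1.
Qed.

Lemma Cmat_cond K I i j : Cmat Sigma K I i j = Ccond I (enum_val i) (enum_val j).
Proof.
rewrite -mul_selTE -mul_selE /Ccond /Ginv; congr (fun_of_matrix _ i j).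
by rewrite /Cmat !blk_sel mulmxBl mulmxBr !mulmxA.
Qed.

Lemma Ginv_out I a b : a \notin I -> Ginv I a b = 0.
Proof.
move=> aI; rewrite /Ginv -mulmxA mxE big1 // => i _; rewrite !mxE.
case: eqP => [E|_]; last by rewrite mul0r.
by rewrite -E enum_valP in aI.
Qed.

Lemma Lcond_in I a b : a \in I -> Lcond I a b = (a == b)%:R.
Proof.
move=> aI; rewrite -(enum_rankK_in aI aI) -mul_selE /Lcond.
have -> : sel I *m (Sigma *m Ginv I) = sel I.
  apply: trmx_inj; rewrite (trmx_mul (sel I)) (trmx_mul Sigma) Sigma_sym Ginv_tr.
  exact: Ginv_Sigma_selT.
by rewrite mxE.
Qed.

Lemma Lcond_out I a b : b \notin I -> Lcond I a b = 0.
Proof.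
move=> bI; rewrite mxE big1 // => c _.
by rewrite -(Ginv_tr I) mxE Ginv_out // mulr0.
Qed.

Lemma Ccond_tr I : (Ccond I)^T = Ccond I.
Proof.
rewrite /Ccond raddfB /= (trmx_mul (Sigma *m Ginv I)) (trmx_mul Sigma).
by rewrite Sigma_sym Ginv_tr mulmxA.
Qed.

Lemma Ccond_in I a b : b \in I -> Ccond I a b = 0.
Proof.
move=> bI; rewrite -(enum_rankK_in bI bI) -mul_selTE /Ccond mulmxBl.
rewrite -(mulmxA (Sigma *m Ginv I)) -(mulmxA Sigma) (mulmxA (Ginv I)).
by rewrite Ginv_Sigma_selT subrr mxE.
Qed.

Lemma Ccond_sym I a b : Ccond I a b = Ccond I b a.
Proof. by rewrite -{1}(Ccond_tr I) mxE. Qed.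

(** The law of total expectation. *)
Lemma Lcond_comp I K : I \subset K -> Lcond K *m Lcond I = Lcond I.
Proof. by move=> sIK; rewrite /Lcond -mulmxA (mulmxA (Ginv K)) Ginv_mul_sub. Qed.

(** The law of total covariance: the fluctuation around the mean given I is that of the mean
    given K, plus the fluctuation around the latter. *)
Lemma Ccond_comp I K : I \subset K ->
  Lcond K *m Ccond I *m (Lcond K)^T + Ccond K = Ccond I.
Proof.
move=> sIK; rewrite /Lcond /Ccond (trmx_mul Sigma) Sigma_sym Ginv_tr.
rewrite mulmxBr mulmxBl.
have -> : Sigma *m Ginv K *m Sigma *m (Ginv K *m Sigma) =
    Sigma *m (Ginv K *m Sigma *m Ginv K) *m Sigma by rewrite !mulmxA.
have -> : Sigma *m Ginv K *m (Sigma *m Ginv I *m Sigma) *m (Ginv K *m Sigma) =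
    Sigma *m (Ginv K *m Sigma *m Ginv I *m Sigma *m Ginv K) *m Sigma by rewrite !mulmxA.
rewrite (Ginv_mul_sub (subxx K)) Ginv_mul_sub // Ginv_mul_sup //.
by rewrite addrC addrA subrK.
Qed.

End Covariance.

(** * The Wick operator *)

Section PolynomialInduction.

Lemma mpoly_gen_ind (A : comNzRingType) n (Q : {mpoly A[n]} -> Prop) :
  (forall c, Q c%:MP) -> (forall i, Q 'X_i) ->
  (forall f g, Q f -> Q g -> Q (f + g)) -> (forall f g, Q f -> Q g -> Q (f * g)) ->
  forall f, Q f.
Proof.
move=> QC QX QD QM f; rewrite [f]mpolyE.
apply: (big_ind Q) => [|//|m _]; first by rewrite -mpolyC0.
rewrite -mul_mpolyC; apply: (QM) => //; rewrite mpolyXE_id.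
apply: (big_ind Q) => [|//|i _]; first by rewrite -mpolyC1.
by elim: (m i) => [|j IH]; rewrite ?expr0 ?exprS -?mpolyC1 //; apply: QM.
Qed.

(** Chain rule for substitution. *)
Lemma mderiv_mmap (C A : comNzRingType) n k (phi : {rmorphism C -> A})
    (h : 'I_n -> {mpoly A[k]}) (p : {mpoly C[n]}) u :
  (mmap (@mpolyC k A \o phi) h p)^`M(u) =
    \sum_v mmap (@mpolyC k A \o phi) h p^`M(v) * (h v)^`M(u).
Proof.
elim/mpoly_gen_ind: p => [c|i|p q IHp IHq|p q IHp IHq].
- by rewrite mmapC mderivC big1 // => v _; rewrite mderivC mmap0 mul0r.
- rewrite mmapX mmap1U (bigD1 i) //= big1 ?addr0 => [|v nv].
    rewrite mderivX mnm1E eqxx scale1r (_ : (U_(i) - U_(i))%MM = 0%MM).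
      by rewrite mpolyX0 rmorph1 mul1r.
    by apply/mnmP=> v; rewrite mnmBE subnn mnm0E.
  by rewrite mderivX mnm1E eq_sym (negPf nv) scale0r mmap0 mul0r.
- rewrite mmapD mderivD IHp IHq -big_split /=; apply: eq_bigr => v _.
  by rewrite mderivD mmapD mulrDl.
rewrite rmorphM mderivM IHp IHq mulr_suml mulr_sumr -big_split /=.
apply: eq_bigr => v _; rewrite mderivM mmapD !rmorphM /=; ring.
Qed.

Lemma mderivU (A : comNzRingType) n (i j : 'I_n) :
  ('X_i : {mpoly A[n]})^`M(j) = (i == j)%:R.
Proof.
rewrite mderivX mnm1E; case: eqP => [->|_]; last by rewrite scale0r.
rewrite scale1r (_ : (U_(j) - U_(j))%MM = 0%MM) ?mpolyX0 //.
by apply/mnmP=> v; rewrite mnmBE subnn mnm0E.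
Qed.

End PolynomialInduction.

Section Labels.
Variables (A : comNzRingType) (r d : nat).
Implicit Types (I J K : {set 'I_r}) (a b : 'I_r) (nu : 'I_d).

Lemma pos_enum K (i : 'I_#|K|) : pos K (enum_val i) = Some i.
Proof.
rewrite /pos; case: pickP => [j /eqP/enum_val_inj->//|/(_ i)].
by rewrite eqxx.
Qed.

Variant pos_spec K a : option 'I_#|K| -> Prop :=
  | PosIn i of enum_val i = a & a \in K : pos_spec a (Some i)
  | PosOut of a \notin K : pos_spec a None.

Lemma posP K a : pos_spec a (pos K a).
Proof.
have [aK|aK] := boolP (a \in K).
  rewrite -{2}(enum_rankK_in aK aK) pos_enum.
  by apply: PosIn => //; apply: enum_rankK_in.
rewrite /pos; case: pickP => [j /eqP E|_]; last exact: PosOut.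
by rewrite -E enum_valP in aK.
Qed.

Lemma sum_pos (V : nmodType) K (F : 'I_#|K| -> V) :
  \sum_i F i = \sum_a (if pos K a is Some i then F i else 0).
Proof.
pose G a := if pos K a is Some i then F i else 0.
rewrite [RHS](bigID (fun a => a \in K)) /= [X in _ + X]big1 ?addr0 => [|a].
  rewrite -[RHS]/(\sum_(a in K) G a) [RHS]big_enum_val.
  by apply: eq_bigr => i _; rewrite /G pos_enum.
by case: posP => // i _ ->.
Qed.

Lemma big_mxvec (T : Type) (idx : T) (op : Monoid.com_law idx) m n (F : 'I_(m * n) -> T) :
  \big[op/idx]_v F v = \big[op/idx]_i \big[op/idx]_j F (mxvec_index i j).
Proof.
by rewrite (reindex _ (curry_mxvec_bij _ _)) /= pair_big; apply: eq_bigr => -[i j].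
Qed.

Lemma mxvec_index_eq m n (i i' : 'I_m) (j j' : 'I_n) :
  (mxvec_index i j == mxvec_index i' j') = (i == i') && (j == j').
Proof.
have inj : injective (uncurry (@mxvec_index m n)).
  by case: (curry_mxvec_bij m n) => g gK _ x y E; rewrite -[x]gK // E gK.
apply/eqP/andP => [E|[/eqP-> /eqP->] //].
by have [-> ->] : (i, j) = (i', j') by apply: inj.
Qed.

(** Points range over all labels, and those outside the set at hand have the index None, with
    the value zero; sums over points then carry no side conditions. *)
Definition oder n (o : option 'I_n) (g : {mpoly A[n]}) : {mpoly A[n]} :=
  if o is Some v then g^`M(v) else 0.

Definition ovar n (o : option 'I_n) : {mpoly A[n]} := if o is Some v then 'X_v else 0.

Section OptionalIndex.
Variables (n : nat) (o : option 'I_n).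
Implicit Types (g h : {mpoly A[n]}).

Fact oder_linear : linear (oder o).
Proof.
by case: o => [v|] c g h /=; rewrite ?scaler0 ?addr0 // mderivD mderivZ.
Qed.

HB.instance Definition _ :=
  GRing.isLinear.Build A {mpoly A[n]} {mpoly A[n]} *:%R (oder o) oder_linear.

Lemma oderM g h : oder o (g * h) = oder o g * h + g * oder o h.
Proof. by case: o => [v|] /=; rewrite ?mderivM // mul0r mulr0 addr0. Qed.

Lemma oderC c : oder o c%:MP = 0.
Proof. by case: o => [v|] //=; rewrite mderivC. Qed.

Lemma oder_ovar o' : oder o (ovar o') = ((o == o') && (o : bool))%:R.
Proof.
case: o o' => [v|] [w|] //=; last by rewrite mderiv0.
by rewrite mderivU andbT -[Some v == _]/(v == w) eq_sym.
Qed.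

Lemma oder_comm (o' : option 'I_n) g : oder o (oder o' g) = oder o' (oder o g).
Proof. by case: o o' => [v|] [w|] //=; rewrite ?mderiv0 // mderiv_comm. Qed.

Lemma msize_oder g : (msize (oder o g) <= (msize g).-1)%N.
Proof.
case: o => [v|] /=; last by rewrite mmeasure0.
have [->|nz] := eqVneq g 0; first by rewrite mderiv0 mmeasure0.
by apply: msize_deriv_bound; rewrite -mpolySpred.
Qed.

End OptionalIndex.

Lemma label_index K (i : 'I_#|K|) nu : label (mxvec_index i nu) = (enum_val i, nu).
Proof. by rewrite /label mxvecE mxE. Qed.

Definition xidx K a nu : option 'I_(npt d K) := omap (fun i => mxvec_index i nu) (pos K a).

Lemma xidx_enum K i nu : xidx K (enum_val i) nu = Some (mxvec_index i nu).
Proof. by rewrite /xidx pos_enum. Qed.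

Lemma xidx_out K a nu : a \notin K -> xidx K a nu = None.
Proof. by rewrite /xidx; case: posP => // i _ ->. Qed.

Lemma xidx_eq K a b nu nu' :
  (xidx K a nu == xidx K b nu') && (xidx K a nu : bool) = [&& a == b, nu == nu' & a \in K].
Proof.
rewrite /xidx; case: posP => [i Ei aK|aK] /=; last by rewrite (negPf aK) !andbF.
rewrite aK !andbT; case: posP => [j Ej bK|bK] /=.
  by rewrite -[Some _ == _]/(_ == mxvec_index j nu') mxvec_index_eq -Ei -Ej (inj_eq enum_val_inj).
by symmetry; apply: contraNF bK => /andP[/eqP <-].
Qed.

Notation xvar K a nu := (ovar (xidx K a nu)).
Notation xder K a nu := (oder (xidx K a nu)).

Lemma xder_xvar K a b nu nu' :
  xder K a nu (xvar K b nu') = [&& a == b, nu == nu' & a \in K]%:R.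
Proof. by rewrite oder_ovar xidx_eq. Qed.

Lemma mvar_ind K (Q : {mpoly A[npt d K]} -> Prop) :
  (forall c, Q c%:MP) -> (forall a nu, a \in K -> Q (xvar K a nu)) ->
  (forall f g, Q f -> Q g -> Q (f + g)) -> (forall f g, Q f -> Q g -> Q (f * g)) ->
  forall f, Q f.
Proof.
move=> QC QX QD QM; apply: mpoly_gen_ind => // v; case/mxvec_indexP: v => i nu.
by have := QX _ nu (enum_valP i); rewrite xidx_enum.
Qed.

End Labels.

Notation xvar K a nu := (ovar _ (xidx K a nu)).
Notation xder K a nu := (oder (xidx K a nu)).

Section Wick.
Variables (R : realType) (r d : nat) (A : comNzRingType) (iota : {rmorphism R[i] -> A}).
Variable (Sigma : 'M[R]_r).
Hypotheses (Sigma_sym : Sigma^T = Sigma) (Sigma_pd : posdef Sigma).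
Implicit Types (I J K : {set 'I_r}) (a b : 'I_r) (nu : 'I_d).

Local Notation sc := (rsc iota).
Local Notation L I := (Lcond Sigma I).
Local Notation C I := (Ccond Sigma I).

Lemma rsc0 : sc 0 = 0. Proof. by rewrite /rsc !rmorph0. Qed.
Lemma rsc1 : sc 1 = 1. Proof. by rewrite /rsc !rmorph1. Qed.
Lemma rscD x y : sc (x + y) = sc x + sc y. Proof. by rewrite /rsc !rmorphD. Qed.
Lemma rscM x y : sc (x * y) = sc x * sc y. Proof. by rewrite /rsc !rmorphM. Qed.
Lemma rscN x : sc (- x) = - sc x. Proof. by rewrite /rsc !rmorphN. Qed.
Lemma rsc_nat n : sc n%:R = n%:R. Proof. by rewrite /rsc !rmorph_nat. Qed.
Lemma rsc_sum (T : finType) (F : T -> R) : sc (\sum_t F t) = \sum_t sc (F t).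
Proof. by rewrite /rsc !rmorph_sum. Qed.

Section TwoSets.
Variables (I K : {set 'I_r}).
Hypothesis sIK : I \subset K.
Local Notation J := (K :\: I).
Local Notation B := {mpoly A[npt d I + npt d J]}.
Implicit Types (g h : B) (f : {mpoly A[npt d K]}).

Definition xpos a nu : option 'I_(npt d I + npt d J) := omap (@lshift _ _) (xidx I a nu).
Definition ypos a nu : option 'I_(npt d I + npt d J) := omap (@rshift _ _) (xidx J a nu).

Lemma xpos_eq a b nu nu' :
  (xpos a nu == xpos b nu') && (xpos a nu : bool) = [&& a == b, nu == nu' & a \in I].
Proof.
rewrite -xidx_eq /xpos; case: (xidx I a nu) => [u|] //; case: (xidx I b nu') => [v|] //=.
Qed.

Lemma ypos_eq a b nu nu' :
  (ypos a nu == ypos b nu') && (ypos a nu : bool) = [&& a == b, nu == nu' & a \in J].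
Proof.
rewrite -xidx_eq /ypos; case: (xidx J a nu) => [u|] //; case: (xidx J b nu') => [v|] //=.
by rewrite -[Some _ == _]/(rshift _ u == rshift _ v) eq_rshift.
Qed.

Lemma xypos_eq a b nu nu' : (xpos a nu == ypos b nu') && (xpos a nu : bool) = false.
Proof.
rewrite /xpos /ypos; case: (xidx I a nu) => [u|] //; case: (xidx J b nu') => [v|] //=.
  by rewrite -[Some _ == _]/(lshift _ u == rshift _ v) eq_lrshift.
Qed.

Lemma yxpos_eq a b nu nu' : (ypos a nu == xpos b nu') && (ypos a nu : bool) = false.
Proof.
rewrite /xpos /ypos; case: (xidx J a nu) => [u|] //; case: (xidx I b nu') => [v|] //=.
by rewrite -[Some _ == _]/(rshift _ u == lshift _ v) eq_rlshift.
Qed.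

Lemma wshift_xvar a nu : a \in K -> wshift iota Sigma I (xvar K a nu) =
  \sum_b sc (L I a b) *: ovar A (xpos b nu) + ovar A (ypos a nu) :> B.
Proof.
move=> aK; rewrite {1}/xidx; case: posP => [i Ei _|]; last by rewrite aK.
rewrite /wshift comp_mpolyXU -tnth_nth tnth_mktuple mxvecE mxE Ei.
case: posP => [b Eb aI|aI].
  rewrite (bigD1 a) //= Lcond_in // eqxx rsc1 scale1r big1 ?addr0 => [|c nc].
    rewrite mxE /xpos /xidx -Eb pos_enum /ypos /xidx; case: posP => [j _|_] /=; last by rewrite addr0.
    by rewrite inE enum_valP.
  by rewrite Lcond_in // eq_sym (negPf nc) rsc0 scale0r.
rewrite /ypos /xidx; case: posP => [j Ej _|]; last by rewrite inE aI aK.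
rewrite !mxE; congr (_ + _); rewrite sum_pos; apply: eq_bigr => b _.
rewrite /xpos /xidx; case: posP => [l El _|_] /=; last by rewrite scaler0.
by rewrite [X in _ * X]mxE [X in X * _]mxE Lmat_cond // Ej El mul_mpolyC.
Qed.

Lemma wshiftC c : wshift iota Sigma I c%:MP = c%:MP :> B.
Proof. by rewrite /wshift comp_mpolyC. Qed.

Lemma wshiftD f f' : wshift iota Sigma I (f + f') = wshift iota Sigma I f + wshift iota Sigma I f' :> B.
Proof. by rewrite /wshift comp_mpolyD. Qed.

Lemma wshiftM f f' : wshift iota Sigma I (f * f') = wshift iota Sigma I f * wshift iota Sigma I f' :> B.
Proof. by rewrite /wshift rmorphM. Qed.

Lemma wshift0 : wshift iota Sigma I 0 = 0 :> B.
Proof. by rewrite /wshift comp_mpoly0. Qed.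

Lemma wshift_natr (n : nat) : wshift iota Sigma I n%:R = n%:R :> B.
Proof. by rewrite /wshift rmorph_nat. Qed.

Lemma wshiftZ c f : wshift iota Sigma I (c *: f) = c *: wshift iota Sigma I f :> B.
Proof. by rewrite /wshift comp_mpolyZ. Qed.

Lemma wshift_xder b nu f : oder (xpos b nu) (wshift iota Sigma I f) =
  \sum_a sc (L I a b) *: wshift iota Sigma I (xder K a nu f) :> B.
Proof.
elim/mvar_ind: f => [c|a nu' aK|f f' IH IH'|f f' IH IH'].
- rewrite wshiftC oderC big1 // => a _.
  by rewrite oderC wshift0 scaler0.
- rewrite wshift_xvar // linearD /= [X in _ + X]oder_ovar xypos_eq addr0 linear_sum /=.
  rewrite (bigD1 b) //= [X in _ + X]big1 ?addr0 => [|c nc]; last first.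
    by rewrite linearZ /= oder_ovar xpos_eq eq_sym (negPf nc) scaler0.
  rewrite linearZ /= oder_ovar xpos_eq eqxx /=.
  rewrite (bigD1 a) //= [X in _ + X]big1 ?addr0 => [|c nc]; last first.
    by rewrite xder_xvar (negPf nc) wshift0 scaler0.
  rewrite xder_xvar eqxx aK andbT wshift_natr.
  have [bI|bI] := boolP (b \in I); first by rewrite andbT.
  by rewrite Lcond_out // rsc0 !scale0r.
- rewrite wshiftD linearD /= IH IH' -big_split /=; apply: eq_bigr => a _.
  by rewrite linearD /= wshiftD scalerDr.
rewrite wshiftM oderM IH IH' mulr_suml mulr_sumr -big_split /=; apply: eq_bigr => a _.
by rewrite oderM wshiftD !wshiftM scalerDr scalerAl scalerAr.
Qed.

Lemma wshift_yder b nu f : b \in J -> oder (ypos b nu) (wshift iota Sigma I f) =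
  wshift iota Sigma I (xder K b nu f) :> B.
Proof.
move=> bJ; have bK : b \in K by move: bJ; rewrite inE => /andP[].
elim/mvar_ind: f => [c|a nu' aK|f f' IH IH'|f f' IH IH'].
- by rewrite wshiftC !oderC wshift0.
- rewrite wshift_xvar // linearD /= oder_ovar ypos_eq linear_sum big1 ?add0r => [|c _].
    by rewrite xder_xvar wshift_natr bK bJ.
  by rewrite linearZ /= oder_ovar yxpos_eq scaler0.
- by rewrite wshiftD !linearD /= IH IH' wshiftD.
by rewrite wshiftM !oderM IH IH' wshiftD !wshiftM.
Qed.

Local Notation lap := (@glap R r d A iota Sigma K I).

Lemma glapE g : lap g =
  \sum_a \sum_b sc (C I a b) *: \sum_nu oder (ypos a nu) (oder (ypos b nu) g).
Proof.
rewrite /glap sum_pos; apply: eq_bigr => a _.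
case: posP => [i Ei _|aJ]; last first.
  rewrite big1 // => b _; rewrite big1 ?scaler0 // => nu _.
  by rewrite /ypos xidx_out.
rewrite sum_pos; apply: eq_bigr => b _; case: posP => [j Ej _|bJ]; last first.
  by rewrite big1 ?scaler0 // => nu _; rewrite /ypos [X in oder _ (oder (omap _ X) _)]xidx_out //= linear0.
rewrite Cmat_cond // Ei Ej; congr (_ *: _); apply: eq_bigr => nu _.
by rewrite -Ei -Ej /ypos !xidx_enum /= mderiv_comm.
Qed.

Fact glap_linear : linear lap.
Proof.
move=> c g h; rewrite !glapE scaler_sumr -big_split /=; apply: eq_bigr => a _.
rewrite scaler_sumr -big_split /=; apply: eq_bigr => b _.
rewrite scalerA mulrC -scalerA -scalerDr; congr (_ *: _).
rewrite scaler_sumr -big_split /=; apply: eq_bigr => nu _.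
by rewrite !linearP.
Qed.

HB.instance Definition _ := GRing.isLinear.Build A B B *:%R lap glap_linear.

Lemma glap_oder o g : oder o (lap g) = lap (oder o g).
Proof.
rewrite !glapE linear_sum; apply: eq_bigr => a _; rewrite linear_sum; apply: eq_bigr => b _.
rewrite linearZ /= linear_sum; congr (_ *: _); apply: eq_bigr => nu _.
by rewrite /= (oder_comm o (ypos a nu)) (oder_comm o (ypos b nu)).
Qed.

Lemma glap_ovar o g : lap (ovar A o * g) = ovar A o * lap g +
  \sum_a \sum_b sc (C I a b) *: \sum_nu
    (oder (ypos b nu) (ovar A o) * oder (ypos a nu) g
     + oder (ypos a nu) (ovar A o) * oder (ypos b nu) g).
Proof.
rewrite !glapE mulr_sumr -big_split /=; apply: eq_bigr => a _.
rewrite mulr_sumr -big_split /=; apply: eq_bigr => b _.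
rewrite -scalerAr -scalerDr; congr (_ *: _).
rewrite mulr_sumr -big_split /=; apply: eq_bigr => nu _.
rewrite oderM linearD /= !oderM.
have -> : oder (ypos a nu) (oder (ypos b nu) (ovar A o)) = 0.
  by rewrite [in X in oder _ X]oder_ovar -mpolyC_nat oderC.
ring.
Qed.

Lemma glap_xvar a nu g : lap (ovar A (xpos a nu) * g) = ovar A (xpos a nu) * lap g.
Proof.
rewrite glap_ovar big1 ?addr0 // => b _; rewrite big1 // => c _.
by rewrite big1 ?scaler0 // => nu' _; rewrite !oder_ovar !yxpos_eq !mul0r addr0.
Qed.

(** Half the commutator of the Gaussian Laplacian with the variable y_a. *)
Definition cgrad a nu g : B := \sum_b sc (C I a b) *: oder (ypos b nu) g.

Lemma glap_yvar a nu g : a \in J ->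
  lap (ovar A (ypos a nu) * g) = ovar A (ypos a nu) * lap g + cgrad a nu g *+ 2.
Proof.
move=> aJ; rewrite glap_ovar; congr (_ + _).
have E b c : \sum_nu' (oder (ypos c nu') (ovar A (ypos a nu)) * oder (ypos b nu') g
     + oder (ypos b nu') (ovar A (ypos a nu)) * oder (ypos c nu') g) =
    (if c == a then oder (ypos b nu) g else 0) + (if b == a then oder (ypos c nu) g else 0).
  rewrite (bigD1 nu) //= [X in _ + X]big1 ?addr0 => [|nu' nn].
    rewrite !oder_ovar !ypos_eq eqxx /=.
    have H x y : (([&& x == a & x \in J])%:R : B) * y = if x == a then y else 0.
      by case: eqP => [->|_]; rewrite ?aJ ?mul1r ?mul0r.
    by rewrite !H.
  by rewrite !oder_ovar !ypos_eq (negPf nn) !andbF !mul0r addr0.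
under eq_bigr => b _ do under eq_bigr => c _ do rewrite E scalerDr.
under eq_bigr => b _ do rewrite big_split /=.
rewrite big_split /= mulr2n; congr (_ + _).
  apply: eq_bigr => b _; rewrite (bigD1 a) //= eqxx big1 ?addr0 => [|c nc].
    by rewrite Ccond_sym.
  by rewrite (negPf nc) scaler0.
rewrite (bigD1 a) //= [X in _ + X]big1 ?addr0 => [|b nb].
  by apply: eq_bigr => c _; rewrite eqxx.
by rewrite big1 // => c _; rewrite (negPf nb) scaler0.
Qed.

Lemma cgrad_glap a nu g : cgrad a nu (lap g) = lap (cgrad a nu g).
Proof.
rewrite /cgrad linear_sum; apply: eq_bigr => b _.
by rewrite linearZ /= glap_oder.
Qed.

Fact cgrad_linear a nu : linear (cgrad a nu).
Proof.
move=> c g h; rewrite /cgrad scaler_sumr -big_split /=; apply: eq_bigr => b _.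
by rewrite linearP scalerDr !scalerA mulrC.
Qed.

HB.instance Definition _ a nu :=
  GRing.isLinear.Build A B B *:%R (cgrad a nu) (cgrad_linear a nu).

Lemma iter_glap_xvar k a nu g :
  iter k lap (ovar A (xpos a nu) * g) = ovar A (xpos a nu) * iter k lap g.
Proof. by elim: k => // k IH; rewrite !iterS IH glap_xvar. Qed.

Lemma iter_glap_yvar k a nu g : a \in J ->
  iter k.+1 lap (ovar A (ypos a nu) * g) =
    ovar A (ypos a nu) * iter k.+1 lap g + cgrad a nu (iter k lap g) *+ (2 * k.+1).
Proof.
move=> aJ; elim: k => [|k IH]; first by rewrite /= glap_yvar // muln1.
rewrite iterS IH linearD /= glap_yvar // -addrA; congr (_ + _).
by rewrite raddfMn /= -cgrad_glap -mulrnDr -mulnS.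
Qed.

Lemma msize_glap g : (msize (lap g) <= (msize g).-1)%N.
Proof.
rewrite glapE; apply: msize_sum_bound => a _; apply: msize_sum_bound => b _.
apply: leq_trans (msizeZ_le _ _) _; apply: msize_sum_bound => nu _.
apply: leq_trans (msize_oder _ _) _; apply: leq_trans (leq_pred _) _.
exact: msize_oder.
Qed.

Lemma msize_iter_glap k g : (msize (iter k lap g) <= msize g - k)%N.
Proof.
elim: k => [|k IH]; first by rewrite subn0.
rewrite iterS subnS; apply: leq_trans (msize_glap _) _.
by rewrite -!subn1 leq_sub2r.
Qed.

Local Notation term := (@gexp_term R r d A iota Sigma K I).
Local Notation gexp := (@gexp R r d A iota Sigma K I).

Lemma gexp_term_large k g : (msize g <= k)%N -> term k g = 0.
Proof.
move=> le_gk; have := msize_iter_glap k g; have /eqP-> : (msize g - k == 0)%N by [].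
by rewrite leqn0 msize_poly_eq0 /gexp_term => /eqP->; rewrite scaler0.
Qed.

Lemma gexpE N g : (msize g <= N)%N -> gexp g = \sum_(k < N) term k g.
Proof.
move=> le_gN; rewrite -(subnKC le_gN) big_split_ord /= [X in _ + X]big1 ?addr0 // => k _.
by apply: gexp_term_large; rewrite leq_addr.
Qed.

Fact gexp_term_linear k : linear (term k).
Proof.
move=> c g h; rewrite /gexp_term.
have -> : iter k lap (c *: g + h) = c *: iter k lap g + iter k lap h.
  by elim: k => // k IH; rewrite !iterS IH linearP.
by rewrite scalerDr !scalerA mulrC.
Qed.

HB.instance Definition _ k :=
  GRing.isLinear.Build A B B *:%R (term k) (gexp_term_linear k).

Fact gexp_linear : linear gexp.
Proof.
move=> c g h; pose N := maxn (msize (c *: g + h)) (maxn (msize g) (msize h)).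
rewrite (@gexpE N) ?leq_maxl // (@gexpE N g) ?(@gexpE N h) /N ?leq_max ?leqnn ?orbT //.
rewrite scaler_sumr -big_split /=; apply: eq_bigr => k _.
exact: linearP.
Qed.

HB.instance Definition _ := GRing.isLinear.Build A B B *:%R gexp gexp_linear.

Lemma gexp_oder o g : oder o (gexp g) = gexp (oder o g).
Proof.
have le : (msize (oder o g) <= msize g)%N.
  by apply: leq_trans (msize_oder _ _) (leq_pred _).
rewrite (gexpE le) linear_sum; apply: eq_bigr => k _; rewrite /gexp_term linearZ /=.
congr (_ *: _); elim: (val k) => // j IH.
by rewrite !iterS -IH glap_oder.
Qed.

Lemma gexpC c : gexp c%:MP = c%:MP.
Proof.
have le : (msize (c%:MP : B) <= 1)%N by rewrite msizeC; case: eqP.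
rewrite (gexpE le) big_ord_recl big_ord0 addr0 /gexp_term /=.
by rewrite expr0 fact0 mul1r invr1 rsc1 scale1r.
Qed.

Lemma gexp_xvar a nu g : gexp (ovar A (xpos a nu) * g) = ovar A (xpos a nu) * gexp g.
Proof.
set x := ovar A _; pose N := maxn (msize (x * g)) (msize g).
rewrite (@gexpE N) ?leq_maxl // (@gexpE N g) ?leq_maxr // mulr_sumr.
by apply: eq_bigr => k _; rewrite /gexp_term iter_glap_xvar scalerAr.
Qed.

(** Gaussian integration by parts: exp(Delta/2) y = (y + C grad) exp(Delta/2), because the
    commutator of Delta/2 with y is C grad, which commutes with Delta. *)
Lemma gexp_yvar a nu g : a \in J ->
  gexp (ovar A (ypos a nu) * g) = ovar A (ypos a nu) * gexp g + cgrad a nu (gexp g).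
Proof.
move=> aJ; set y := ovar A _; pose N := maxn (msize (y * g)) (msize g).
have le1 : (msize (y * g) <= N)%N by apply: leq_maxl.
have le2 : (msize g <= N)%N by apply: leq_maxr.
have -> : cgrad a nu (gexp g) = cgrad a nu (\sum_(k < N) term k g) by rewrite (gexpE le2).
rewrite (gexpE (leqW le1)) (gexpE (leqW le2)) !big_ord_recl linear_sum mulrDr -addrA.
congr (_ + _); first by rewrite /gexp_term /= scalerAr.
rewrite mulr_sumr -big_split /=; apply: eq_bigr => k _.
rewrite /gexp_term /bump leq0n add1n iter_glap_yvar // scalerDr scalerAr linearZ /=.
congr (_ + _); rewrite -scaler_nat scalerA -rsc_nat -rscM; congr (rsc _ _ *: _).
rewrite factS !natrM exprS.
have nz2 : (2 : R) != 0 by rewrite pnatr_eq0.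
have nzz : (k.+1%:R : R) != 0 by rewrite pnatr_eq0.
have nzq : (k`!%:R : R) != 0 by rewrite pnatr_eq0 -lt0n fact_gt0.
have nzp : (2 : R) ^+ k != 0 by rewrite expf_neq0.
move: (k.+1%:R : R) (k`!%:R : R) (2 ^+ k : R) nzz nzq nzp => z q p nzz nzq nzp.
by field; rewrite nzz nzq nzp.
Qed.

Local Notation ev0 := (@set_y0 r d A K I).

Lemma set_y0D g h : ev0 (g + h) = ev0 g + ev0 h.
Proof. by rewrite /set_y0 comp_mpolyD. Qed.

Lemma set_y0M g h : ev0 (g * h) = ev0 g * ev0 h.
Proof. by rewrite /set_y0 rmorphM. Qed.

Lemma set_y0C c : ev0 c%:MP = c%:MP.
Proof. by rewrite /set_y0 comp_mpolyC. Qed.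

Lemma set_y0Z c g : ev0 (c *: g) = c *: ev0 g.
Proof. by rewrite /set_y0 comp_mpolyZ. Qed.

Lemma set_y0_0 : ev0 0 = 0.
Proof. by rewrite /set_y0 comp_mpoly0. Qed.

Lemma set_y0_sum (T : finType) (F : T -> B) : ev0 (\sum_t F t) = \sum_t ev0 (F t).
Proof. by rewrite /set_y0 raddf_sum. Qed.

Lemma set_y0_xvar a nu : ev0 (ovar A (xpos a nu)) = xvar I a nu.
Proof.
rewrite /xpos; case: (xidx I a nu) => [u|] /=; last exact: set_y0_0.
rewrite /set_y0 comp_mpolyXU -tnth_nth tnth_mktuple.
by case: splitP => j /= E; [congr 'X__; apply: val_inj|have := ltn_ord u; rewrite E ltnNge leq_addr].
Qed.

Lemma set_y0_yvar a nu : ev0 (ovar A (ypos a nu)) = 0.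
Proof.
rewrite /ypos; case: (xidx J a nu) => [u|] /=; last exact: set_y0_0.
rewrite /set_y0 comp_mpolyXU -tnth_nth tnth_mktuple.
by case: splitP => j /= E //; have := ltn_ord j; rewrite -E ltnNge leq_addr.
Qed.

Lemma set_y0_xder a nu g : xder I a nu (ev0 g) = ev0 (oder (xpos a nu) g).
Proof.
elim/mpoly_gen_ind: g => [c|v|g h IH IH'|g h IH IH'].
- by rewrite set_y0C !oderC set_y0_0.
- have [[b [nu' ->]]|[b [nu' ->]]] :
      (exists b nu', 'X_v = ovar A (xpos b nu') :> B) \/ (exists b nu', 'X_v = ovar A (ypos b nu') :> B).
  + case: (splitP v) => u E.
      left; case/mxvec_indexP: u E => i nu' E; exists (enum_val i), nu'.
      by rewrite /xpos xidx_enum /=; congr 'X__; apply: val_inj.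
    right; case/mxvec_indexP: u E => i nu' E; exists (enum_val i), nu'.
    by rewrite /ypos xidx_enum /=; congr 'X__; apply: val_inj.
  + rewrite set_y0_xvar xder_xvar oder_ovar xpos_eq.
    by rewrite -!mpolyC_nat set_y0C.
  + by rewrite set_y0_yvar linear0 oder_ovar xypos_eq set_y0_0.
- by rewrite set_y0D !linearD /= IH IH' set_y0D.
by rewrite set_y0M !oderM IH IH' set_y0D !set_y0M.
Qed.

Local Notation W := (@wick R r d A iota Sigma K I).

Lemma wickC c : W c%:MP = c%:MP.
Proof. by rewrite /wick wshiftC gexpC set_y0C. Qed.

Fact wick_linear : linear W.
Proof.
by move=> c f f'; rewrite /wick wshiftD wshiftZ linearP set_y0D set_y0Z.
Qed.

HB.instance Definition _ :=
  GRing.isLinear.Build A {mpoly A[npt d K]} {mpoly A[npt d I]} *:%R W wick_linear.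

(** x_a splits into its conditional mean given x_I and a centred Gaussian variable, which
    integration by parts turns into a derivative. *)
Lemma wick_xvar a nu f : a \in K -> W (xvar K a nu * f) =
  \sum_b sc (L I a b) *: (xvar I b nu * W f) + \sum_b sc (C I a b) *: W (xder K b nu f).
Proof.
move=> aK; rewrite {1}/wick wshiftM wshift_xvar // mulrDl linearD /= set_y0D; congr (_ + _).
  rewrite mulr_suml linear_sum set_y0_sum; apply: eq_bigr => b _.
  by rewrite -scalerAl linearZ /= set_y0Z gexp_xvar set_y0M set_y0_xvar.
have [aI|aI] := boolP (a \in I).
  rewrite /ypos xidx_out ?inE ?aI //= mul0r linear0 set_y0_0 big1 // => b _.
  by rewrite Ccond_sym // Ccond_in // rsc0 scale0r.
rewrite gexp_yvar ?inE ?aI // set_y0D set_y0M set_y0_yvar mul0r add0r set_y0_sum.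
apply: eq_bigr => b _; rewrite set_y0Z gexp_oder.
have [bI|bI] := boolP (b \in I).
  by rewrite (Ccond_in Sigma_pd a bI) rsc0 !scale0r.
have [bK|bK] := boolP (b \in K).
  by rewrite wshift_yder ?inE ?bI.
have -> : ypos b nu = None by rewrite /ypos xidx_out // inE (negPf bK) andbF.
rewrite (xidx_out nu bK) -[oder None f]/(0 : {mpoly A[npt d K]}).
by rewrite -[oder None _]/(0 : B) linear0 set_y0_0 [W 0]linear0.
Qed.

Lemma wick_xder b nu f :
  xder I b nu (W f) = \sum_a sc (L I a b) *: W (xder K a nu f).
Proof.
rewrite {1}/wick set_y0_xder gexp_oder wshift_xder linear_sum set_y0_sum.
by apply: eq_bigr => a _; rewrite linearZ /= set_y0Z.
Qed.

(** The inclusion of the polynomials in x_I among those in x_K. *)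
Definition embed (g : {mpoly A[npt d I]}) : {mpoly A[npt d K]} :=
  g \mPo [tuple xvar K (label u).1 (label u).2 | u < npt d I].

Lemma embed_xvar a nu : a \in I -> embed (xvar I a nu) = xvar K a nu.
Proof.
move=> aI; rewrite {1}/xidx; case: posP => [i Ei _|]; last by rewrite aI.
rewrite /= /embed comp_mpolyXU -tnth_nth tnth_mktuple label_index /=.
by rewrite Ei.
Qed.

(** A variable at a point of I is its own conditional expectation, and has no fluctuation. *)
Lemma wick_embed_mul p f : W (embed p * f) = p * W f.
Proof.
elim/mvar_ind: p f => [c|a nu aI|g g' IH IH'|g g' IH IH'] f.
- by rewrite /embed comp_mpolyC !mul_mpolyC linearZ.
- rewrite embed_xvar // wick_xvar ?(subsetP sIK) // [X in _ + X]big1 ?addr0 => [|b _].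
    rewrite (bigD1 a) //= Lcond_in // eqxx rsc1 scale1r big1 ?addr0 // => b nb.
    by rewrite Lcond_in // eq_sym (negPf nb) rsc0 scale0r.
  by rewrite Ccond_sym // Ccond_in // rsc0 scale0r.
- by rewrite /embed comp_mpolyD mulrDl linearD /= IH IH' mulrDl.
by rewrite /embed rmorphM /= -!/(embed _) -mulrA IH IH' mulrA.
Qed.

Lemma wick_embed p : W (embed p) = p.
Proof.
by rewrite -[embed p]mulr1 wick_embed_mul -mpolyC1 wickC mpolyC1 mulr1.
Qed.

End TwoSets.
End Wick.

(** * Wick contraction and twisted derivatives *)

Section WickCohomology.
Variables (R : realType) (r d : nat) (A : comNzRingType) (iota : {rmorphism R[i] -> A}).
Variable (Sigma : 'M[R]_r).
Hypotheses (Sigma_sym : Sigma^T = Sigma) (Sigma_pd : posdef Sigma).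
Implicit Types (S I J K : {set 'I_r}) (a b c : 'I_r) (nu : 'I_d).

Local Notation sc := (rsc iota).
Local Notation L I := (Lcond Sigma I).
Local Notation C I := (Ccond Sigma I).
Local Notation G I := (Ginv Sigma I).

(** The arguments on cohomology use these properties only.  The first two clauses alone form a
    recursion that determines the operator. *)
Definition is_wick I K (W : {linear {mpoly A[npt d K]} -> {mpoly A[npt d I]}}) : Prop :=
  [/\ W 1 = 1,
      forall a nu f, a \in K -> W (xvar K a nu * f) =
        \sum_b sc (L I a b) *: (xvar I b nu * W f) + \sum_b sc (C I a b) *: W (xder K b nu f),
      forall b nu f, xder I b nu (W f) = \sum_a sc (L I a b) *: W (xder K a nu f) &
      forall p f, W (embed K p * f) = p * W f].

Lemma rsc_mulmx (M N : 'M[R]_r) a b : sc ((M *m N) a b) = \sum_c sc (M a c) * sc (N c b).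
Proof. by rewrite mxE rsc_sum; apply: eq_bigr => c _; rewrite rscM. Qed.

Lemma scale_mulmx (V : lmodType A) (M N : 'M[R]_r) a (F : 'I_r -> V) :
  \sum_b sc (M a b) *: (\sum_c sc (N b c) *: F c) = \sum_c sc ((M *m N) a c) *: F c.
Proof.
under eq_bigr => b _ do rewrite scaler_sumr.
rewrite exchange_big; apply: eq_bigr => c _.
rewrite rsc_mulmx scaler_suml; apply: eq_bigr => b _.
by rewrite scalerA.
Qed.

Section Tower.
Variables (I K M : {set 'I_r}).
Hypotheses (sIK : I \subset K) (sKM : K \subset M).
Variables (WKM : {linear {mpoly A[npt d M]} -> {mpoly A[npt d K]}})
  (WIK : {linear {mpoly A[npt d K]} -> {mpoly A[npt d I]}})
  (WIM : {linear {mpoly A[npt d M]} -> {mpoly A[npt d I]}}).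
Hypotheses (wickKM : is_wick WKM) (wickIK : is_wick WIK) (wickIM : is_wick WIM).

(** Means and covariances compose by the laws of total expectation and total covariance. *)
Lemma wick_comp_xvar a nu (f : {mpoly A[npt d M]}) : a \in M ->
  WIK (WKM (xvar M a nu * f)) =
    \sum_c sc (L I a c) *: (xvar I c nu * WIK (WKM f)) +
    \sum_c sc (C I a c) *: WIK (WKM (xder M c nu f)).
Proof.
have [_ recKM derKM _] := wickKM; have [_ recIK _ _] := wickIK.
move=> aM; rewrite recKM // linearD !linear_sum /=.
have E b : WIK (sc (L K a b) *: (xvar K b nu * WKM f)) =
    sc (L K a b) *: (\sum_c sc (L I b c) *: (xvar I c nu * WIK (WKM f)) +
      \sum_c sc ((C I *m (L K)^T) b c) *: WIK (WKM (xder M c nu f))).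
  rewrite linearZ /=; have [bK|bK] := boolP (b \in K); last first.
    by rewrite (Lcond_out Sigma_sym a bK) rsc0 !scale0r.
  rewrite recIK //; congr (_ *: (_ + _)).
  rewrite -scale_mulmx; apply: eq_bigr => c _; congr (_ *: _).
  rewrite derKM linear_sum; apply: eq_bigr => e _.
  by rewrite linearZ /= [in RHS]mxE.
rewrite (eq_bigr _ (fun b _ => E b)) (eq_bigr _ (fun b _ => scalerDr _ _ _)) big_split /=.
rewrite !scale_mulmx (Lcond_comp Sigma_pd sIK) -addrA; congr (_ + _).
rewrite -big_split /=; apply: eq_bigr => c _.
by rewrite linearZ /= -scalerDl -rscD mulmxA -[in RHS](Ccond_comp Sigma_sym Sigma_pd sIK) [in RHS]mxE.
Qed.

(** Both sides satisfy the same recursion, which determines a linear operator by induction on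
    the degree. *)
Theorem is_wick_comp (f : {mpoly A[npt d M]}) : WIK (WKM f) = WIM f.
Proof.
have [oneKM _ _ _] := wickKM; have [oneIK _ _ _] := wickIK; have [oneIM recIM _ _] := wickIM.
suff mono N (m : 'X_{1..npt d M}) : (mdeg m < N)%N -> WIK (WKM 'X_[m]) = WIM 'X_[m].
  rewrite [f]mpolyE !linear_sum /=; apply: eq_bigr => m _.
  by rewrite !linearZ /= (mono (mdeg m).+1).
elim: N m => // N IH m; rewrite ltnS leq_eqVlt => /predU1P[dm|]; last exact: IH.
have low (g : {mpoly A[npt d M]}) : (msize g <= N)%N -> WIK (WKM g) = WIM g.
  move=> Hg; rewrite [g]mpolyE !linear_sum /= big_seq [RHS]big_seq; apply: eq_bigr => l l_g.
  by rewrite !linearZ /= IH // (leq_trans (msize_mdeg_lt l_g)).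
have [->|nz] := eqVneq m 0%MM; first by rewrite mpolyX0 oneKM oneIK oneIM.
have [v mv] : exists v, m v != 0%N.
  apply: contrapT => no; case/eqP: nz; apply/mnmP=> v; rewrite mnm0E.
  by apply: contrapT => nz; apply: no; exists v; apply/eqP.
have le : (U_(v) <= m)%MM by rewrite lep1mP.
have -> : 'X_[m] = 'X_v * 'X_[m - U_(v)] :> {mpoly A[npt d M]}.
  by rewrite -mpolyXD addmC submK.
have size_l : (msize ('X_[m - U_(v)] : {mpoly A[npt d M]}) <= N)%N.
  by rewrite msizeX -dm -{2}(submK le) mdegD mdeg1 addn1.
case/mxvec_indexP: v le mv size_l => i nu le mv size_l.
have Ex : 'X_(mxvec_index i nu) = xvar M (enum_val i) nu :> {mpoly A[npt d M]}.
  by rewrite xidx_enum.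
rewrite Ex wick_comp_xvar ?enum_valP // recIM ?enum_valP //.
rewrite low //; congr (_ + _); apply: eq_bigr => c _; rewrite low //.
by apply: leq_trans (msize_oder _ _) _; apply: leq_trans (leq_pred _) size_l.
Qed.

End Tower.

Section Phase.
Variables (P : {mpoly R[i][d]}) (S : {set 'I_r}) (t : 'I_r -> A).

Local Notation F K := (@phase R r d A iota Sigma P K S t).

Definition at_point K a (p : {mpoly R[i][d]}) : {mpoly A[npt d K]} :=
  mmap (@mpolyC (npt d K) A \o iota) (fun nu => xvar K a nu) p.

(** The derivatives along x_{a,nu} of the interaction and, up to sign, of the Gaussian part of
    the phase, see [xder_phase]. *)
Definition dpotential K a nu : {mpoly A[npt d K]} :=
  if a \in S then iota 'i%C *: (t a *: at_point K a P^`M(nu)) else 0.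

Definition dquadratic K a nu : {mpoly A[npt d K]} :=
  \sum_b sc (G K a b) *: xvar K b nu.

Lemma xmatE K i nu : xmat d A K i nu = xvar K (enum_val i) nu.
Proof. by rewrite mxE xidx_enum. Qed.

Lemma PatE K i : Pat iota P i = at_point K (enum_val i) P.
Proof.
by rewrite /Pat /at_point; congr (mmap _ _ P); apply: funext => nu; rewrite xmatE.
Qed.

Lemma sum_enum (V : nmodType) K (H : 'I_r -> V) :
  (forall a, a \notin K -> H a = 0) -> \sum_(i < #|K|) H (enum_val i) = \sum_a H a.
Proof.
move=> H0; rewrite sum_pos; apply: eq_bigr => a _.
by case: posP => [i -> //|/H0->].
Qed.

Lemma xder_phase K a nu : a \in K -> S \subset K ->
  xder K a nu (F K) = dpotential K a nu - dquadratic K a nu.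
Proof.
move=> aK sSK; rewrite /phase linearD linearN /= addrC; congr (_ - _); rewrite linearZ /=.
  rewrite linear_sum /= /dpotential.
  have E i : xder K a nu (t (enum_val i) *: Pat iota P i) =
      if enum_val i == a then t a *: at_point K a P^`M(nu) else 0.
    rewrite linearZ /= PatE /xidx; case: posP => [l El _|]; last by rewrite aK.
    rewrite /= /at_point mderiv_mmap (bigD1 nu) //= big1 => [|nu' nn].
      have := xder_xvar A K a (enum_val i) nu nu; rewrite {1}/xidx -El pos_enum /= => ->.
      rewrite eqxx enum_valP addr0 andbT [enum_val l == _]eq_sym.
      by case: eqP => [->|_]; rewrite ?mulr1 ?mulr0 ?scaler0.
    have := xder_xvar A K a (enum_val i) nu nu'; rewrite {1}/xidx -El pos_enum /= => ->.
    by rewrite [nu == _]eq_sym (negPf nn) andbF mulr0.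
  rewrite (eq_bigr _ (fun i _ => E i)); case: ifP => aS.
    congr (_ *: _); rewrite (bigD1 (enum_rank_in aK a)) /= ?enum_rankK_in // eqxx.
    rewrite big1 ?addr0 // => i /andP[_ ni]; case: eqP => // Ei; case/eqP: ni.
    by apply: enum_val_inj; rewrite enum_rankK_in.
  rewrite big1 ?scaler0 // => i iS; case: eqP => // Ei.
  by rewrite Ei aS in iS.
have Ed i j : xder K a nu (xdot d A i j) =
    (if a == enum_val i then xvar K (enum_val j) nu else 0) +
    (if a == enum_val j then xvar K (enum_val i) nu else 0).
  rewrite /xdot linear_sum (bigD1 nu) //= big1 => [|nu' nn].
    rewrite oderM !xmatE !xder_xvar eqxx aK !andbT addr0.
    by do 2!case: eqP => _; rewrite ?mul1r ?mulr1 ?mul0r ?mulr0.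
  by rewrite oderM !xmatE !xder_xvar [nu == _]eq_sym (negPf nn) !andbF mul0r mulr0 addr0.
rewrite linear_sum /=.
have E i : xder K a nu (\sum_j sc (invmx (blk K K Sigma) i j) *: xdot d A i j) =
    (if a == enum_val i then dquadratic K a nu else 0) +
    sc (G K a (enum_val i)) *: xvar K (enum_val i) nu.
  rewrite linear_sum /=.
  under eq_bigr => j _ do rewrite linearZ /= Ed invmx_blkE scalerDr.
  rewrite big_split /=; congr (_ + _).
    case: eqP => [->|_]; last by rewrite big1 // => j _; rewrite scaler0.
    rewrite /dquadratic -(sum_enum (K := K)) // => b bK.
    by rewrite xidx_out // scaler0.
  rewrite (bigD1 (enum_rank_in aK a)) //= enum_rankK_in // eqxx big1 ?addr0 => [|j nj].
    by rewrite -[in LHS](Ginv_tr Sigma_sym) mxE.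
  case: eqP => [Ej|_]; last by rewrite scaler0.
  by case/eqP: nj; apply: enum_val_inj; rewrite enum_rankK_in.
rewrite (eq_bigr _ (fun i _ => E i)) big_split /=.
rewrite (sum_enum (H := fun b => sc (G K a b) *: xvar K b nu)) => [|b bK]; last first.
  by rewrite xidx_out // scaler0.
rewrite (bigD1 (enum_rank_in aK a)) //= enum_rankK_in // eqxx big1 ?addr0 => [|j nj].
  rewrite -/(dquadratic K a nu) -mulr2n -scaler_nat scalerA -(rsc_nat iota) -rscM.
  by rewrite mulVf ?pnatr_eq0 // rsc1 scale1r.
case: eqP => // Ej; case/eqP: nj; apply: enum_val_inj.
by rewrite enum_rankK_in.
Qed.

Section Descent.
Variables (I K : {set 'I_r}).
Hypotheses (sSI : S \subset I) (sIK : I \subset K).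
Variable W : {linear {mpoly A[npt d K]} -> {mpoly A[npt d I]}}.
Hypothesis wickW : is_wick W.

Lemma embed_at_point a p : a \in I -> embed K (at_point I a p) = at_point K a p.
Proof.
move=> aI; elim/mpoly_gen_ind: p => [c|nu|p q IH IH'|p q IH IH'].
- by rewrite /at_point !mmapC /embed comp_mpolyC.
- by rewrite /at_point !mmapX !mmap1U embed_xvar.
- by rewrite /at_point !mmapD /embed comp_mpolyD -!/(embed _ _) IH IH'.
by rewrite /at_point !rmorphM /= /embed rmorphM /= -!/(embed _ _) IH IH'.
Qed.

Lemma wick_dpotential a nu f :
  W (dpotential K a nu * f) = dpotential I a nu * W f.
Proof.
have [_ _ _ embW] := wickW; rewrite /dpotential; case: ifP => [aS|_]; last by rewrite !mul0r linear0.
rewrite -(embed_at_point _ (subsetP sSI _ aS)).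
by rewrite -!scalerAl [W _]linearZ /= [W _]linearZ /= embW.
Qed.

(** The recursion replaces x_b by its mean and covariances given x_I.  The means recombine to
    the quadratic part for I, by Ginv K * Lcond I = Ginv I; on K the covariances give
    Ginv K * Ccond I = 1 - (Lcond I)^T. *)
Lemma wick_dquadratic a nu f : a \in K -> W (dquadratic K a nu * f) =
  dquadratic I a nu * W f + W (xder K a nu f)
  - \sum_c sc (L I c a) *: W (xder K c nu f).
Proof.
have [_ recW _ _] := wickW; move=> aK; rewrite /dquadratic mulr_suml linear_sum /=.
have E b : W (sc (G K a b) *: xvar K b nu * f) =
    sc (G K a b) *: (\sum_c sc (L I b c) *: (xvar I c nu * W f) +
      \sum_c sc (C I b c) *: W (xder K c nu f)).
  rewrite -scalerAl linearZ /=; have [bK|bK] := boolP (b \in K); last first.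
    by rewrite -(Ginv_tr Sigma_sym) mxE Ginv_out // rsc0 !scale0r.
  by rewrite recW.
rewrite (eq_bigr _ (fun b _ => E b)) (eq_bigr _ (fun b _ => scalerDr _ _ _)) big_split /=.
rewrite !scale_mulmx -addrA; congr (_ + _).
  rewrite mulr_suml; apply: eq_bigr => c _.
  by rewrite scalerAl /Lcond (mulmxA (G K)) (Ginv_mul_sub Sigma_pd sIK).
have EGC : G K *m C I = G K *m Sigma - (L I)^T.
  rewrite /Ccond mulmxBr /Lcond (trmx_mul Sigma) Sigma_sym Ginv_tr //; congr (_ - _).
  by rewrite (mulmxA (G K)) (mulmxA (G K)) (Ginv_mul_sub Sigma_pd sIK).
rewrite EGC.
have -> : W (xder K a nu f) = \sum_c sc ((G K *m Sigma) a c) *: W (xder K c nu f).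
  rewrite (bigD1 a) //= big1 => [|c nc].
    rewrite -(enum_rankK_in aK aK) -mul_selTE Ginv_Sigma_selT // !mxE eqxx rsc1 scale1r.
    by rewrite addr0.
  have [cK|cK] := boolP (c \in K); last by rewrite (xidx_out nu cK) [W _]linear0 scaler0.
  rewrite -(enum_rankK_in aK cK) -mul_selTE Ginv_Sigma_selT // !mxE enum_rankK_in //.
  by rewrite (negPf nc) rsc0 scale0r.
rewrite -sumrB; apply: eq_bigr => c _.
rewrite -scalerBl -rscN -rscD; congr (sc _ *: _).
by rewrite [LHS]mxE; congr (_ + _); rewrite [LHS]mxE [X in - X]mxE.
Qed.

(** The interaction sits at points of S, which are retained, and commutes with contraction.  The
    derivative of f cancels against the covariance terms of the quadratic part, and what
    remains is the twisted derivative of the contraction, if a is retained, or zero. *)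
Lemma wick_twisted a nu f : a \in K ->
  W (xder K a nu f + xder K a nu (F K) * f) =
    if a \in I then xder I a nu (W f) + xder I a nu (F I) * W f else 0.
Proof.
have [_ _ derW _] := wickW; move=> aK.
rewrite xder_phase // ?(subset_trans sSI sIK) // mulrBl linearD linearB /=.
rewrite wick_dpotential wick_dquadratic //; case: ifP => [aI|/negbT aI].
  rewrite xder_phase // derW mulrBl; ring.
rewrite {1}/dpotential ifN; last by apply: contra aI; apply: (subsetP sSI).
rewrite /dquadratic big1 => [|b _]; last by rewrite Ginv_out // rsc0 scale0r.
rewrite mul0r add0r add0r big1 => [|b _]; last by rewrite (Lcond_out Sigma_sym b aI) rsc0 scale0r.
by rewrite subr0 subrr.
Qed.

Lemma wick_twisted_class v f : top_class (F I) (W (twisted_deriv (F K) v f)) = 0.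
Proof.
case/mxvec_indexP: v => i nu; rewrite twisted_derivE.
have -> : f^`M(mxvec_index i nu) = xder K (enum_val i) nu f by rewrite xidx_enum.
have -> : (F K)^`M(mxvec_index i nu) = xder K (enum_val i) nu (F K) by rewrite xidx_enum.
rewrite (wick_twisted nu f (enum_valP i)); case: ifP => [aI|_]; last exact: raddf0.
rewrite {1 2}/xidx; case: posP => [j _ _|]; last by rewrite aI.
exact: (top_class_twisted (F I) (mxvec_index j nu) (W f)).
Qed.

Lemma wick_top_class f : top_class (F K) f = 0 -> top_class (F I) (W f) = 0.
Proof.
move=> f0; pose phi : {linear _ -> coh (nabla (F I)) (npt d I)} := top_class (F I) \o W.
exact: (top_class_descent (phi := phi) wick_twisted_class f0).
Qed.

End Descent.
End Phase.

Lemma wick_is_wick I K : I \subset K ->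
  is_wick (@wick R r d A iota Sigma K I : {linear _ -> _}).
Proof.
move=> sIK; split.
- by rewrite -mpolyC1; apply: wickC.
- exact: wick_xvar.
- exact: wick_xder.
exact: wick_embed_mul.
Qed.

Lemma wick_comp I K M (f : {mpoly A[npt d M]}) : I \subset K -> K \subset M ->
  wick iota Sigma I (wick iota Sigma K f) = wick iota Sigma I f.
Proof.
move=> sIK sKM; have sIM := subset_trans sIK sKM.
exact: (is_wick_comp sIK (wick_is_wick sKM) (wick_is_wick sIK) (wick_is_wick sIM)).
Qed.

End WickCohomology.

(** * Cohomology of the Gaussian-polynomial phase *)

Section HomogeneousPoints.
Variables (R : realType) (r d : nat) (A : comNzRingType) (iota : {rmorphism R[i] -> A}).
Variables (K : {set 'I_r}).
Implicit Types (a b : 'I_r) (nu : 'I_d) (p q : {mpoly R[i][d]}).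

Lemma dhomog_deriv (k : comNzRingType) n e (p : {mpoly k[n]}) v :
  p \is e.-homog -> p^`M(v) \is e.-1.-homog.
Proof.
move=> /dhomogP hp; apply/dhomogP => m; rewrite mcoeff_msupp mcoeff_deriv => nz.
have : (m + U_(v))%MM \in msupp p.
  by rewrite mcoeff_msupp; apply: contra nz => /eqP->; rewrite mul0rn.
by move=> /hp /=; rewrite mdegD mdeg1 addn1 => <-.
Qed.

Lemma xvar_homog a nu : xvar K a nu \is [in A[npt d K], 1.-homog].
Proof.
rewrite /ovar; case: (xidx K a nu) => [u|]; last exact: rpred0.
by rewrite dhomogX /= mdeg1.
Qed.

Lemma at_point_homog e a p : p \is e.-homog -> at_point iota K a p \is e.-homog.
Proof.
move=> /dhomogP hp; rewrite /at_point /mmap big_seq; apply: rpred_sum => m /hp /= dm.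
rewrite /= mul_mpolyC; apply: rpredZ; rewrite -dm mdegE /mmap1.
apply: (big_ind2 (fun x y => x \is [in A[npt d K], y.-homog])) => [|x e1 y e2|nu _].
- exact: dhomog1.
- exact: dhomogM.
by have := dhomogMn (m nu) (xvar_homog a nu); rewrite mul1n.
Qed.

Lemma msize_at_point e a p : (msize p <= e)%N -> (msize (at_point iota K a p) <= e)%N.
Proof.
move=> Hp; rewrite (@pihomog_partitionE _ _ mdeg e p Hp) /at_point raddf_sum.
apply: msize_sum_bound => j _; apply: leq_trans (ltn_ord j).
by apply/msize_homog_le/at_point_homog/pihomogP.
Qed.

Lemma msize_dquadratic (Sigma : 'M[R]_r) a nu : (msize (dquadratic iota Sigma K a nu) <= 2)%N.
Proof.
apply: msize_sum_bound => b _; apply: leq_trans (msizeZ_le _ _) _.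
by apply/msize_homog_le/xvar_homog.
Qed.

Lemma dquadratic_homog (Sigma : 'M[R]_r) a nu : dquadratic iota Sigma K a nu \is 1.-homog.
Proof. by apply: rpred_sum => b _; apply/rpredZ/xvar_homog. Qed.

End HomogeneousPoints.

Section Symbols.
Variables (R : realType) (r d m : nat) (P : {mpoly R[i][d]}) (Pk : nat -> {mpoly R[i][d]}).
Variable (Sigma : 'M[R]_r).
Hypothesis m_ge3 : (3 <= m)%N.
Hypothesis P_homog : forall k : nat, (k <= m)%N -> Pk k \is k.-homog.
Hypothesis P_sum : P = \sum_(k < m.+1) Pk k.
Hypothesis P_crit : forall x : 'I_d -> R[i],
  (forall nu : 'I_d, ((Pk m)^`M(nu)).@[x] = 0) -> forall nu : 'I_d, x nu = 0.
Hypotheses (Sigma_sym : Sigma^T = Sigma) (Sigma_pd : posdef Sigma).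

Lemma msize_lower : (msize (P - Pk m) <= m)%N.
Proof.
rewrite P_sum big_ord_recr /= addrK; apply: msize_sum_bound => k _.
by apply: leq_trans (ltn_ord k); apply/msize_homog_le/P_homog/ltnW/ltn_ord.
Qed.

Definition gradient_ideal (g : {mpoly R[i][d]}) : Prop :=
  exists al : 'I_d -> {mpoly R[i][d]}, g = \sum_nu al nu * (Pk m)^`M(nu).

Lemma lin_comb_ideal (k : comNzRingType) n (T : finType) (h : T -> {mpoly k[n]}) :
  is_ideal (fun g => exists al : T -> {mpoly k[n]}, g = \sum_u al u * h u).
Proof.
split=> [|f g [al ->] [be ->]|f g [al ->]].
- by exists (fun=> 0); rewrite big1 // => u _; rewrite mul0r.
- exists (fun u => al u + be u); rewrite -big_split; apply: eq_bigr => u _.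
  by rewrite mulrDl.
by exists (fun u => f * al u); rewrite mulr_sumr; apply: eq_bigr => u _; rewrite mulrA.
Qed.

(** By assumption the derivatives of the leading form have no common zero but the origin. *)
Lemma gradient_nullstellensatz nu : exists N, gradient_ideal ('X_nu ^+ N).
Proof.
apply: homog_nullstellensatz => [|e f [al ->]|x zx].
- exact: lin_comb_ideal.
- have hP u : (Pk m)^`M(u) \is m.-1.-homog by apply/dhomog_deriv/P_homog.
  exists (fun u => if (m.-1 <= e)%N then pihomog mdeg (e - m.-1) (al u) else 0).
  rewrite raddf_sum; apply: eq_bigr => u _ /=.
  by rewrite mulrC (pihomogM _ _ (hP u)); case: ifP; rewrite ?mul0r // mulrC.
apply: P_crit => u; apply: zx; exists (fun v => (v == u)%:R).
rewrite (bigD1 u) //= eqxx mul1r big1 ?addr0 // => v /negPf ->.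
by rewrite mul0r.
Qed.

Variables (S K : {set 'I_r}).
Hypothesis sSK : S \subset K.
Local Notation k := (kfield R S).
Local Notation iota := (kcst R S).
Local Notation t := (kvar R S).
Local Notation A := {mpoly k[npt d K]}.

Lemma kvar_neq0 a : a \in S -> t a != 0.
Proof.
move=> aS; rewrite /kvar tofrac_eq0 /tpoly; case: posP => [i _ _|]; last by rewrite aS.
by rewrite -msize_poly_eq0 msizeX.
Qed.

Lemma imag_neq0 : iota 'i%C != 0.
Proof. by rewrite fmorph_eq0 eq_complex /= oner_eq0 andbF. Qed.

(** The leading part of the derivative of the phase along v.  At an active point the interaction
    dominates, as m - 1 is at least 2; elsewhere only the quadratic part is left. *)
Definition symbol (v : 'I_(npt d K)) : A :=
  let: (a, nu) := label v in
  if a \in S then iota 'i%C *: (t a *: at_point iota K a (Pk m)^`M(nu))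
  else - dquadratic iota Sigma K a nu.

Definition symbol_deg (v : 'I_(npt d K)) : nat := if (label v).1 \in S then m.-1 else 1%N.

Lemma symbol_homog v : symbol v \is (symbol_deg v).-homog.
Proof.
case/mxvec_indexP: v => i nu; rewrite /symbol /symbol_deg label_index /=.
case: ifP => _; last by rewrite rpredN dquadratic_homog.
by do 2!apply: rpredZ; apply/at_point_homog/dhomog_deriv/P_homog.
Qed.

Lemma Fphase_symbol v :
  (msize ((Fphase Sigma P K S)^`M(v) - symbol v) <= symbol_deg v)%N.
Proof.
case/mxvec_indexP: v => i nu; rewrite /symbol /symbol_deg label_index /=.
have := xder_phase iota Sigma_sym P (t) nu (enum_valP i) sSK; rewrite xidx_enum /= => ->.
rewrite /dpotential; case: ifP => _; last by rewrite sub0r subrr msize_bound0.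
rewrite addrAC; apply: msizeB_bound; last first.
  by apply: leq_trans (msize_dquadratic _ _ _ _ _) _; rewrite -ltnS prednK // (leq_trans _ m_ge3).
rewrite -!scalerBr; do 2!apply: leq_trans (msizeZ_le _ _) _.
rewrite /at_point -raddfB -mderivB; apply: msize_at_point; apply: msize_deriv_bound.
by rewrite prednK ?msize_lower // (leq_trans _ m_ge3).
Qed.

Definition symbol_ideal (g : A) : Prop := exists al : 'I_(npt d K) -> A, g = \sum_u al u * symbol u.

Lemma unscale_ideal (F : fieldType) n (I : {mpoly F[n]} -> Prop) (c : F) g :
  is_ideal I -> c != 0 -> I (c *: g) -> I g.
Proof.
move=> [_ _ IM] c0 Ig; have -> : g = c^-1%:MP * (c *: g); last exact: IM.
by rewrite mul_mpolyC scalerA mulVf // scale1r.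
Qed.

Lemma symbol_in u : symbol_ideal (symbol u).
Proof.
exists (fun v => (v == u)%:R); rewrite (bigD1 u) //= eqxx mul1r big1 ?addr0 // => v /negPf ->.
by rewrite mul0r.
Qed.

(** The relation over the complex numbers, evaluated at x_a; the factors i and t_a are units. *)
Lemma symbol_ideal_active a nu : a \in S -> exists N, symbol_ideal (xvar K a nu ^+ N).
Proof.
move=> aS; have aK := subsetP sSK a aS.
have idF : is_ideal symbol_ideal by apply: lin_comb_ideal.
have [F0 FD FM] := idF; have [N [al EN]] := gradient_nullstellensatz nu.
exists N; have <- : at_point iota K a ('X_nu ^+ N) = xvar K a nu ^+ N.
  by rewrite /at_point rmorphXn /= mmapX mmap1U.
have -> : at_point iota K a ('X_nu ^+ N) =
    \sum_u at_point iota K a (al u) * at_point iota K a (Pk m)^`M(u).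
  by rewrite EN /at_point rmorph_sum; apply: eq_bigr => u _; apply: rmorphM.
apply: (big_ind symbol_ideal) => // u _; apply: (FM).
have [i Ei] : exists i : 'I_#|K|, enum_val i = a.
  by exists (enum_rank_in aK a); rewrite enum_rankK_in.
have := symbol_in (mxvec_index i u); rewrite /symbol label_index Ei aS.
rewrite scalerA => Fg.
exact: (unscale_ideal idF (mulf_neq0 imag_neq0 (kvar_neq0 aS)) Fg).
Qed.

(** x_a is the sum of its conditional mean given the active points and of the covariances Ccond S
    applied to Sigma_K^-1 x.  The mean involves active variables only; Ccond S vanishes at
    active points, so that the second part is a combination of symbols of inactive points. *)
Lemma symbol_ideal_inactive a nu : a \notin S -> a \in K -> exists N, symbol_ideal (xvar K a nu ^+ N).
Proof.
move=> aS aK; have idF : is_ideal symbol_ideal by apply: lin_comb_ideal.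
have [F0 FD FM] := idF.
have Ex : xvar K a nu = \sum_b rsc iota (Lcond Sigma S a b) *: xvar K b nu +
    \sum_c rsc iota (Ccond Sigma S a c) *: dquadratic iota Sigma K c nu.
  have Elc b : Lcond Sigma S a b + (Ccond Sigma S *m Ginv Sigma K) a b = (a == b)%:R.
    have -> : Ccond Sigma S *m Ginv Sigma K = Sigma *m Ginv Sigma K - Lcond Sigma S.
      rewrite /Ccond mulmxBl /Lcond; congr (_ - _).
      by rewrite -(mulmxA Sigma) -(mulmxA Sigma) (Ginv_mul_sup Sigma_sym Sigma_pd sSK).
    by rewrite [X in _ + X]mxE [X in _ + (_ + X)]mxE addrC subrK (Lcond_in Sigma_sym Sigma_pd _ aK).
  rewrite [X in _ + X]scale_mulmx -big_split /=.
  rewrite (eq_bigr (fun b => (a == b)%:R *: xvar K b nu)) => [|b _].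
    rewrite (bigD1 a) //= eqxx scale1r big1 ?addr0 // => b nb.
    by rewrite eq_sym (negPf nb) scale0r.
  rewrite -[LHS](scalerDl (xvar K b nu)) -(rscD iota) Elc.
  by case: (a == b); rewrite ?rsc0 ?rsc1.
rewrite Ex; apply: (radicalD idF).
  apply: (big_ind (fun g => exists N, symbol_ideal (g ^+ N))) => [|x y|b _].
  - by exists 1%N; rewrite expr1.
  - exact: radicalD.
  have [bS|bS] := boolP (b \in S); last first.
    by exists 1%N; rewrite (Lcond_out Sigma_sym a bS) rsc0 scale0r expr1.
  by rewrite -mul_mpolyC; apply: (radicalM _ idF); apply: symbol_ideal_active.
exists 1%N; rewrite expr1; apply: (big_ind symbol_ideal) => // c _.
have [cS|cS] := boolP (c \in S); first by rewrite Ccond_in // rsc0 scale0r.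
have [cK|cK] := boolP (c \in K); last first.
  rewrite /dquadratic big1 ?scaler0 // => b _.
  by rewrite Ginv_out // rsc0 scale0r.
have [i Ei] : exists i : 'I_#|K|, enum_val i = c.
  by exists (enum_rank_in cK c); rewrite enum_rankK_in.
have := symbol_in (mxvec_index i nu); rewrite /symbol label_index Ei ifN // => Fc.
rewrite -mul_mpolyC; apply: (FM); rewrite -[dquadratic _ _ _ _ _]opprK -mulN1r.
exact: FM.
Qed.

Lemma symbol_pow : exists N, forall v, symbol_ideal ('X_v ^+ N).
Proof.
have /choice[N HN] : forall v, exists N, symbol_ideal ('X_v ^+ N).
  case/mxvec_indexP=> i nu; have := symbol_ideal_active (a := enum_val i) nu.
  have := symbol_ideal_inactive (a := enum_val i) nu; rewrite xidx_enum /= => H1 H2.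
  by have [/H2//|/H1] := boolP (enum_val i \in S); apply; apply: enum_valP.
exists (\max_v N v)%N => v.
have le : (N v <= \max_v N v)%N by apply: leq_bigmax.
rewrite -(subnK le) exprD.
by have [_ _ FM] : is_ideal symbol_ideal by [apply: lin_comb_ideal]; apply: FM.
Qed.

Lemma prod_symbol_deg : (\prod_v symbol_deg v = ((m - 1) ^ d) ^ #|S|)%N.
Proof.
rewrite big_mxvec /=.
under eq_bigr => i _ do under eq_bigr => nu _ do rewrite /symbol_deg label_index /=.
under eq_bigr => i _ do rewrite prod_nat_const card_ord.
rewrite -(big_enum_val (A := mem K) (fun a : 'I_r => (if a \in S then m.-1 else 1) ^ d)%N) /=.
rewrite (bigID (mem S)) /= [X in (_ * X)%N]big1 ?muln1 => [|a /andP[_ /negPf->]]; last by rewrite exp1n.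
rewrite (eq_bigl (mem S)) => [|a]; last first.
  by rewrite /= andbC; have [/(subsetP sSK)->|] := boolP (a \in S).
rewrite (eq_bigr (fun=> ((m - 1) ^ d)%N)) => [|a aS]; last first.
  by have aS' : a \in S by []; rewrite aS' subn1.
by rewrite prod_nat_const.
Qed.

(** The symbols have degree m - 1 at the d variables of each active point, and degree 1 at the
    others. *)
Theorem Fphase_cohomology :
  (forall q : nat, q != (#|K| * d)%N ->
     forall h : coh (nabla (Fphase Sigma P K S)) q, h = 0) /\
  has_dim (coh (nabla (Fphase Sigma P K S)) (#|K| * d)) (((m - 1) ^ d) ^ #|S|)%N.
Proof.
have [N HN] := symbol_pow; rewrite -prod_symbol_deg.
exact: (twisted_cohomology symbol_homog Fphase_symbol HN).
Qed.

End Symbols.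

(** * Orientation lines and shuffle signs *)

Section Orientation.
Variables (R : realType) (r d : nat).
Implicit Types (I J K L : {set 'I_r}).
Local Notation lab K := (@label r d K).

Lemma enum_val_ltn (K : {set 'I_r}) (i j : 'I_#|K|) :
  (enum_val i < enum_val j)%N = (i < j)%N.
Proof.
have mono (i' j' : 'I_#|K|) : (i' < j')%N -> (enum_val i' < enum_val j')%N.
  move=> lt; have x0 := enum_val i'; rewrite !(enum_val_nth x0).
  have so : sorted (relpre val ltn) (enum K).
    rewrite [enum K](_ : _ = [seq x <- enum 'I_r | x \in K]); last first.
      by rewrite {1}/enum_mem -enumT.
    apply: sorted_filter; first by move=> y x z; apply: ltn_trans.
    by rewrite -sorted_map val_enum_ord iota_ltn_sorted.
  apply: (sorted_ltn_nth (leT := relpre val ltn) _ x0 so) => //.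
  - by move=> y x z; apply: ltn_trans.
  - by rewrite inE -cardE.
  by rewrite inE -cardE.
have [/mono//|ji|eij] := ltngtP i j; last by rewrite (val_inj eij) ltnn.
by apply/negbTE; rewrite -leqNgt ltnW // mono.
Qed.

Lemma label_inj K : injective (lab K).
Proof.
move=> u v; case/mxvec_indexP: u => i nu; case/mxvec_indexP: v => j nu'.
by rewrite !label_index => -[/enum_val_inj-> ->].
Qed.

Lemma label_in K v : (lab K v).1 \in K.
Proof. by case/mxvec_indexP: v => i nu; rewrite label_index enum_valP. Qed.

Lemma label_onto K p : p.1 \in K -> exists v, lab K v = p.
Proof.
case: p => a nu /= aK; exists (mxvec_index (enum_rank_in aK a) nu).
by rewrite label_index enum_rankK_in.
Qed.

Lemma index_allpairs (T T' : eqType) (s : seq T) (t : seq T') x y :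
  x \in s -> y \in t ->
  index (x, y) [seq (x', y') | x' <- s, y' <- t] = (index x s * size t + index y t)%N.
Proof.
move=> xs yt; elim: s xs => //= a s IH; rewrite inE index_cat.
have pair_inj : injective (pair a : T' -> T * T') by move=> z z' [].
case: (eqVneq x a) => [-> _|nxa /= xs].
  by rewrite (mem_map pair_inj) yt (index_map pair_inj).
rewrite size_map IH // mulSn addnA ifN //.
by apply: contra nxa => /mapP[z _ [->]].
Qed.

Lemma mxvec_index_val m n (i : 'I_m) (j : 'I_n) : val (mxvec_index i j) = (i * n + j)%N.
Proof.
rewrite /mxvec_index /=.
have -> (T : finType) (x : T) : enum_rank x = index x (enum T) :> nat.
  rewrite -{2}(enum_rankK x) (enum_val_nth x) index_uniq ?enum_uniq //.
  by rewrite -cardT; apply: ltn_ord.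
rewrite enumT unlock /= /prod_enum index_allpairs ?mem_enum //.
by rewrite !index_enum_ord size_enum_ord.
Qed.

(** In row-major order the positions attached to two distinct points compare as the points. *)
Lemma label_ltn K u v : (lab K u).1 != (lab K v).1 ->
  (u < v)%N = ((lab K u).1 < (lab K v).1)%N.
Proof.
case/mxvec_indexP: u => i nu; case/mxvec_indexP: v => j nu'.
rewrite !label_index /= (inj_eq enum_val_inj) enum_val_ltn.
have lt (i' j' : 'I_#|K|) (n n' : 'I_d) : (i' < j')%N ->
    (mxvec_index i' n < mxvec_index j' n')%N.
  move=> lt; rewrite !mxvec_index_val.
  apply: (@leq_trans (i' * d + d)); first by rewrite ltn_add2l.
  by rewrite -mulSnr; apply: (leq_trans _ (leq_addr _ _)); rewrite leq_mul2r lt orbT.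
rewrite -(inj_eq val_inj) neq_ltn; case: (ltngtP i j) => //= [/lt->//|/(lt _ _ nu' nu) ji _].
by apply/negbTE; rewrite -leqNgt ltnW.
Qed.

Definition block K I : {set 'I_(npt d K)} := [set v | (lab K v).1 \in I].

Lemma wedge_mono (M : comNzRingType) n (c c' : M) (B B' : {set 'I_n}) :
  [disjoint B & B'] ->
  wedge (ext_mono c B) (ext_mono c' B') = ext_mono (ext_sign M B B' * (c * c')) (B :|: B').
Proof.
move=> dBB; apply/ffunP=> D; rewrite !ffunE; case: eqP => [->|nD].
  rewrite (bigD1 B) ?subsetUl //= !ffunE eqxx.
  have -> : (B :|: B') :\: B = B'.
    by rewrite setDUl setDv set0U; apply/setDidPl; rewrite disjoint_sym.
  rewrite eqxx big1 ?addr0 // => A /andP[_ /negPf nA].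
  by rewrite !ffunE nA mul0r mulr0.
rewrite big1 // => A sAD; rewrite !ffunE; case: eqP => [EA|]; last by rewrite mul0r mulr0.
case: eqP => [EB|]; last by rewrite !mulr0.
by case: nD; rewrite -EA -EB -{1}(setIidPr sAD) setID.
Qed.

Lemma ext_incl_vform I K c : I \subset K ->
  ext_incl K (vform c : ext R (npt d I)) = ext_mono c (block K I).
Proof.
move=> sIK; apply/ffunP=> D; rewrite !ffunE.
rewrite (eq_bigr (fun B : {set 'I_(npt d I)} => if B == setT then c else 0)) => [|B _]; last first.
  by rewrite ffunE.
have labT : lab I @: setT = [set p | p.1 \in I].
  apply/setP=> p; rewrite inE; apply/imsetP/idP => [[v _ ->]|/label_onto[v <-]].
    exact: label_in.
  by exists v.
have -> : (D == block K I) = (lab I @: setT == lab K @: D).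
  rewrite labT; apply/eqP/eqP => [->|E].
    apply/setP=> p; rewrite inE; apply/idP/imsetP => [pI|[v]]; last by rewrite inE => vI ->.
    have [v Ev] := label_onto (subsetP sIK _ pI).
    by exists v; rewrite ?inE ?Ev.
  apply/setP=> v; have /setP/(_ (lab K v)) := E; rewrite !inE => ->.
  by rewrite mem_imset //; apply: label_inj.
case: eqP => [ET|nT].
  by rewrite (bigD1 setT) ?eqxx /= ?ET // big1 ?addr0 // => B /andP[_ /negPf ->].
by rewrite big1 // => B /eqP EB; case: eqP => // BT; case: nT; rewrite -BT.
Qed.

(** The two factors become monomials on complementary blocks of the generators of K, and labels
    turn the inversions between these blocks into those of the shuffle. *)
Lemma ormul_vform I J K c c' : I :|: J = K -> [disjoint I & J] ->
  ormul K (vform c : ext R (npt d I)) (vform c' : ext R (npt d J)) =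
  vform (shuffle_sign d R I J * (c * c')).
Proof.
move=> EK dIJ; have sIK : I \subset K by rewrite -EK subsetUl.
have sJK : J \subset K by rewrite -EK subsetUr.
have dB : [disjoint block K I & block K J].
  apply/pred0P=> v /=; rewrite !inE; apply/negP=> /andP[vI vJ].
  by move/pred0P/(_ (lab K v).1): dIJ => /=; rewrite vI vJ.
rewrite /ormul !ext_incl_vform // wedge_mono //.
have -> : block K I :|: block K J = setT.
  by apply/setP=> v; rewrite !inE -in_setU EK label_in.
congr (ext_mono ((-1) ^+ _ * _) _).
have inj2 : injective (fun p : 'I_(npt d K) * 'I_(npt d K) => (lab K p.1, lab K p.2)).
  by move=> [u v] [u' v'] /= [/label_inj-> /label_inj->].
rewrite -(card_imset _ inj2); apply: eq_card => -[p q]; rewrite inE /=.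
apply/imsetP/and3P => [[[u v]]|[pI qJ lt]].
  rewrite !inE /= => /and3P[uI vJ lt] [-> ->]; rewrite uI vJ -label_ltn //.
  by apply: contraTneq vJ => ->; rewrite (disjointFr dIJ uI).
have [u Eu] := label_onto (subsetP sIK _ pI); have [v Ev] := label_onto (subsetP sJK _ qJ).
exists (u, v); rewrite /= ?Eu ?Ev // !inE /= Eu Ev pI qJ label_ltn Eu Ev //.
by apply: contraTneq qJ => ->; rewrite (disjointFr dIJ pI).
Qed.

Lemma shuffle_signUl (M : comNzRingType) I I' J : [disjoint I & I'] ->
  shuffle_sign d M (I :|: I') J = shuffle_sign d M I J * shuffle_sign d M I' J.
Proof.
move=> dI; rewrite /shuffle_sign -exprD -cardsUI.
rewrite (_ : [set p | _] :&: [set p | _] = set0) ?cards0 ?addn0; last first.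
  apply/setP=> p; rewrite !inE; apply/negP=> /andP[/and3P[pI _ _] /and3P[pI' _ _]].
  by rewrite (disjointFr dI pI) in pI'.
by congr (_ ^+ _); apply: eq_card => p; rewrite !inE -andb_orl.
Qed.

Lemma shuffle_signUr (M : comNzRingType) I J J' : [disjoint J & J'] ->
  shuffle_sign d M I (J :|: J') = shuffle_sign d M I J * shuffle_sign d M I J'.
Proof.
move=> dI; rewrite /shuffle_sign -exprD -cardsUI.
rewrite (_ : [set p | _] :&: [set p | _] = set0) ?cards0 ?addn0; last first.
  apply/setP=> p; rewrite !inE; apply/negP=> /andP[/and3P[_ pI _] /and3P[_ pI' _]].
  by rewrite (disjointFr dI pI) in pI'.
by congr (_ ^+ _); apply: eq_card => p; rewrite !inE -andb_orr -andb_orl.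
Qed.

Lemma shuffle_sign_neq0 (k : fieldType) I J : shuffle_sign d k I J != 0.
Proof. by rewrite signr_eq0. Qed.

Lemma orcoef_vform I K c : I \subset K ->
  orcoef (vform c : ext R (npt d (K :\: I))) = shuffle_sign d R I (K :\: I) * c.
Proof.
move=> sIK; rewrite /orcoef ormul_vform; first by rewrite ffunE eqxx mul1r.
  by rewrite setUC setDE setUIl (setUC (~: _)) setUCr setIT; apply/setUidPl.
by rewrite disjoint_sym disjoints_subset setDE subsetIr.
Qed.

Lemma orcoef_orvol I K : I \subset K ->
  orcoef (orvol R d (K :\: I)) = shuffle_sign d R I (K :\: I).
Proof. by move=> sIK; rewrite orcoef_vform // mulr1. Qed.

Lemma qvolE I K : I \subset K -> qvol R d K I = vform (shuffle_sign d R I (K :\: I))^-1.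
Proof. by move=> sIK; rewrite /qvol orcoef_orvol. Qed.

Lemma orcoef_qvol I K : I \subset K -> orcoef (qvol R d K I) = 1.
Proof. by move=> sIK; rewrite qvolE // orcoef_vform // mulfV ?shuffle_sign_neq0. Qed.

Lemma ormul_qvol I K : I \subset K -> ormul K (orvol R d I) (qvol R d K I) = orvol R d K.
Proof.
move=> sIK; rewrite qvolE // ormul_vform.
- by rewrite mul1r mulfV ?shuffle_sign_neq0.
- by rewrite -{2}(setID K I) (setIidPr sIK).
by rewrite disjoint_sym disjoints_subset setDE subsetIr.
Qed.

(** Both sides compare the order of the blocks I, K minus I, L minus K with that of L: the
    inversions between the three blocks are counted pair by pair, in whichever order they are
    merged. *)
Lemma ormul_qvol_tower I K L : I \subset K -> K \subset L ->
  ormul (L :\: I) (qvol R d K I) (qvol R d L K) = qvol R d L I.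
Proof.
move=> sIK sKL; have sIL := subset_trans sIK sKL.
have EU : (K :\: I) :|: (L :\: K) = L :\: I.
  apply/setP=> a; rewrite !inE; have := subsetP sKL a; have := subsetP sIK a.
  case: (a \in I) => [/(_ isT) -> /(_ isT) -> //|_]; case: (a \in K) => [/(_ isT) -> //|_].
  by case: (a \in L).
have dJ : [disjoint K :\: I & L :\: K].
  apply/pred0P=> a /=; rewrite !inE; by case: (a \in K); rewrite ?andbF.
have dI : [disjoint I & K :\: I] by rewrite disjoint_sym disjoints_subset setDE subsetIr.
rewrite !qvolE // ormul_vform //.
have := shuffle_signUr R I dJ; rewrite EU => ->.
have EK : I :|: (K :\: I) = K by rewrite -{2}(setID K I) (setIidPr sIK).
have := shuffle_signUl R (L :\: K) dI; rewrite EK => ->.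
congr vform; move: (shuffle_sign_neq0 R I (K :\: I)) (shuffle_sign_neq0 R I (L :\: K)).
move: (shuffle_sign_neq0 R (K :\: I) (L :\: K)).
move: (shuffle_sign d R (K :\: I) _) (shuffle_sign d R I _) (shuffle_sign d R I _) => x y z.
by move=> x0 y0 z0; field; rewrite ?x0 ?y0 ?z0.
Qed.

End Orientation.

(** * Maps between spaces of equal dimension *)

(** In coordinates phi is a square matrix of full row space, hence invertible. *)
Lemma onto_bijective (k : fieldType) (V W : lmodType k) n (phi : V -> W) :
  linear phi -> has_dim V n -> has_dim W n -> (forall w, exists v, phi v = w) -> bijective phi.
Proof.
move=> phi_lin [[cV linV [cV' cVK cVK']]] [[cW linW [cW' cWK cWK']]] ontophi.
pose psi (u : 'rV[k]_n) : 'rV[k]_n := cW (phi (cV' u)).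
have psi_lin : linear psi.
  move=> c u v; rewrite /psi -linW -phi_lin; congr (cW (phi _)); apply: (can_inj cVK).
  by rewrite cVK' linV !cVK'.
pose psil : {linear 'rV[k]_n -> 'rV[k]_n} :=
  HB.pack psi (GRing.isLinear.Build _ _ _ _ psi psi_lin).
pose M := lin1_mx psil.
have EM v : cW (phi v) = cV v *m M by rewrite mul_rV_lin1 /= /psi cVK.
have full : row_full M.
  rewrite -sub1mx; apply/row_subP=> i; have [v Ev] := ontophi (cW' (row i 1%:M)).
  by apply/submxP; exists (cV v); rewrite -EM Ev cWK'.
have inj : injective phi.
  move=> v v' Ev; apply: (can_inj cVK).
  have free : row_free M by rewrite row_free_unit -row_full_unit.
  by apply: (row_free_inj free); rewrite -!EM Ev.
have [g gK] := choice ontophi.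
by exists g => // v; apply: inj; rewrite gK.
Qed.

(** The cohomology of a differential depends on the whole structure of linear map, so the
    structures have to be identified, not only the functions. *)
Lemma linear_ext (k : nzRingType) (U V : lmodType k) (f g : {linear U -> V}) : f =1 g -> f = g.
Proof.
case: f g => [f [[f0] [f1]]] [g [[g0] [g1]]] /= /funext E; subst g.
by congr GRing.Linear.Pack; congr GRing.Linear.Class; congr (_ _); apply: Prop_irrelevance.
Qed.

(** * The maps induced in cohomology *)

Section InducedMaps.
Variables (R : realType) (r d m : nat) (P : {mpoly R[i][d]}) (Pk : nat -> {mpoly R[i][d]}).
Variable (Sigma : 'M[R]_r).
Hypothesis m_ge3 : (3 <= m)%N.
Hypothesis P_homog : forall k : nat, (k <= m)%N -> Pk k \is k.-homog.
Hypothesis P_sum : P = \sum_(k < m.+1) Pk k.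
Hypothesis P_crit : forall x : 'I_d -> R[i],
  (forall nu : 'I_d, ((Pk m)^`M(nu)).@[x] = 0) -> forall nu : 'I_d, x nu = 0.
Hypotheses (Sigma_sym : Sigma^T = Sigma) (Sigma_pd : posdef Sigma).
Variable S : {set 'I_r}.
Implicit Types (I K L : {set 'I_r}).
Local Notation k := (kfield R S).
Local Notation iota := (kcst R S).
Local Notation cls K := (@vclass R r d Sigma P K S).
Local Notation H K := (Htop Sigma P K S).

Lemma class_linear K c f g : cls K (c *: f + g) = c *: cls K f + cls K g.
Proof. exact: (top_class_linear (Fphase Sigma P K S) c f g). Qed.

Lemma classB K f g : cls K (f - g) = cls K f - cls K g.
Proof. by have := class_linear (-1) g f; rewrite !scaleN1r [- g + _]addrC [- cls K g + _]addrC. Qed.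

Lemma classZ K c f : cls K (c *: f) = c *: cls K f.
Proof.
have := class_linear (c - 1) f f; rewrite -{2}[f]scale1r -scalerDl subrK => ->.
by rewrite scalerBl scale1r subrK.
Qed.

Lemma class_onto K (h : H K) : exists f, cls K f = h.
Proof. exact: (top_class_onto (F := Fphase Sigma P K S) h). Qed.

(** By linearity this is the descent of contraction to classes, [wick_top_class]. *)
Lemma class_wick I K f g : S \subset I -> I \subset K ->
  cls K f = cls K g -> cls I (wick iota Sigma I f) = cls I (wick iota Sigma I g).
Proof.
move=> sSI sIK Efg; apply/eqP; rewrite -subr_eq0; apply/eqP.
have wB : wick iota Sigma I (f - g) = wick iota Sigma I f - wick iota Sigma I g.
  exact: (raddfB (@wick R r d k iota Sigma K I : {linear _ -> _}) f g).
rewrite -classB -wB.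
have fg0 : cls K (f - g) = 0 by rewrite classB Efg subrr.
exact: (wick_top_class Sigma_sym Sigma_pd sSI sIK (wick_is_wick d iota Sigma_sym Sigma_pd sIK) fg0).
Qed.

(** The representative selected by the quotient differs from f vol_K by a coboundary, which does
    not change the class of the contraction. *)
Lemma Wcoh_class I K be f : S \subset I -> I \subset K ->
  Wcoh be (cls K f) = rsc iota (orcoef be)^-1 *: cls I (wick iota Sigma I f).
Proof.
move=> sSI sIK; set h := cls K f; set c := rsc iota _.
have Eh : cls K (coh_repr h setT) = h.
  rewrite -[RHS]coh_reprK /vclass -isform_full //.
  by case/cocycleP: (coh_reprP h).
have EW : cls I (wick iota Sigma I (coh_repr h setT)) = cls I (wick iota Sigma I f).
  exact: (class_wick sSI sIK Eh).
exact: (etrans (classZ (K := I) c _) (congr1 ( *:%R c) EW)).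
Qed.

Lemma Wcoh_qvol I K f : S \subset I -> I \subset K ->
  Wcoh (qvol R d K I) (cls K f) = cls I (wick iota Sigma I f).
Proof. by move=> sSI sIK; rewrite Wcoh_class // orcoef_qvol // invr1 rsc1 scale1r. Qed.

Lemma Wcoh_orvol I K f : S \subset I -> I \subset K ->
  Wcoh (orvol R d (K :\: I)) (cls K f) =
    shuffle_sign d k I (K :\: I) *: cls I (wick iota Sigma I f).
Proof.
move=> sSI sIK; rewrite (Wcoh_class _ _ sSI sIK) (orcoef_orvol R d sIK); congr (_ *: _).
by rewrite /shuffle_sign /rsc -exprVn invrN1 !rmorphXn /= !rmorphN1.
Qed.

Lemma Wcoh_linear I K be : S \subset I -> I \subset K ->
  linear (Wcoh be : H K -> H I).
Proof.
move=> sSI sIK c h h'; case: (class_onto h) => f <-; case: (class_onto h') => g <-.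
have EW p : Wcoh be (cls K p) = rsc iota (orcoef be)^-1 *: cls I (wick iota Sigma I p).
  exact: Wcoh_class.
have Ew : wick iota Sigma I (c *: f + g) = c *: wick iota Sigma I f + wick iota Sigma I g.
  exact: (linearP (@wick R r d k iota Sigma K I : {linear _ -> _})).
have scaleC (V : lmodType k) (s : k) (x y : V) : s *: (c *: x + y) = c *: (s *: x) + s *: y.
  by rewrite scalerDr !scalerA mulrC.
apply: etrans (congr1 (Wcoh be) (esym (class_linear c f g))) _; apply: etrans (EW _) _.
apply: etrans (congr1 (fun p => _ *: cls I p) Ew) _.
apply: etrans (congr1 ( *:%R _) (class_linear c _ _)) _; apply: etrans (scaleC _ _ _ _) _.
exact: esym (congr2 (fun x y => c *: x + y) (EW f) (EW g)).
Qed.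

(** Contraction is onto because it undoes the inclusion of polynomials in x_I, and both spaces
    have the dimension ((m - 1) ^ d) ^ |S|. *)
Lemma Wcoh_bijective I K : S \subset I -> I \subset K ->
  bijective (Wcoh (qvol R d K I) : H K -> H I).
Proof.
move=> sSI sIK; have sSK := subset_trans sSI sIK.
have [_ dimK] := Fphase_cohomology m_ge3 P_homog P_sum P_crit Sigma_sym Sigma_pd sSK.
have [_ dimI] := Fphase_cohomology m_ge3 P_homog P_sum P_crit Sigma_sym Sigma_pd sSI.
apply: (onto_bijective (Wcoh_linear (qvol R d K I) sSI sIK) dimK dimI) => h.
case: (class_onto h) => f <-.
have Ef : wick iota Sigma I (embed K f) = f by apply: wick_embed.
have E1 := Wcoh_qvol (embed K f) sSI sIK.
have E2 := congr1 (cls I) Ef.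
have E3 := etrans E1 E2.
exists (cls K (embed K f)).
exact E3.
Qed.

Lemma Wcoh_comp I K L (h : H L) : S \subset I -> I \subset K -> K \subset L ->
  Wcoh (qvol R d K I) (Wcoh (qvol R d L K) h) = Wcoh (I := I) (qvol R d L I) h.
Proof.
move=> sSI sIK sKL; case: (class_onto h) => f <-.
have sSK := subset_trans sSI sIK.
have Ef := wick_comp iota Sigma_sym Sigma_pd f sIK sKL.
apply: etrans (congr1 (Wcoh (qvol R d K I)) (Wcoh_qvol f sSK sKL)) _.
apply: etrans (Wcoh_qvol _ sSI sIK) _; apply: etrans (congr1 (cls I) Ef) _.
exact: esym (Wcoh_qvol f sSI (subset_trans sIK sKL)).
Qed.

End InducedMaps.

(** * Specialisation of the universal complex *)

Section BaseChange.
Variables (A B : comNzRingType) (phi : {rmorphism A -> B}).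

Lemma mcoeff_base_change n (p : {mpoly A[n]}) l : (map_mpoly phi p)@_l = phi p@_l.
Proof. exact: mcoeff_map_mpoly. Qed.

Lemma map_mpoly_deriv n (p : {mpoly A[n]}) v :
  map_mpoly phi p^`M(v) = (map_mpoly phi p)^`M(v).
Proof. by apply/mpolyP=> m; rewrite mcoeff_base_change !mcoeff_deriv mcoeff_base_change rmorphMn. Qed.

Lemma map_mpoly_scale n c (p : {mpoly A[n]}) : map_mpoly phi (c *: p) = phi c *: map_mpoly phi p.
Proof. by apply/mpolyP=> m; rewrite !(mcoeff_base_change, mcoeffZ) rmorphM. Qed.

Lemma map_mpoly_var n v : map_mpoly phi ('X_v : {mpoly A[n]}) = 'X_v.
Proof. by apply/mpolyP=> m; rewrite mcoeff_base_change !mcoeffX rmorph_nat. Qed.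

Lemma map_mpoly_const n c : map_mpoly phi (c%:MP : {mpoly A[n]}) = (phi c)%:MP.
Proof. by apply/mpolyP=> m; rewrite mcoeff_base_change !mcoeffC rmorphM rmorph_nat. Qed.

Definition form_map n (w : forms A n) : forms B n := [ffun D : {set 'I_n} => map_mpoly phi (w D)].

Lemma form_map_mono n l (D : {set 'I_n}) :
  form_map (ext_mono 'X_[l] D : forms A n) = ext_mono 'X_[l] D.
Proof.
apply/ffunP=> D'; rewrite !ffunE; case: ifP => _; last exact: rmorph0.
by apply/mpolyP=> l'; rewrite mcoeff_base_change !mcoeffX rmorph_nat.
Qed.

Lemma form_map_nabla n F (w : forms A n) :
  form_map (nabla F w) = nabla (map_mpoly phi F) (form_map w).
Proof.
apply/ffunP=> D; rewrite ffunE !nablaE rmorph_sum; apply: eq_bigr => v _.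
rewrite rmorphM rmorphD rmorphM /= ffunE !map_mpoly_deriv; congr (_ * _).
by rewrite /ext_sign rmorphXn rmorphN1.
Qed.

Section Phase.
Variables (R : realType) (r d : nat) (Sigma : 'M[R]_r) (P : {mpoly R[i][d]}).
Variables (iota : {rmorphism R[i] -> A}) (iota' : {rmorphism R[i] -> B}).
Hypothesis phi_iota : forall c, phi (iota c) = iota' c.
Variables (K S : {set 'I_r}) (t : 'I_r -> A) (t' : 'I_r -> B).
Hypothesis phi_t : forall a, a \in K -> phi (t a) = if a \in S then t' a else 0.

(** The couplings outside S are sent to zero, and their potentials disappear. *)
Lemma map_phase : map_mpoly phi (phase iota Sigma P K K t) = phase iota' Sigma P K S t'.
Proof.
have x_map i nu : map_mpoly phi (xmat d A K i nu) = xmat d B K i nu.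
  by rewrite !mxE map_mpoly_var.
have mapD (f g : {mpoly A[npt d K]}) :
    map_mpoly phi (f + g) = map_mpoly phi f + map_mpoly phi g by apply: rmorphD.
have mapN (f : {mpoly A[npt d K]}) : map_mpoly phi (- f) = - map_mpoly phi f by apply: rmorphN.
have mapM (f g : {mpoly A[npt d K]}) :
    map_mpoly phi (f * g) = map_mpoly phi f * map_mpoly phi g by apply: rmorphM.
have mapS (I : finType) (Q : pred I) (f : I -> {mpoly A[npt d K]}) :
    map_mpoly phi (\sum_(i | Q i) f i) = \sum_(i | Q i) map_mpoly phi (f i).
  exact: rmorph_sum.
rewrite /phase mapD mapN !map_mpoly_scale !mapS /rsc phi_iota; congr (- (_ *: _) + _).
  apply: eq_bigr => i _; rewrite mapS; apply: eq_bigr => j _.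
  rewrite map_mpoly_scale phi_iota; congr (_ *: _).
  rewrite mapS; apply: eq_bigr => nu _.
  by rewrite mapM !x_map.
rewrite phi_iota; congr (_ *: _).
rewrite big_mkcond [RHS]big_mkcond; apply: eq_bigr => i _ /=.
rewrite enum_valP map_mpoly_scale phi_t ?enum_valP //; case: ifP => _; last by rewrite scale0r.
congr (_ *: _); rewrite /Pat; elim/mpoly_gen_ind: P => [c|nu|p q IHp IHq|p q IHp IHq].
- by rewrite !mmapC /= map_mpoly_const phi_iota.
- by rewrite !mmapX !mmap1U x_map.
- by rewrite !mmapD mapD IHp IHq.
by rewrite !rmorphM /= IHp IHq.
Qed.

End Phase.
End BaseChange.

(** The forms with one monomial coefficient span all forms. *)
Lemma forms_linear_ext (A : comNzRingType) n (f g : {linear forms A n -> forms A n}) :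
  (forall l (B : {set 'I_n}), f (ext_mono 'X_[l] B) = g (ext_mono 'X_[l] B)) -> f = g.
Proof.
move=> Efg; apply: linear_ext => w.
have -> : w = \sum_B ext_mono (w B) B.
  apply/ffunP=> B; rewrite sum_ffunE (bigD1 B) //= ffunE eqxx big1 ?addr0 // => B' nB.
  by rewrite ffunE eq_sym (negPf nB).
rewrite !linear_sum; apply: eq_bigr => B _.
rewrite [w B]mpolyE; elim/big_rec: _ => [|l q _ IH].
  have -> : ext_mono 0 B = 0 :> forms A n by apply/ffunP=> B'; rewrite !ffunE if_same.
  by rewrite !linear0.
have -> : ext_mono ((w B)@_l *: 'X_[l] + q) B =
    (w B)@_l *: ext_mono 'X_[l] B + ext_mono q B :> forms A n.
  apply/ffunP=> B'; rewrite [RHS]ffunE [X in _ = X + _]ffunE !ffunE.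
  by case: ifP => // _; rewrite scaler0 addr0.
by rewrite !linearP /= IH Efg.
Qed.

Definition twisted_diff (A : comNzRingType) n (F : {mpoly A[n]}) :
  {linear forms A n -> forms A n} := nabla F.

Section Specialisation.
Variables (R : realType) (r d : nat) (Sigma : 'M[R]_r) (P : {mpoly R[i][d]}).
Variables (S K : {set 'I_r}).
Local Notation k := (kfield R S).

Definition tspec_morphism : {rmorphism {mpoly R[i][#|K|]} -> k} :=
  mmap (kcst R S) (fun i : 'I_#|K| => if enum_val i \in S then kvar R S (enum_val i) else 0).

Lemma Funiv_spec : map_mpoly tspec_morphism (Funiv Sigma P K) = Fphase Sigma P K S.
Proof.
apply: map_phase => // [c|a aK]; first by rewrite /tspec_morphism /= mmapC.
rewrite /tspec_morphism /tpoly; case: posP => [i Ei _|]; last by rewrite aK.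
by rewrite /= mmapX mmap1U Ei.
Qed.

Lemma nabla_specialised :
  @specialised_diff R r d Sigma P K S (twisted_diff (Fphase Sigma P K S)).
Proof.
move=> w; have E := form_map_nabla tspec_morphism (Funiv Sigma P K) w.
rewrite Funiv_spec in E; exact: esym E.
Qed.

(** Monomial forms are specialisations of universal forms, and they span. *)
Lemma specialised_diff_uniq (D : {linear forms k (npt d K) -> forms k (npt d K)}) :
  specialised_diff Sigma P D -> D = twisted_diff (Fphase Sigma P K S).
Proof.
move=> HD; apply: forms_linear_ext => l B.
have E := form_map_mono tspec_morphism l B.
apply: etrans (congr1 D (esym E)) _; apply: etrans (HD (ext_mono 'X_[l] B)) _.
exact: etrans (esym (nabla_specialised (ext_mono 'X_[l] B))) (congr1 (twisted_diff _) E).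
Qed.

End Specialisation.

(** * Conditional restrictions of Gaussian-polynomial cohomology *)

Theorem theorem6p1 (R : realType) (d m r : nat)
    (P : {mpoly R[i][d]}) (Pk : nat -> {mpoly R[i][d]}) (Sigma : 'M[R]_r)
    (m_ge3 : (3 <= m)%N)
    (P_homog : forall k : nat, (k <= m)%N -> Pk k \is k.-homog)
    (P_sum : P = \sum_(k < m.+1) Pk k)
    (P_crit : forall x : 'I_d -> R[i],
       (forall nu : 'I_d, ((Pk m)^`M(nu)).@[x] = 0) -> forall nu : 'I_d, x nu = 0)
    (Sigma_sym : Sigma^T = Sigma)
    (Sigma_pd : posdef Sigma) :
  [/\ (* (i) *)
      forall S K : {set 'I_r}, S \subset K ->
        (forall q : nat, q != (#|K| * d)%N ->
           forall h : coh (nabla (Fphase Sigma P K S)) q, h = 0) /\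
        has_dim (coh (nabla (Fphase Sigma P K S)) (#|K| * d))
          (((m - 1) ^ d) ^ #|S|)%N,
      (* (ii) *)
      forall S I K : {set 'I_r}, S \subset I -> I \subset K ->
        [/\ forall g : {mpoly (kfield R S)[npt d I + npt d (K :\: I)]},
              exists N : nat, forall n : nat, (N <= n)%N ->
                gexp_term (kcst R S) Sigma n g = 0 /\
                \sum_(k < n) gexp_term (kcst R S) Sigma k g
                  = gexp (kcst R S) Sigma g,
            ormul K (orvol R d I) (qvol R d K I) = orvol R d K,
            linear (@Wcoh R r d Sigma P K I S (qvol R d K I)),
            bijective (@Wcoh R r d Sigma P K I S (qvol R d K I)) &
            forall f : {mpoly (kfield R S)[npt d K]},
              Wcoh (qvol R d K I) (vclass Sigma P f) =
                vclass Sigma P (wick (kcst R S) Sigma I f) /\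
              Wcoh (orvol R d (K :\: I)) (vclass Sigma P f) =
                shuffle_sign d (kfield R S) I (K :\: I) *:
                  vclass Sigma P (wick (kcst R S) Sigma I f)],
      (* (iii) *)
      forall S I K L : {set 'I_r}, S \subset I -> I \subset K -> K \subset L ->
        [/\ forall f : {mpoly (kfield R S)[npt d L]},
              wick (kcst R S) Sigma I (wick (kcst R S) Sigma K f) =
                wick (kcst R S) Sigma I f,
            ormul (L :\: I) (qvol R d K I) (qvol R d L K) = qvol R d L I,
            forall h : Htop Sigma P L S,
              Wcoh (qvol R d K I) (Wcoh (qvol R d L K) h) =
                Wcoh (qvol R d L I) h &
            forall K' : {set 'I_r}, I \subset K' -> K' \subset L ->
              forall h : Htop Sigma P L S,
                Wcoh (qvol R d K I) (Wcoh (qvol R d L K) h) =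
                  Wcoh (I := I) (qvol R d K' I) (Wcoh (qvol R d L K') h)] &
      (* (iv) *)
      forall S K : {set 'I_r}, S \subset K ->
        (exists D : {linear forms (kfield R S) (npt d K) ->
                            forms (kfield R S) (npt d K)},
           specialised_diff Sigma P D) /\
        (forall D : {linear forms (kfield R S) (npt d K) ->
                            forms (kfield R S) (npt d K)},
           specialised_diff Sigma P D ->
           (forall q : nat, q != (#|K| * d)%N -> forall h : coh D q, h = 0) /\
           exists Phi : {linear coh D (#|K| * d) -> Htop Sigma P K S},
             bijective Phi /\
             forall f : {mpoly (kfield R S)[npt d K]},
               Phi (coh_class D (#|K| * d) (vform f)) = vclass Sigma P f)].
Proof.
have part1 (S K : {set 'I_r}) (sSK : S \subset K) := Fphase_cohomology m_ge3 P_homog P_sum P_crit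
  Sigma_sym Sigma_pd sSK.
split.
- exact: part1.
- move=> S I K sSI sIK; split.
  + move=> g; exists (msize g) => n le_gn; split.
      exact: gexp_term_large.
    by rewrite (gexpE _ _ le_gn).
  + exact: ormul_qvol.
  + exact: Wcoh_linear.
  + exact: (Wcoh_bijective m_ge3 P_homog P_sum P_crit Sigma_sym Sigma_pd sSI sIK).
  + move=> f; split; first exact: Wcoh_qvol.
    exact: Wcoh_orvol.
- move=> S I K L sSI sIK sKL; split.
  + move=> f; exact: wick_comp.
  + exact: ormul_qvol_tower.
  + move=> h; exact: Wcoh_comp.
  + move=> K' sIK' sK'L h.
    have E1 := Wcoh_comp Sigma_sym Sigma_pd h sSI sIK sKL.
    have E2 := Wcoh_comp Sigma_sym Sigma_pd h sSI sIK' sK'L.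
    exact (etrans E1 (esym E2)).
move=> S K sSK; split; first by exists (twisted_diff (Fphase Sigma P K S)); apply: nabla_specialised.
move=> D /specialised_diff_uniq ->; split; first by case: (part1 S K sSK).
by exists idfun; split=> //; exists id.
Qed.
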